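(* Let $Y=PGL(3,\mathbb{Q}_2)/PGL(3,\mathbb{Z}_2)$ be the $\widetilde A_2$-building of $PGL(3,\mathbb{Q}_2)$ with its CAT(0) metric. Then for all $p\in Y$, $$\delta(TC_pY)\le\frac{37-18\sqrt2}{28}\;(=0.4122\cdots).$$
   Context: The building $Y$: its vertices are the elements of $PGL(3,\mathbb{Q}_2)/PGL(3,\mathbb{Z}_2)$, i.e. homothety classes $[L]$ of $\mathbb{Z}_2$-lattices $L$ in $\mathbb{Q}_2^3$; distinct classes span a simplex if they have representatives forming a chain $L_0\supsetneq L_1\supsetneq\cdots\supsetneq L_k\supsetneq 2L_0$. $Y$ is the geometric realization of this 2-dimensional complex with the length metric making each triangle a Euclidean equilateral triangle of a fixed side length; it is a Hadamard space (complete CAT(0) space). For $p\in Y$, the tangent cone $TC_pY$ is the Euclidean cone over the space of directions $S_pY$ (completion of the set of nontrivial geodesics from $p$ modulo angle zero, with the angle metric $\angle_p$): $d((V,t),(V',t'))^2=t^2+t'^2-2tt'\cos\angle_p(V,V')$. It is a Hadamard space. (If $p$ is a vertex, $TC_pY$ is the metric cone over the incidence graph of points and lines of the projective plane over $\mathbb{Z}/2\mathbb{Z}$, each edge having length $\pi/3$, with angles truncated at $\pi$.) The barycenter of $v_1,\dots,v_n$ with weight $t_i\ge 0$, $\sum t_i=1$, in a Hadamard space is the unique minimizer of $q\mapsto\sum t_id(v_i,q)^2$. The invariant $\delta$: let $T$ be a Hadamard space, $v_1,\dots,v_n\in T$ distinct points ($n\ge2$), $t_i>0$ with $\sum t_i=1$,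 and $\overline v$ the barycenter of $\{v_i\}$ with weight $\{t_i\}$. A realization of $\{v_i\}$ is a collection of vectors $\mathbf v_1,\dots,\mathbf v_n\in\mathbb{R}^N$ for some $N$ with $\|\mathbf v_i\|=d_T(\overline v,v_i)$ and $\|\mathbf v_i-\mathbf v_j\|\le d_T(v_i,v_j)$. Put $\delta(\{v_i\},\{t_i\})=\inf\big[\|\sum_i t_i\mathbf v_i\|^2/\sum_i t_i\|\mathbf v_i\|^2\big]$ over all realizations, and $\delta(T)=\sup\delta(\{v_i\},\{t_i\})\in[0,1]$ over all such collections. *)

(* Defs.v *)
From HB Require Import structures.
From mathcomp Require Import all_boot all_order all_algebra.
From mathcomp Require Import all_classical all_reals all_analysis.

Set Implicit Arguments.
Unset Strict Implicit.
Unset Printing Implicit Defensive.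
Import Order.TTheory GRing.Theory Num.Theory numFieldNormedType.Exports.
Local Open Scope classical_set_scope.
Local Open Scope ring_scope.

(* Z_2 as the inverse limit of the Z/2^n: [res x n] is the residue of x
   modulo 2^n, taken in {0, .., 2^n - 1}. *)
Record Z2 := MkZ2 {
  res : nat -> nat;
  res_coherent : forall n, (res n.+1 %% 2 ^ n)%N = res n }.

HB.instance Definition _ := gen_eqMixin Z2.
HB.instance Definition _ := gen_choiceMixin Z2.

Section Z2_ring.
Local Open Scope nat_scope.

Lemma Z2_eqP (x y : Z2) : (forall n, res x n = res y n) -> x = y.
Proof.
case: x y => [f hf] [g hg] /= /funext e; case: _ / e in hg *.
by congr MkZ2; exact: Prop_irrelevance.
Qed.

Lemma res_modn (x : Z2) n : res x n %% 2 ^ n = res x n.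
Proof. by rewrite -res_coherent modn_mod. Qed.

Lemma modn_expS m n : m %% 2 ^ n.+1 %% 2 ^ n = m %% 2 ^ n.
Proof. by rewrite modn_dvdm // dvdn_exp2l. Qed.

Lemma res_modn_leq (x : Z2) m n : m <= n -> res x n %% 2 ^ m = res x m.
Proof.
move=> /subnK <-; elim: (n - m) => [|k IH]; first by rewrite res_modn.
by rewrite -IH -(res_coherent x (k + m)) modn_dvdm // dvdn_exp2l // leq_addl.
Qed.

Lemma Z2_of_nat_proof k n : k %% 2 ^ n.+1 %% 2 ^ n = k %% 2 ^ n.
Proof. exact: modn_expS. Qed.
Definition Z2_of_nat k := MkZ2 (Z2_of_nat_proof k).

Lemma Z2_add_proof (x y : Z2) n :
  (res x n.+1 + res y n.+1) %% 2 ^ n.+1 %% 2 ^ n = (res x n + res y n) %% 2 ^ n.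
Proof. by rewrite modn_expS -modnDm !res_coherent. Qed.
Definition Z2_add x y := MkZ2 (Z2_add_proof x y).

Lemma Z2_mul_proof (x y : Z2) n :
  (res x n.+1 * res y n.+1) %% 2 ^ n.+1 %% 2 ^ n = (res x n * res y n) %% 2 ^ n.
Proof. by rewrite modn_expS -modnMm !res_coherent. Qed.
Definition Z2_mul x y := MkZ2 (Z2_mul_proof x y).

Lemma res_leq (x : Z2) n : res x n <= 2 ^ n.
Proof. by rewrite -res_modn ltnW // ltn_mod expn_gt0. Qed.

Lemma Z2_opp_proof (x : Z2) n :
  (2 ^ n.+1 - res x n.+1) %% 2 ^ n.+1 %% 2 ^ n = (2 ^ n - res x n) %% 2 ^ n.
Proof.
rewrite modn_expS; apply/eqP; rewrite -(eqn_modDr (res x n)).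
rewrite subnK ?res_leq // modnn -{1}(res_coherent x n) modnDmr.
by rewrite subnK ?res_leq // expnS modnMl.
Qed.
Definition Z2_opp x := MkZ2 (Z2_opp_proof x).

Lemma Z2_addA : associative Z2_add.
Proof. by move=> x y z; apply: Z2_eqP => n /=; rewrite modnDml modnDmr addnA. Qed.
Lemma Z2_addC : commutative Z2_add.
Proof. by move=> x y; apply: Z2_eqP => n /=; rewrite addnC. Qed.
Lemma Z2_add0 : left_id (Z2_of_nat 0) Z2_add.
Proof. by move=> x; apply: Z2_eqP => n /=; rewrite mod0n res_modn. Qed.
Lemma Z2_addN : left_inverse (Z2_of_nat 0) Z2_opp Z2_add.
Proof.
by move=> x; apply: Z2_eqP => n /=; rewrite modnDml subnK ?res_leq // modnn mod0n.
Qed.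
Lemma Z2_mulA : associative Z2_mul.
Proof. by move=> x y z; apply: Z2_eqP => n /=; rewrite modnMml modnMmr mulnA. Qed.
Lemma Z2_mulC : commutative Z2_mul.
Proof. by move=> x y; apply: Z2_eqP => n /=; rewrite mulnC. Qed.
Lemma Z2_mul1 : left_id (Z2_of_nat 1) Z2_mul.
Proof. by move=> x; apply: Z2_eqP => n /=; rewrite modnMml mul1n res_modn. Qed.
Lemma Z2_mulD : left_distributive Z2_mul Z2_add.
Proof.
by move=> x y z; apply: Z2_eqP => n /=; rewrite modnMml modnDm mulnDl.
Qed.
Lemma Z2_1neq0 : Z2_of_nat 1 != Z2_of_nat 0.
Proof. by apply/eqP => /(congr1 (res ^~ 1)). Qed.

End Z2_ring.

HB.instance Definition _ := GRing.isZmodule.Build Z2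
  Z2_addA Z2_addC Z2_add0 Z2_addN.
HB.instance Definition _ := GRing.Zmodule_isComNzRing.Build Z2
  Z2_mulA Z2_mulC Z2_mul1 Z2_mulD Z2_1neq0.

Definition Z2_unit : pred Z2 := fun x => `[< exists y : Z2, y * x = 1 >].
Definition Z2_inv (x : Z2) : Z2 :=
  if pselect (exists y : Z2, y * x = 1) is left h then projT1 (cid h) else x.

Lemma Z2_mulVx : {in Z2_unit, left_inverse 1 Z2_inv *%R}.
Proof.
move=> x /asboolP hx; rewrite /Z2_inv; case: pselect => // h.
exact: (projT2 (cid h)).
Qed.
Lemma Z2_unitP (x y : Z2) : y * x = 1 -> Z2_unit x.
Proof. by move=> h; apply/asboolP; exists y. Qed.
Lemma Z2_inv_out : {in [predC Z2_unit], Z2_inv =1 id}.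
Proof.
move=> x /negP hx; rewrite /Z2_inv; case: pselect => // h.
by case: hx; apply/asboolP.
Qed.

HB.instance Definition _ := GRing.ComNzRing_hasMulInverse.Build Z2
  Z2_mulVx Z2_unitP Z2_inv_out.

Lemma Z2_idomain : GRing.integral_domain_axiom Z2.
Proof.
move=> x y xy0; apply/negPn; rewrite negb_or; apply/negP => /andP[x0 y0].
have nz (z : Z2) : z != 0 -> exists n, ~~ (2 ^ n %| res z n)%N.
  move=> z0; apply: contrapT => /forallNP h; move/eqP: z0; apply.
  apply: Z2_eqP => n /=; rewrite mod0n -res_modn.
  by move/negP: (h n); rewrite negbK => /eqP.
have [a ha] := nz _ x0; have [b hb] := nz _ y0.
have up (z : Z2) m n : (m <= n)%N -> (2 ^ m %| res z n)%N = (2 ^ m %| res z m)%N.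
  by move=> mn; rewrite /dvdn res_modn_leq // res_modn.
have : (2 ^ (a + b) %| res x (a + b) * res y (a + b))%N.
  by have /(congr1 (res ^~ (a + b)%N)) /= := xy0; rewrite mod0n => /eqP.
move: ha hb; rewrite -(up x a (a + b)%N) ?leq_addr // -(up y b (a + b)%N) ?leq_addl //.
set u := res x _; set v := res y _ => hu hv.
have u0 : (0 < u)%N by rewrite lt0n; apply: contraNneq hu => ->.
have v0 : (0 < v)%N by rewrite lt0n; apply: contraNneq hv => ->.
rewrite !pfactor_dvdn ?muln_gt0 ?u0 ?v0 // in hu hv *.
rewrite -ltnNge in hu; rewrite -ltnNge in hv.
by rewrite lognM // leqNgt -addnS leq_add // ltnW.
Qed.

HB.instance Definition _ := GRing.ComUnitRing_isIntegral.Build Z2 Z2_idomain.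

Definition Q2 : fieldType := {fraction Z2}.

Definition Z2_span (B : 'M[Q2]_3) : set 'rV[Q2]_3 :=
  [set u | exists c : 'rV[Z2]_3, u = map_mx (@tofrac Z2) c *m B].

Definition is_lattice (L : set 'rV[Q2]_3) : Prop :=
  exists2 B : 'M[Q2]_3, B \in unitmx & L = Z2_span B.

Definition dilate (a : Q2) (L : set 'rV[Q2]_3) : set 'rV[Q2]_3 :=
  [set a *: u | u in L].

Definition homothety_class (L : set 'rV[Q2]_3) : set (set 'rV[Q2]_3) :=
  [set dilate a L | a in [set a : Q2 | a != 0]].

(* GL(3, Q_2) acts transitively on the lattices and the stabilizer of the
   standard one is GL(3, Z_2), so this is PGL(3, Q_2) / PGL(3, Z_2). *)
Definition vertex : Type :=
  {A : set (set 'rV[Q2]_3) |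
    exists2 L, is_lattice L & A = homothety_class L}.

HB.instance Definition _ := gen_eqMixin vertex.
HB.instance Definition _ := gen_choiceMixin vertex.

(* A `<` B is strict inclusion. *)
Definition is_simplex (S : set vertex) : Prop :=
  exists (k : nat) (L : 'I_k.+1 -> set 'rV[Q2]_3),
  [/\ forall i, is_lattice (L i),
      forall i j : 'I_k.+1, (i < j)%N -> L j `<` L i,
      dilate 2 (L ord0) `<` L ord_max
    & S = [set v | exists i, sval v = homothety_class (L i)]].

(* A point of the geometric realization, by its barycentric coordinates. *)
Record building (R : realType) := Building {
  coord :> vertex -> R;
  coord_ge0 : forall v, 0 <= coord v;
  coord_sum : \sum_(v \in [set: vertex]) coord v = 1;
  coord_simplex : is_simplex [set v | coord v != 0] }.

Section BuildingMetric.
Variables (R : realType) (side : R).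
Implicit Types x y : building R.

Definition in_common_simplex x y : Prop :=
  exists S, [/\ is_simplex S, [set v | x v != 0] `<=` S
              & [set v | y v != 0] `<=` S].

(* In barycentric coordinates, the standard simplex of R^3 is an equilateral
   triangle of side sqrt 2. *)
Definition simplex_dist x y : R :=
  side * Num.sqrt ((\sum_(v \in [set: vertex]) (x v - y v) ^+ 2) / 2).

Definition is_string x y (m : nat) (z : nat -> building R) : Prop :=
  [/\ z 0%N = x, z m = y
    & forall i, (i < m)%N -> in_common_simplex (z i) (z i.+1)].

Definition string_length (m : nat) (z : nat -> building R) : R :=
  \sum_(i < m) simplex_dist (z i) (z i.+1).

(* The length metric; the building is connected, so that the infimum is over
   a nonempty set. *)
Definition building_dist x y : R :=
  inf [set l | exists m z, is_string x y m z /\ l = string_length m z].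

End BuildingMetric.

(* Here and below a metric space is given by a type T and its distance
   function d : T -> T -> R. The points of the metric space associated with a
   pseudometric d are the classes of points at distance zero. *)
Section Identification.
Variables (R : realType) (T : Type) (d : T -> T -> R).

Definition metric_quotient : Type :=
  {A : set T | exists x, A = [set y | d x y = 0]}.

Definition mq_repr (A : metric_quotient) : T := projT1 (cid (svalP A)).

Definition mq_dist (A B : metric_quotient) : R := d (mq_repr A) (mq_repr B).

End Identification.

(* The completion of a pseudometric space, as Cauchy sequences modulo
   sequences at distance zero; it incorporates the identification of points
   at distance zero. *)
Section Completion.
Variables (R : realType) (T : Type) (d : T -> T -> R).

Record cauchy_seq := CauchySeq {
  cs_val :> nat -> T;
  cs_cauchy : forall e : R, 0 < e -> exists N : nat, forall m n : nat,
    (N <= m)%N -> (N <= n)%N -> d (cs_val m) (cs_val n) < e }.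

Definition cs_dist (u w : cauchy_seq) : R := limn (fun n => d (u n) (w n)).

Definition completion : Type := metric_quotient cs_dist.
Definition completion_dist : completion -> completion -> R :=
  @mq_dist R cauchy_seq cs_dist.

End Completion.

Section TangentCone.
Variables (R : realType) (T : Type) (d : T -> T -> R) (p : T).

(* Nontrivial geodesics issuing from p, parametrized by arc length; the values
   of geo outside of [0, geo_len] are irrelevant. *)
Record geodesic := Geodesic {
  geo_len : R;
  geo :> R -> T;
  geo_len_gt0 : 0 < geo_len;
  geo_start : geo 0 = p;
  geo_isometric : forall s t, s \in `[0, geo_len] -> t \in `[0, geo_len] ->
    d (geo s) (geo t) = `|s - t| }.

(* The angle at p of a Euclidean triangle with the same side lengths as
   (p, c s, c' t). *)
Definition comparison_angle (c c' : geodesic) (s t : R) : R :=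
  acos ((s ^+ 2 + t ^+ 2 - d (c s) (c' t) ^+ 2) / (2 * s * t)).

(* The limit superior as (s, t) tends to (0, 0) with s, t > 0; in a CAT(0)
   space it is a limit. *)
Definition angle (c c' : geodesic) : R :=
  fine (limf_esup (fun st : R * R => (comparison_angle c c' st.1 st.2)%:E)
                  (filter_prod (0:R)^'+ (0:R)^'+)).

Definition directions : Type := completion angle.
Definition direction_dist : directions -> directions -> R :=
  @completion_dist R geodesic angle.

Definition cone_pdist (x y : directions * {nonneg R}) : R :=
  Num.sqrt (x.2%:num ^+ 2 + y.2%:num ^+ 2
            - 2 * x.2%:num * y.2%:num * cos (direction_dist x.1 y.1)).

(* The identification collapses the pairs (V, 0) to the apex. *)
Definition tangent_cone : Type := metric_quotient cone_pdist.
Definition tangent_cone_dist : tangent_cone -> tangent_cone -> R :=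
  @mq_dist R (directions * {nonneg R}) cone_pdist.

End TangentCone.

Arguments tangent_cone {R T} d p.
Arguments tangent_cone_dist {R T} d p _ _.

(* The norm of 'rV[R]_N in the library is the sup norm. *)
Definition eucl_norm (R : realType) (N : nat) (w : 'rV[R]_N) : R :=
  Num.sqrt (\sum_(j < N) w 0 j ^+ 2).

Section Delta.
Variables (R : realType) (T : Type) (d : T -> T -> R).

Definition is_barycenter (n : nat) (v : 'I_n -> T) (t : 'I_n -> R) (q : T) :
    Prop :=
  forall q', q' <> q ->
    \sum_(i < n) t i * d (v i) q ^+ 2 < \sum_(i < n) t i * d (v i) q' ^+ 2.

Definition is_realization (n : nat) (v : 'I_n -> T) (b : T)
    (N : nat) (w : 'I_n -> 'rV[R]_N) : Prop :=
  (forall i, eucl_norm (w i) = d b (v i)) /\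
  (forall i j, eucl_norm (w i - w j) <= d (v i) (v j)).

Definition realization_ratio (n : nat) (t : 'I_n -> R) (N : nat)
    (w : 'I_n -> 'rV[R]_N) : R :=
  eucl_norm (\sum_(i < n) t i *: w i) ^+ 2
  / \sum_(i < n) t i * eucl_norm (w i) ^+ 2.

Definition delta_at (n : nat) (v : 'I_n -> T) (t : 'I_n -> R) (b : T) :
    \bar R :=
  ereal_inf [set r : \bar R | exists N (w : 'I_n -> 'rV[R]_N),
    is_realization v b w /\ r = (realization_ratio t w)%:E].

Definition delta : \bar R :=
  ereal_sup [set r : \bar R |
    exists (n : nat) (v : 'I_n -> T) (t : 'I_n -> R) (b : T),
    [/\ (2 <= n)%N /\ injective v,
        forall i, 0 < t i, \sum_(i < n) t i = 1,
        is_barycenter v t b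
      & r = delta_at v t b]].

End Delta.

Arguments delta {R T} d.

(* Main.v *)
Require Import Defs.
From mathcomp Require Import all_boot all_order all_algebra.
From mathcomp Require Import cyclic ring lra.
From mathcomp Require Import all_classical all_reals all_analysis.

(** The link of a vertex v0 of the building is the incidence graph of the Fano
    plane, and the barycentric coordinates of a point x of the open star of v0
    give a vector of R^14 with nonnegative entries supported on a clique. In
    this model the squared distance is D (x - y), where D is the (indefinite)
    quadratic form whose matrix entries are the cosines of the distances of the
    graph: it agrees with the Euclidean metric on each apartment, and foldings
    onto apartments, which are linear on R^14, give the opposite inequality. So
    near p the building is isometric to that cone near the vector b of p, and
    the tangent cone at p is the set of vectors pointing from b into the cone,
    again with squared distance D.

    Let s = sum t_i (v_i - beta), with beta the barycenter. The first variation
    gives D (eta, s) <= 0 for every eta pointing from beta into the tangent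
    cone. A linear map given by a positive semidefinite matrix G >= D which
    agrees with D on chambers and on the rows of the support of b and beta maps
    the v_i - beta to a realization, and it remains to choose G. If the support
    is a chamber, G is the folding onto an apartment and G (s, s) = 0. If it is
    one vertex, G folds onto a book with three half-planes at angle 2 pi / 3,
    and the ratio is at most 1/4. If it is empty, then D (s, s) <= 0, and a
    matrix G with entries 1, 1/2, -3/32, -17/64 (by distance) satisfies
    G (u, w) <= K |u| |w| + (1 - K) D (u, w) on the cone with K = 13/32, which
    is smaller than (37 - 18 sqrt 2) / 28. *)

Set Implicit Arguments.
Unset Strict Implicit.
Unset Printing Implicit Defensive.
Import Order.TTheory GRing.Theory Num.Theory numFieldNormedType.Exports.
Local Open Scope classical_set_scope.
Local Open Scope ring_scope.

(** * The Fano plane and its incidence graph *)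

Section Heawood.
Local Open Scope nat_scope.

(** The cone over the link branches, so no Euclidean copy of it is isometric. A realization has to
    keep only the distances to the barycenter and may shrink the others, which is why one matrix is
    needed for each kind of support. For the empty support the constants come from a spectral
    condition. Asking [(G - (1 - K) D) / K] to be 1/2 at distance 2 forces the entry [K - 1/2] of
    [G] there; let [g] be the entry at distance 3. On the vectors that are constant on points and on
    lines, positivity of [G] reads [|3/2 + 4 g| <= 6 K - 2]. On their complement the incidence
    matrix of the Fano plane has singular value [sqrt 2], and positivity reads
    [sqrt 2 |1/2 - g| <= 3/2 - K]. With the largest [g] allowed by the first condition,
    [g = 3 K / 2 - 7/8], the second becomes [K >= (3 - sqrt 2) / 4 = 0.396...] for the [K] of
    interest. The value 13/32 is a rational number between this and the bound to be proved, and it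
    gives [g = -17/64]. Rational entries let every property of the matrices be checked by integer
    computation. *)

Definition F23 := (bool * bool * bool)%type.

Definition dotF (a c : F23) : bool :=
  (a.1.1 && c.1.1) (+) (a.1.2 && c.1.2) (+) (a.2 && c.2).

Definition addF (a c : F23) : F23 :=
  (a.1.1 (+) c.1.1, a.1.2 (+) c.1.2, a.2 (+) c.2).

Definition zeroF : F23 := (false, false, false).

Definition F23s : seq F23 :=
  [:: zeroF; (true, false, false); (false, true, false); (true, true, false);
      (false, false, true); (true, false, true); (false, true, true);
      (true, true, true)].

Lemma mem_F23s c : c \in F23s.
Proof. by case: c => [[[] []] []]. Qed.

(** The binary digits of [n.+1], so that [n < 7] enumerates the nonzero vectors. *)
Definition vecF (n : nat) : F23 := (odd n.+1, odd (n.+1 %/ 2), odd (n.+1 %/ 4)).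

(* The subgroup {0, a} for i < 7 and the orthogonal of a for 7 <= i, where a
   runs over the nonzero vectors. *)
Definition subF (i : nat) (c : F23) : bool :=
  if i < 7 then (c == zeroF) || (c == vecF i) else ~~ dotF (vecF (i - 7)) c.

(** Points are numbered from 0 to 6 and lines from 7 to 13; a line is given by the vector orthogonal
    to it. *)
Definition adj (i j : nat) : bool :=
  if i < 7 then (7 <= j) && ~~ dotF (vecF i) (vecF (j - 7))
  else (j < 7) && ~~ dotF (vecF j) (vecF (i - 7)).

(** The graph is bipartite of diameter 3, so equality, adjacency and the two types determine the
    distance. *)
Definition gdist (i j : nat) : nat :=
  if i == j then 0 else if adj i j then 1
  else if (i < 7) == (j < 7) then 2 else 3.

Definition allb (n : nat) (P : nat -> bool) : bool := all P (iota 0 n).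

Lemma allbP n (P : nat -> bool) : allb n P -> forall i, i < n -> P i.
Proof. by move=> /allP h i lin; apply: h; rewrite mem_iota. Qed.

Lemma allb2 n (P : nat -> nat -> bool) :
  allb n (fun i => allb n (P i)) -> forall i j, i < n -> j < n -> P i j.
Proof. by move=> h i j hi hj; have /allbP := allbP h hi; apply. Qed.

Lemma allb3 n (P : nat -> nat -> nat -> bool) :
  allb n (fun i => allb n (fun j => allb n (P i j))) ->
  forall i j k, i < n -> j < n -> k < n -> P i j k.
Proof. by move=> h i j k hi hj hk; have /allbP := allb2 h hi hj; apply. Qed.

Lemma adj_sym i j : i < 14 -> j < 14 -> adj i j = adj j i.
Proof.
move=> hi hj; apply/eqP; move: i j hi hj.
by apply: (@allb2 14 (fun i j => adj i j == adj j i)); vm_compute.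
Qed.

Lemma adj_neq i j : i < 14 -> j < 14 -> adj i j -> i != j.
Proof.
move=> hi hj; apply/implyP; move: i j hi hj.
by apply: (@allb2 14 (fun i j => adj i j ==> (i != j))); vm_compute.
Qed.

Lemma adj_triangle i j k : i < 14 -> j < 14 -> k < 14 ->
  adj i j -> adj j k -> adj i k -> False.
Proof.
move=> hi hj hk h1 h2 h3; move: (conj (conj h1 h2) h3).
have : ~~ [&& adj i j, adj j k & adj i k].
  move: i j k hi hj hk {h1 h2 h3}.
  by apply: (@allb3 14 (fun i j k => ~~ [&& adj i j, adj j k & adj i k])); vm_compute.
by rewrite h1 h2 h3.
Qed.

Definition nbr (i : nat) : seq nat := [seq j <- iota 0 14 | adj i j].

Lemma adj_ex i : i < 14 -> exists2 j, j < 14 & adj i j.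
Proof.
move=> hi; have /hasP[j] : has (adj i) (iota 0 14).
  by move: i hi; apply: (@allbP 14 (fun i => has (adj i) (iota 0 14))); vm_compute.
by rewrite mem_iota => /andP[_ hj] aij; exists j.
Qed.

Lemma subF_incl i j : i < 14 -> j < 14 ->
  (forall c, subF i c -> subF j c) -> (i == j) || adj i j.
Proof.
pose P i j := all (fun c => subF i c ==> subF j c) F23s ==> ((i == j) || adj i j).
move=> hi hj h.
have /implyP : P i j by move: i j hi hj {h}; apply: (@allb2 14 P); vm_compute.
by apply; apply/allP => c _; apply/implyP/h.
Qed.

Lemma subF_inj i j : i < 14 -> j < 14 -> (forall c, subF i c = subF j c) -> i = j.
Proof.
pose P i j := all (fun c => subF i c == subF j c) F23s ==> (i == j).
move=> hi hj h; apply/eqP.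
have /implyP : P i j by move: i j hi hj {h}; apply: (@allb2 14 P); vm_compute.
by apply; apply/allP => c _; rewrite h.
Qed.

Lemma adj_proper i j : i < 14 -> j < 14 -> adj i j -> i < 7 ->
  exists2 c, subF j c & ~~ subF i c.
Proof.
move=> hi hj aij i7.
pose P i j := adj i j ==> ((i < 7) ==> has (fun c => subF j c && ~~ subF i c) F23s).
have : P i j by move: i j hi hj {aij i7}; apply: (@allb2 14 P); vm_compute.
by rewrite /P aij i7 => /hasP[c _ /andP[]]; exists c.
Qed.

Lemma adj_lt7 i j : adj i j -> (i < 7) || (j < 7).
Proof. by rewrite /adj; case: ltnP => //= _ /andP[]. Qed.

Lemma subF_zero i : i < 14 -> subF i zeroF.
Proof. by move: i; apply: (@allbP 14 (subF^~ zeroF)); vm_compute. Qed.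

Lemma adj_incl i j : i < 14 -> j < 14 -> adj i j -> (i < 7) ->
  forall c, subF i c -> subF j c.
Proof.
move=> hi hj aij i7 c.
pose P i j := adj i j ==> ((i < 7) ==> all (fun c => subF i c ==> subF j c) F23s).
have : P i j by move: i j hi hj {aij i7}; apply: (@allb2 14 P); vm_compute.
by rewrite /P aij i7 => /allP /(_ c (mem_F23s c)) /implyP.
Qed.

(** Over the field with two elements an additive subset is a subspace, and the fourteen proper
    nonzero ones are listed by [subF]. The hypotheses are made boolean so that the eight values of
    [U] can be enumerated. *)
Lemma subF_class (U : F23 -> bool) :
  U zeroF -> (forall c c', U c -> U c' -> U (addF c c')) ->
  (exists c, ~~ U c) -> (exists2 c, c != zeroF & U c) ->
  exists2 i, i < 14 & forall c, subF i c = U c.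
Proof.
move=> U0 UD Up Un.
have h1 : all (fun c => all (fun c' => U c ==> U c' ==> U (addF c c')) F23s) F23s.
  by apply/allP => c _; apply/allP => c' _; apply/implyP => ?; apply/implyP; apply: UD.
have h2 : has (fun c => ~~ U c) F23s by apply/hasP; have [c] := Up; exists c; rewrite ?mem_F23s.
have h3 : has (fun c => (c != zeroF) && U c) F23s.
  by apply/hasP; have [c c0 Uc] := Un; exists c; rewrite ?mem_F23s // c0.
have : has (fun i => all (fun c => subF i c == U c) F23s) (iota 0 14).
  move: U0 h1 h2 h3; rewrite /F23s /zeroF /=.
  case: (U (false, false, false)) => //.
  case: (U (true, false, false)); case: (U (false, true, false));
  case: (U (true, true, false)); case: (U (false, false, true));
  case: (U (true, false, true)); case: (U (false, true, true));
  case: (U (true, true, true)) => //.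
move=> /hasP[i]; rewrite mem_iota => /andP[_ hi] /allP h.
by exists i => // c; apply/eqP/h/mem_F23s.
Qed.

Lemma subF_proper i : i < 14 -> exists c, ~~ subF i c.
Proof.
move=> hi; have /hasP[c _ hc] : has (fun c => ~~ subF i c) F23s.
  by move: i hi; apply: (@allbP 14 (fun i => has (fun c => ~~ subF i c) F23s)); vm_compute.
by exists c.
Qed.

Lemma subF_nonzero i : i < 14 -> exists2 c, c != zeroF & subF i c.
Proof.
move=> hi; have /hasP[c _ /andP[h1 h2]] : has (fun c => (c != zeroF) && subF i c) F23s.
  move: i hi; apply: (@allbP 14 (fun i =>
    has (fun c => (c != zeroF) && subF i c) F23s)).
  by vm_compute.
by exists c.
Qed.

End Heawood.

(* Twice the cosine of the angular distance gdist * pi / 3. *)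
Definition cos2 (i j : nat) : int := nth 0 [:: 2; 1; -1; -2] (gdist i j).

(** Written with [foldr] so that it reduces under [vm_compute]; [gramE] gives back the sum. *)
Definition gram (N : nat) (d : nat -> int) (l : nat -> nat -> int)
    (i j : nat) : int :=
  foldr (fun k s => d k * l k i * l k j + s) 0 (iota 0 N).

Lemma gramE N d l i j : gram N d l i j = \sum_(k < N) d k * l k i * l k j.
Proof.
rewrite /gram -(big_mkord xpredT (fun k => d k * l k i * l k j)) /index_iota subn0.
by elim: (iota 0 N) => [|k s IH] /=; rewrite ?big_nil // big_cons IH.
Qed.

(* The folding of the cone onto the plane of an apartment containing the
   chamber {x, y}, in the basis of the images of x and y. *)
Definition fold_pos (x y z : nat) : int * int :=
  match gdist x z, gdist y z with
  | 0%N, _ => (1, 0) | 1%N, 0%N => (0, 1) | 2%N, 1%N => (-1, 1)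
  | 3%N, _ => (-1, 0) | 2%N, _ => (0, -1) | _, _ => (1, -1)
  end.

(** In a basis at angle pi / 3, four times the squared norm is [4 (p^2 + p q + q^2) = (2 p + q)^2 +
    3 q^2], whence the weights 1 and 3. *)
Definition fold_wt (k : nat) : int := nth 0 [:: 1; 3] k.
Definition fold_lin (x y k z : nat) : int :=
  let p := fold_pos x y z in if k == 0%N then 2 * p.1 + p.2 else p.2.
Definition fold_gram (x y : nat) := gram 2 fold_wt (fold_lin x y).

(* The page containing z of the book with binding x. *)
Definition page (x z : nat) : nat :=
  find (fun y => (y == z) || adj y z) (nbr x).
(** Vertices at distance 0 or 3 from [x] go to the two ends of the binding; the others are at
    distance [sqrt 3 / 2] from it. *)
Definition offaxis (x z : nat) : bool := (gdist x z == 1) || (gdist x z == 2).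

(* (2, -1, -1) and (0, 1, -1), with weights 3 and 9, are multiples of the
   coordinates of three unit vectors at angle 2 pi / 3. *)
Definition book_wt (k : nat) : int := nth 0 [:: 4; 3; 9] k.
Definition book_lin (x k z : nat) : int :=
  if k == 0%N then cos2 x z
  else if offaxis x z then
    nth 0 (nth [::] [:: [::]; [:: 2; -1; -1]; [:: 0; 1; -1]] k) (page x z)
  else 0.
Definition book_gram (x : nat) := gram 3 book_wt (book_lin x).

(* Points go to 10 (7 e_a - 1) and lines to 7 (7 N_l - 3) + sqrt 2 (7 e_l - 1),
   with N_l the indicator of the points of l; adding the constant sqrt 280 gives
   the Gram matrix 70 (64, 32, -6, -17), by distance. *)
Definition apex_wt (k : nat) : int :=
  if (k < 7)%N then 1 else if (k < 14)%N then 2 else 14 * 20.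
Lemma apex_wt_ge0 k : 0 <= apex_wt k.
Proof. by rewrite /apex_wt; case: ifP => // _; case: ifP. Qed.

Definition apex_lin (k z : nat) : int :=
  if (k < 7)%N then
    if (z < 7)%N then 10 * (7 *+ (z == k) - 1) else 7 * (7 *+ adj k z - 3)
  else if (k < 14)%N then (if (z < 7)%N then 0 else 7 *+ (z == k) - 1)
  else 1.
Definition apex_gram := gram 15 apex_wt apex_lin.

Lemma fold_ge (x y z t : nat) : (x < 14)%N -> (y < 14)%N -> adj x y ->
  (z < 14)%N -> (t < 14)%N ->
  2 * cos2 z t <= fold_gram x y z t /\
  ([|| z == x, z == y, z == t | adj z t] -> fold_gram x y z t = 2 * cos2 z t).
Proof.
move=> hx hy axy hz ht.
pose Q z t x y := ((2 * cos2 z t <= fold_gram x y z t) &&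
  ([|| z == x, z == y, z == t | adj z t] ==> (fold_gram x y z t == 2 * cos2 z t))).
have /implyP/(_ axy) : adj x y ==> allb 14 (fun z => allb 14 (fun t => Q z t x y)).
  move: x y hx hy {axy}.
  apply: (@allb2 14 (fun x y => adj x y ==>
    allb 14 (fun z => allb 14 (fun t => Q z t x y)))).
  by vm_compute.
move=> /(@allb2 14 (fun z t => Q z t x y)) /(_ z t hz ht) /andP[h1 /implyP h2].
by split=> // /h2/eqP.
Qed.

Lemma book_ge (x z t : nat) : (x < 14)%N -> (z < 14)%N -> (t < 14)%N ->
  8 * cos2 z t <= book_gram x z t /\
  ([|| z == x, z == t | adj z t] -> book_gram x z t = 8 * cos2 z t).
Proof.
move=> hx hz ht.
pose Q x z t := ((8 * cos2 z t <= book_gram x z t) &&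
  ([|| z == x, z == t | adj z t] ==> (book_gram x z t == 8 * cos2 z t))).
have : Q x z t by move: x z t hx hz ht; apply: allb3; vm_compute.
by move=> /andP[h1 /implyP h2]; split=> // /h2/eqP.
Qed.

(** The point of [apex_gram] is to exhibit this matrix as a Gram matrix with nonnegative weights,
    hence as positive semidefinite. *)
Lemma apex_gramE (z t : nat) : (z < 14)%N -> (t < 14)%N ->
  apex_gram z t = nth 0 [:: 64; 32; -6; -17] (gdist z t) * 70.
Proof.
move=> hz ht; apply/eqP; move: z t hz ht.
by apply: (@allb2 14 (fun z t => apex_gram z t ==
  nth 0 [:: 64; 32; -6; -17] (gdist z t) * 70)); vm_compute.
Qed.

Lemma page_lt x z : (x < 14)%N -> (z < 14)%N -> offaxis x z -> (page x z < 3)%N.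
Proof.
move=> hx hz; apply/implyP; move: x z hx hz.
by apply: (@allb2 14 (fun x z => offaxis x z ==> (page x z < 3)%N)); vm_compute.
Qed.

Lemma page_adj x z t : (x < 14)%N -> (z < 14)%N -> (t < 14)%N -> adj z t ->
  offaxis x z -> offaxis x t -> page x z = page x t.
Proof.
move=> hx hz ht h1 h2 h3.
pose Q x z t := [&& adj z t, offaxis x z & offaxis x t] ==> (page x z == page x t).
have : Q x z t by move: x z t hx hz ht {h1 h2 h3}; apply: allb3; vm_compute.
by rewrite /Q h1 h2 h3 => /eqP.
Qed.

(* Off the axis of the book, a neighbour y of x satisfies
   cos (d (y, z)) = cos (d (x, z)) / 2 +- 3/4, with + on the page of y. *)
Lemma page_cos2 x j : (x < 14)%N -> (j < 3)%N ->
  [/\ (nth 0%N (nbr x) j < 14)%N, adj x (nth 0%N (nbr x) j)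
   & forall z, (z < 14)%N ->
     2 * cos2 (nth 0%N (nbr x) j) z = cos2 x z +
       (if offaxis x z then (if page x z == j then 3 else -3) else 0)].
Proof.
move=> hx hj.
pose Q x j := [&& (nth 0%N (nbr x) j < 14)%N, adj x (nth 0%N (nbr x) j)
   & allb 14 (fun z =>
     2 * cos2 (nth 0%N (nbr x) j) z == cos2 x z +
       (if offaxis x z then (if page x z == j then 3 else -3) else 0))].
have : Q x j.
  move: x hx; have : allb 14 (fun x => allb 3 (Q x)) by vm_compute.
  by move=> h x hx; apply: (allbP (allbP h hx)).
by move=> /and3P[h1 h2 /allbP h3]; split=> // z /h3/eqP.
Qed.

(* Positions on a hexagon with consecutive vertices numbered 0, .., 5. *)
Definition hexdist (a b : nat) : nat :=
  let d := (a - b + (b - a))%N in if (d <= 3)%N then d else (6 - d)%N.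

Definition hexes (i j : nat) : seq (seq nat) :=
  flatten [seq flatten [seq flatten [seq
    [seq [:: i; j; c; d; e; f] | f <- nbr e & adj f i]
    | e <- nbr d & e != c] | d <- nbr c & d != j] | c <- nbr j & c != i].

(** The building axiom that two chambers lie in a common apartment. Closed walks of length 6 through
    the edge [i], [j] are enumerated, and those embedded isometrically are kept. *)
Lemma hexagon_ex (i j k l : nat) : (i < 14)%N -> (j < 14)%N -> (k < 14)%N ->
  (l < 14)%N -> adj i j -> adj k l -> exists2 h : seq nat,
  [/\ i \in h, j \in h, k \in h & l \in h]
  & (size h = 6)%N /\ (forall a b : nat, (a < 6)%N -> (b < 6)%N ->
      (nth 0%N h a < 14)%N /\ gdist (nth 0%N h a) (nth 0%N h b) = hexdist a b)%N.
Proof.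
move=> hi hj hk hl aij akl.
pose W h := (size h == 6) && allb 6 (fun a => allb 6 (fun b =>
  (nth 0 h a < 14) && (gdist (nth 0 h a) (nth 0 h b) == hexdist a b)))%N.
pose P i j := adj i j ==> (fun H => allb 14 (fun k => all (fun l =>
    has (fun h => (k \in h) && (l \in h)) H) (nbr k)))
  [seq h <- hexes i j | W h].
have /implyP/(_ aij)/allbP/(_ k hk)/allP/(_ l) : P i j.
  by move: i j hi hj {aij}; apply: (@allb2 14 P); vm_compute.
rewrite mem_filter akl mem_iota hl => /(_ isT)/hasP[h].
rewrite mem_filter => /andP[/andP[/eqP sh /allb2 Wh] hh] /andP[kh lh].
have [ih jh] : i \in h /\ j \in h.
  move: hh => /flatten_mapP[c _ /flatten_mapP[d _ /flatten_mapP[e _ /mapP[f _ ->]]]].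
  by rewrite !inE !eqxx orbT.
exists h => //; split=> // a b ha hb; have /andP[? /eqP] := Wh a b ha hb.
by [].
Qed.

(** * The link of a vertex of the building *)

(** The residue map to the field with two elements; addition becomes exclusive or, and product
    becomes conjunction. *)
Definition par (x : Z2) : bool := odd (res x 1).

Lemma odd_mod2 n : odd (n %% 2) = odd n.
Proof. by rewrite modn2; case: (odd n). Qed.

Lemma parD x y : par (x + y) = par x (+) par y.
Proof. by rewrite /par /= odd_mod2 oddD. Qed.

Lemma parM x y : par (x * y) = par x && par y.
Proof. by rewrite /par /= odd_mod2 oddM. Qed.

Lemma par0 : par 0 = false. Proof. by []. Qed.
Lemma par1 : par 1 = true. Proof. by []. Qed.

Lemma parN x : par (- x) = par x.
Proof.
have := parD x (- x); rewrite subrr par0.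
by case: (par x); case: (par (- x)).
Qed.

Lemma par_nat n : par n%:R = odd n.
Proof. by elim: n => [|n IH] //; rewrite -natr1 parD IH par1 addbT. Qed.

Lemma par_int (n : int) : par n%:~R = odd `|n|%N.
Proof.
by case: (intP n) => [//|m|m]; rewrite ?rmorphN ?parN ?abszN /= par_nat.
Qed.

Lemma res_nat k n : res (k%:R : Z2) n = (k %% 2 ^ n)%N.
Proof.
elim: k => [|k IH] /=; first by rewrite mod0n.
by rewrite -natr1 /= IH modnDm addn1.
Qed.

Lemma par_even x : par x = false -> exists y, x = 2 * y.
Proof.
move=> hx.
have ev n : ~~ odd (res x n.+1).
  by rewrite -odd_mod2 -{1}(expn1 2) res_modn_leq // -/(par x) hx.
(* Halving loses one binary digit, so the quotient at level [n] is read off from [x] at level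
   [n.+1]. *)
have hc n : ((res x n.+2)./2 %% 2 ^ n = (res x n.+1)./2)%N.
  have := res_coherent x n.+1; have := ev n; have := ev n.+1.
  move=> /even_halfK e1 /even_halfK e2; rewrite -{1}e1 -{1}e2.
  by rewrite -!muln2 expnS (mulnC 2) -muln_modl => /eqP; rewrite eqn_pmul2r // => /eqP.
exists (MkZ2 hc); apply: Z2_eqP => n.
have -> : res (2 * MkZ2 hc) n = ((2 %% 2 ^ n) * (res x n.+1)./2 %% 2 ^ n)%N.
  by rewrite -(res_nat 2).
by rewrite modnMml mul2n (even_halfK (ev n)) res_coherent.
Qed.

Lemma par_unit x : par x -> exists y, x * y = 1.
Proof.
move=> hx.
have od n : odd (res x n.+1).
  by rewrite -odd_mod2 -{1}(expn1 2) res_modn_leq.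
have pw n : (res x n.+1 ^ (2 ^ n) = 1 %[mod 2 ^ n.+1])%N.
  have := @Euler_exp_totient (res x n.+1) (2 ^ n.+1).
  rewrite totient_pfactor // mul1n; apply.
  by rewrite coprime_pexpr // coprimen2 od.
(* By Euler's theorem ([pw]) the power [2 ^ n] of an odd residue is 1 modulo [2 ^ n], so one factor
   less gives the inverse at each level. *)
pose f n := (res x n ^ (2 ^ n).-1 %% 2 ^ n)%N.
have fE n : (res x n * f n = 1 %[mod 2 ^ n])%N.
  rewrite /f modnMmr -expnS prednK ?expn_gt0 //.
  case: n => [|n]; first by rewrite !modn1.
  have -> : (res x n.+1 ^ 2 ^ n.+1 = (res x n.+1 ^ 2 ^ n) ^ 2)%N by rewrite expnSr expnM.
  by rewrite -modnXm pw modnXm exp1n.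
have hc n : (f n.+1 %% 2 ^ n = f n)%N.
  have fm : (f n = f n %% 2 ^ n)%N by rewrite /f modn_mod.
  have e1 : (res x n * f n.+1 = 1 %[mod 2 ^ n])%N.
    by rewrite -(res_coherent x n) modnMml -modn_expS fE modn_expS.
  rewrite fm -[in RHS](muln1 (f n)) -modnMmr -e1 modnMmr mulnA (mulnC (f n)).
  by rewrite -modnMml fE modnMml mul1n.
exists (MkZ2 hc); apply: Z2_eqP => n.
have -> : res (x * MkZ2 hc) n = (res x n * f n %% 2 ^ n)%N by [].
by rewrite fE.
Qed.

Lemma Z2_factor x : x != 0 -> exists n u, x = 2 ^+ n * u /\ par u.
Proof.
move=> x0.
have ex k : (exists n u, x = 2 ^+ n * u /\ par u) \/ exists u, x = 2 ^+ k * u.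
  elim: k => [|k [IH|[u xu]]]; [by right; exists x; rewrite mul1r|by left|].
  have [pu|/negbTE/par_even[v uv]] := boolP (par u); first by left; exists k, u.
  by right; exists v; rewrite xu uv exprSr mulrA.
have [n hn] : exists n, res x n != 0%N.
  apply: contrapT => /forallNP h; move/eqP: x0; apply.
  apply: Z2_eqP => n /=; rewrite mod0n; apply/eqP/negPn/negP; exact: h.
(* A residue that is nonzero at level [n] excludes divisibility by [2 ^+ n], so the extraction of
   factors 2 has stopped by then. *)
have [//|[u xu]] := ex n.
have h2 k : res (2 ^+ k : Z2) n = (2 ^ k %% 2 ^ n)%N.
  by rewrite -natrX res_nat.
move: hn; rewrite xu.
have -> : res (2 ^+ n * u) n = (res (2 ^+ n) n * res u n %% 2 ^ n)%N by [].
by rewrite h2 modnn mul0n mod0n eqxx.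
Qed.

Local Notation "x %:F" := (@tofrac Z2 x) : ring_scope.

Lemma fracE (a : Q2) : exists x y : Z2, y != 0 /\ a = x%:F / y%:F.
Proof.
elim/quotW: a => r.
exists (frac r).1, (frac r).2; split; first exact: denom_ratioP.
apply: (canRL (mulfK _)); first by rewrite tofrac_eq0 denom_ratioP.
unlock tofrac; rewrite -[LHS]FracField.pi_mul; apply/eqmodP.
rewrite /= FracField.equivfE /FracField.mulf.
rewrite !numden_Ratio ?mulf_neq0 ?oner_neq0 ?denom_ratioP //=.
by rewrite !mulr1 mulrC.
Qed.

Lemma two_neq0 : (2 : Z2) != 0.
Proof. by apply/eqP => /(congr1 (res ^~ 2%N)); rewrite res_nat. Qed.

(* Z_2 is a valuation ring with uniformizer 2. *)
Lemma Q2_trichotomy (a : Q2) : a != 0 -> exists z : Z2,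
  [\/ a = (2 * z)%:F, a^-1 = (2 * z)%:F | a = z%:F /\ par z].
Proof.
have [x [y [y0 ->]]] := fracE a => xy0.
have x0 : x != 0 by apply: contraNneq xy0 => ->; rewrite tofrac0 mul0r.
have [m [u [xE pu]]] := Z2_factor x0; have [n [v [yE pv]]] := Z2_factor y0.
have key (p k : nat) (t s : Z2) : par s -> exists w,
    (2 ^+ (p + k) * t)%:F / (2 ^+ p * s)%:F = (2 ^+ k * w)%:F /\ par w = par t.
  move=> ps; have [s' ss'] := par_unit ps; exists (t * s'); split.
    have h2 : 2 ^+ p != 0 :> Z2 by rewrite expf_neq0 // two_neq0.
    have hs : s != 0 by apply: contraTneq ps => ->; rewrite par0.
    apply: (canLR (mulfK _)); first by rewrite tofrac_eq0 mulf_neq0.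
    rewrite -tofracM; congr (_%:F); rewrite exprD.
    by rewrite -[LHS]mulr1 -ss'; ring.
  have := congr1 par ss'; rewrite !parM par1 ps /= => ->.
  by rewrite andbT.
have [le|lt] := leqP n m.
  have [w [wE pw]] := key n (m - n)%N u v pv.
  rewrite subnKC // -xE -yE in wE; move: wE.
  case: (m - n)%N => [|k] wE; last first.
    by exists (2 ^+ k * w); constructor 1; rewrite wE exprS mulrA.
  by exists w; constructor 3; rewrite wE mul1r pw pu.
have [w [wE pw]] := key m (n - m)%N v u pu.
rewrite subnKC ?(ltnW lt) // -xE -yE in wE; move: wE.
case nm: (n - m)%N => [|k] wE; first by move: lt; rewrite -subn_gt0 nm.
by exists (2 ^+ k * w); constructor 2; rewrite invf_div wE exprS mulrA.
Qed.

(** * Lattices between a lattice and its double, and subspaces of the residue space *)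

Definition red (c : 'rV[Z2]_3) : F23 := (par (c 0 0), par (c 0 1), par (c 0 2%:R)).

Lemma redD c c' : red (c + c') = addF (red c) (red c').
Proof. by rewrite /red !mxE !parD. Qed.

Lemma redZ z c : red (z *: c) = if par z then red c else zeroF.
Proof. by rewrite /red !mxE !parM; case: (par z). Qed.

Lemma ord3_ind (P : 'I_3 -> Prop) : P 0 -> P 1 -> P 2%:R -> forall i, P i.
Proof.
move=> h0 h1 h2 [[|[|[|//]]] h].
- by rewrite (_ : Ordinal h = 0) //; apply: val_inj.
- by rewrite (_ : Ordinal h = 1) //; apply: val_inj.
- by rewrite (_ : Ordinal h = 2%:R) //; apply: val_inj.
Qed.

Lemma red_even c : red c = zeroF -> exists c', c = 2 *: c'.
Proof.
rewrite /red => -[h0 h1 h2].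
have h (i : 'I_3) : exists y, c 0 i = 2 * y.
  by apply: par_even; move: i; apply: ord3_ind.
have [f fE] := choice h.
by exists (\row_i f i); apply/rowP => i; rewrite !mxE.
Qed.

Definition liftF (c : F23) : 'rV[Z2]_3 :=
  \row_i ((nth false [:: c.1.1; c.1.2; c.2] i)%:R).

Lemma red_lift c : red (liftF c) = c.
Proof. by rewrite /red !mxE /= !par_nat !oddb; case: c => [[]]. Qed.

Section Lattices.
Variable B : 'M[Q2]_3.
Hypothesis Bu : B \in unitmx.

Definition vecB (c : 'rV[Z2]_3) : 'rV[Q2]_3 := map_mx (@tofrac Z2) c *m B.

Lemma vecB_inj : injective vecB.
Proof.
move=> c c' /(congr1 (mulmx^~ (invmx B))); rewrite /vecB !mulmxK // => /rowP h.
by apply/rowP => i; have := h i; rewrite !mxE => /eqP; rewrite tofrac_eq => /eqP.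
Qed.

Lemma vecBD c c' : vecB (c + c') = vecB c + vecB c'.
Proof. by rewrite /vecB map_mxD mulmxDl. Qed.

Lemma vecBZ z c : vecB (z *: c) = z%:F *: vecB c.
Proof. by rewrite /vecB map_mxZ scalemxAl. Qed.

(** For a subspace [U], the corresponding lattice between the span of [B] and its double. Arbitrary
    predicates are allowed, so that the two extreme lattices are instances. *)
Definition latt (U : F23 -> Prop) : set 'rV[Q2]_3 :=
  [set u | exists2 c, U (red c) & u = vecB c].

Lemma vecB_latt U c : latt U (vecB c) <-> U (red c).
Proof. by split=> [[c' Uc' /vecB_inj ->]|Uc]; last by exists c. Qed.

Lemma latt_sub U U' : latt U `<=` latt U' <-> (forall c, U c -> U' c).
Proof.
split=> [h c Uc|h _ [c Uc ->]]; last by exists c => //; apply: h.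
by rewrite -(red_lift c) -vecB_latt; apply: h; rewrite vecB_latt red_lift.
Qed.

Lemma latt_proper U U' : latt U `<` latt U' <->
  (forall c, U c -> U' c) /\ exists2 c, U' c & ~ U c.
Proof.
rewrite /proper; split=> [[/latt_sub h n]|[h [c U'c nUc]]]; split=> //.
- apply: contrapT => h'; apply: n; apply/latt_sub => c U'c.
  by apply: contrapT => nUc; apply: h'; exists c.
- exact/latt_sub.
- by move=> /latt_sub h'; apply: nUc; apply: h'.
Qed.

Lemma latt_full : Z2_span B = latt (fun=> True).
Proof. by apply/seteqP; split=> u [c]; [move=> ->; exists c | move=> _ ->; exists c]. Qed.

Lemma latt_zero : dilate 2 (Z2_span B) = latt (fun c => c = zeroF).
Proof.
have h2 : (2 : Q2) = (2 : Z2)%:F by rewrite (rmorph_nat (@tofrac Z2) 2).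
apply/seteqP; split=> [u [_ [c ->] <-]|u [c /red_even[c' ->] ->]].
  by exists (2 *: c); [rewrite redZ | rewrite vecBZ h2].
by exists (vecB c'); [exists c' | rewrite vecBZ h2].
Qed.

End Lattices.

Lemma vecB_scale a B c : vecB (a *: B) c = a *: vecB B c.
Proof. by rewrite /vecB scalemxAr. Qed.

Lemma latt_scale a B U : latt (a *: B) U = dilate a (latt B U).
Proof.
apply/seteqP; split=> [u [c Uc ->]|u [_ [c Uc ->] <-]].
  by exists (vecB B c); [exists c | rewrite vecB_scale].
by exists c; rewrite // vecB_scale.
Qed.

Lemma dilateM a b L : dilate a (dilate b L) = dilate (a * b) L.
Proof.
apply/seteqP; split=> [_ [_ [u Lu <-] <-]|_ [u Lu <-]].
  by exists u => //; rewrite scalerA.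
by exists (b *: u); [exists u | rewrite scalerA].
Qed.

Lemma dilate1 L : dilate 1 L = L.
Proof.
apply/seteqP; split=> [_ [u Lu <-]|u Lu]; first by rewrite scale1r.
by exists u; rewrite ?scale1r.
Qed.

Lemma homothety_class_dilate a L : a != 0 ->
  homothety_class (dilate a L) = homothety_class L.
Proof.
move=> a0; apply/seteqP; split=> [_ [b /= b0 <-]|_ [b /= b0 <-]].
  by exists (b * a); rewrite /= ?mulf_neq0 // dilateM.
exists (b / a); rewrite /= ?mulf_neq0 ?invr_eq0 //.
by rewrite dilateM divfK.
Qed.

Lemma homothety_class_eq L L' : homothety_class L = homothety_class L' ->
  exists2 a, a != 0 & L = dilate a L'.
Proof.
move=> h; have : homothety_class L L by exists 1; rewrite ?dilate1 //= oner_neq0.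
by rewrite h => -[a a0 <-]; exists a.
Qed.

Lemma latt_not_sub_even (B : 'M[Q2]_3) (U U' : F23 -> Prop) z : B \in unitmx ->
  (exists2 c, c != zeroF & U c) -> ~ latt B U `<=` dilate (2 * z)%:F (latt B U').
Proof.
move=> Bu [c c0 Uc] h.
have /h[_ [c' _ ->]] : latt B U (vecB B (liftF c)) by apply/(vecB_latt Bu); rewrite red_lift.
rewrite -vecBZ => /(vecB_inj Bu)/(congr1 red); rewrite red_lift redZ parM /=.
by move=> e; rewrite -e eqxx in c0.
Qed.

Lemma dilateVK a L : a != 0 -> dilate a^-1 (dilate a L) = L.
Proof. by move=> a0; rewrite dilateM mulVf // dilate1. Qed.

(** The homothety factor is a unit: if it or its inverse were divisible by 2, one of the lattices
    would have only zero residues. Multiplication by a unit does not change residues. *)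
Lemma latt_class_inj (B : 'M[Q2]_3) (U U' : F23 -> Prop) : B \in unitmx ->
  (exists2 c, c != zeroF & U c) -> (exists2 c, c != zeroF & U' c) ->
  homothety_class (latt B U) = homothety_class (latt B U') ->
  forall c, U c -> U' c.
Proof.
move=> Bu Un U'n /homothety_class_eq[a a0 e].
have [z [az|az|[az pz]]] := Q2_trichotomy a0.
- by case: (@latt_not_sub_even B U U' z Bu Un); rewrite e az.
- by case: (@latt_not_sub_even B U' U z Bu U'n); rewrite e -az dilateVK.
- move=> c Uc.
  have : latt B U (vecB B (liftF c)) by apply/(vecB_latt Bu); rewrite red_lift.
  rewrite e az => -[_ [c' U'c' ->]].
  rewrite -vecBZ => /(vecB_inj Bu)/(congr1 red); rewrite red_lift redZ pz => <-.
  exact: U'c'.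
Qed.

Lemma unitmx_factor (F : fieldType) n (a : F) (A A' : 'M[F]_n) :
  a != 0 -> A *m A' = a%:M -> A \in unitmx.
Proof.
move=> a0 e; have /mulmx1_unit[] // : A *m (a^-1 *: A') = 1%:M.
by rewrite -scalemxAr e scale_scalar_mx mulVf.
Qed.

Lemma unitmx_prod (F : fieldType) n (A B : 'M[F]_n) :
  A \in unitmx -> B \in unitmx -> A *m B \in unitmx.
Proof. by rewrite unitmx_mul => ->. Qed.

Lemma two_neq0F : (2 : Q2) != 0.
Proof. by rewrite -(rmorph_nat (@tofrac Z2) 2) tofrac_eq0 two_neq0. Qed.

Lemma unitmx_scale (a : Q2) (B : 'M[Q2]_3) : a != 0 -> B \in unitmx -> a *: B \in unitmx.
Proof. by move=> a0 Bu; rewrite unitmxZ ?unitfE. Qed.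

Lemma dilate_lattice a L : a != 0 -> is_lattice L -> is_lattice (dilate a L).
Proof.
move=> a0 [B Bu ->]; exists (a *: B); first exact: unitmx_scale.
by rewrite !latt_full latt_scale.
Qed.

(** Since [M] contains the double of the span of [C], membership in [M] depends only on residues.
    These form a subspace, which the two strict inclusions make proper and nonzero. *)
Lemma between (C : 'M[Q2]_3) M : C \in unitmx -> is_lattice M ->
  M `<` Z2_span C -> dilate 2 (Z2_span C) `<` M ->
  exists2 i, (i < 14)%N & M = latt C (subF i).
Proof.
move=> Cu [D Du MD] [MC nCM] [CM nMC].
have M0 : M 0 by rewrite MD; exists 0; rewrite map_mx0 mul0mx.
have MB u v : M u -> M v -> M (u - v).
  by rewrite MD => -[c ->] [c' ->]; exists (c - c'); rewrite map_mxB mulmxBl.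
have MA u v : M u -> M v -> M (u + v).
  by move=> Mu Mv; rewrite -(opprK v) -[- v]add0r; apply: (MB) => //; apply: (MB).
pose U c := `[< exists2 c', red c' = c & M (vecB C c') >].
have ME : M = latt C U.
  apply/seteqP; split=> [u Mu|_ [c /asboolP[c' cc' Mc'] ->]].
    have [c uE] := MC _ Mu; exists c => //; apply/asboolP; exists c => //.
    by rewrite /vecB -uE.
  have : red (c + (-1) *: c') = zeroF.
    rewrite redD redZ parN par1 cc' /addF.
    by case: (red c) => [[[] []] []].
  move=> /red_even[d dE].
  have : M (vecB C (c + (-1) *: c')).
    by apply: CM; rewrite latt_zero; exists (2 *: d); rewrite // ?redZ ?dE.
  by move=> /MA/(_ Mc'); rewrite -vecBD scaleN1r subrK.
have [i i14 iU] : exists2 i, (i < 14)%N & forall c, subF i c = U c.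
  apply: subF_class.
  - by apply/asboolP; exists 0; rewrite ?/vecB ?map_mx0 ?mul0mx // /red !mxE.
  - move=> c c' /asboolP[d dc Md] /asboolP[d' dc' Md'].
    by apply/asboolP; exists (d + d'); rewrite ?redD ?dc ?dc' // vecBD; apply: MA.
  - apply: contrapT => /forallNP h; apply: nCM; rewrite ME latt_full.
    by apply/(latt_sub Cu) => c _; apply/negPn/negP/h.
  - apply: contrapT => h; apply: nMC; rewrite ME latt_zero.
    apply/(latt_sub Cu) => c Uc; apply: contrapT => /eqP c0; apply: h.
    by exists c.
exists i => //; rewrite ME; congr latt; apply/funext => c.
by rewrite iU.
Qed.

(* The matrices lattM i and lattM' i have product 2, and the residues killed
   by lattM' i form the subgroup subF i. *)
Definition bitF (c : F23) (r : nat) : bool := nth false [:: c.1.1; c.1.2; c.2] r.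
Definition pivot (c : F23) : nat := index true [:: c.1.1; c.1.2; c.2].

Definition lattM' (i r s : nat) : int :=
  if (i < 7)%N then
    let a := vecF i in let k := pivot a in
    if s == k then 2 *+ (r == k) else (r == s)%:Z - (bitF a s && (r == k))%:Z
  else
    let a := vecF (i - 7) in let k := pivot a in
    if s == k then (bitF a r)%:Z else 2 *+ (r == s).

Definition lattM (i r s : nat) : int :=
  if (i < 7)%N then
    let a := vecF i in let k := pivot a in
    if s == k then (r == k)%:Z else 2 *+ (r == s) + (bitF a s && (r == k))%:Z
  else
    let a := vecF (i - 7) in let k := pivot a in
    if s == k then (if r == k then 2 else - (bitF a r)%:Z) else (r == s)%:Z.

Lemma lattM_mul i r s : (i < 14)%N -> (r < 3)%N -> (s < 3)%N ->
  lattM i r 0 * lattM' i 0 s + lattM i r 1 * lattM' i 1 s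
  + lattM i r 2 * lattM' i 2 s = 2 *+ (r == s).
Proof.
move=> hi hr hs; apply/eqP; move: i hi r s hr hs.
have h : allb 14 (fun i => allb 3 (fun r => allb 3 (fun s =>
  lattM i r 0 * lattM' i 0 s + lattM i r 1 * lattM' i 1 s
  + lattM i r 2 * lattM' i 2 s == 2 *+ (r == s)))) by vm_compute.
by move=> i hi; apply: allb2; apply: (allbP h).
Qed.

Lemma lattM'_mul i r s : (i < 14)%N -> (r < 3)%N -> (s < 3)%N ->
  lattM' i r 0 * lattM i 0 s + lattM' i r 1 * lattM i 1 s
  + lattM' i r 2 * lattM i 2 s = 2 *+ (r == s).
Proof.
move=> hi hr hs; apply/eqP; move: i hi r s hr hs.
have h : allb 14 (fun i => allb 3 (fun r => allb 3 (fun s =>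
  lattM' i r 0 * lattM i 0 s + lattM' i r 1 * lattM i 1 s
  + lattM' i r 2 * lattM i 2 s == 2 *+ (r == s)))) by vm_compute.
by move=> i hi; apply: allb2; apply: (allbP h).
Qed.

Lemma lattM_ker i c : (i < 14)%N -> subF i c =
  allb 3 (fun s => ~~ ((c.1.1 && odd `|lattM' i 0 s|%N)
    (+) (c.1.2 && odd `|lattM' i 1 s|%N) (+) (c.2 && odd `|lattM' i 2 s|%N))).
Proof.
move=> hi; apply/eqP; move: c (mem_F23s c); apply/allP; move: i hi.
by apply: allbP; vm_compute.
Qed.

Lemma ord3_sum (V : zmodType) (f : 'I_3 -> V) : \sum_i f i = f 0 + f 1 + f 2%:R.
Proof.
rewrite !big_ord_recr big_ord0 /= add0r; congr (f _ + f _ + f _); exact: val_inj.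
Qed.

(** The basis is [A B]. As [A A'] and [A' A] are both 2, the rows of [A] span exactly the vectors
    [d] with [d A'] even, and [lattM_ker] identifies these with [subF i]. *)
Lemma is_lattice_subF (B : 'M[Q2]_3) i : B \in unitmx -> (i < 14)%N ->
  is_lattice (latt B (subF i)).
Proof.
move=> Bu hi.
pose A : 'M[Z2]_3 := \matrix_(r, s) (lattM i r s)%:~R.
pose A' : 'M[Z2]_3 := \matrix_(r, s) (lattM' i r s)%:~R.
have AA' : A *m A' = 2%:M.
  apply/matrixP => r s; rewrite !mxE ord3_sum !mxE -!intrM -!intrD.
  by rewrite lattM_mul // -val_eqE; case: (val r == val s).
have A'A : A' *m A = 2%:M.
  apply/matrixP => r s; rewrite !mxE ord3_sum !mxE -!intrM -!intrD.
  by rewrite lattM'_mul // -val_eqE; case: (val r == val s).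
have subFE d : subF i (red d) <-> red (d *m A') = zeroF.
  rewrite lattM_ker // /red /= !mxE !ord3_sum !mxE !parD !parM !par_int.
  rewrite /zeroF; split=> [/and4P[h0 h1 h2 _]|[h0 h1 h2]].
    by congr (_, _, _); apply/negbTE; [exact: h0|exact: h1|exact: h2].
  by apply/and4P; split=> //; apply/negbT; [exact: h0|exact: h1|exact: h2].
have two_inj (c d : 'rV[Z2]_3) : 2 *: c = 2 *: d -> c = d.
  move=> /rowP h; apply/rowP => j; have := h j; rewrite !mxE.
  exact/mulfI/two_neq0.
pose FA : 'M[Q2]_3 := map_mx (@tofrac Z2) A.
pose FA' : 'M[Q2]_3 := map_mx (@tofrac Z2) A'.
have FAA' : FA *m FA' = (2 : Q2)%:M.
  by rewrite -map_mxM AA' map_scalar_mx /= (rmorph_nat (@tofrac Z2) 2).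
have two0 : (2 : Q2) != 0 by exact: two_neq0F.
have FAu : FA \in unitmx by exact: (unitmx_factor two0 FAA').
exists (FA *m B); first exact: unitmx_prod.
apply/seteqP; split=> [_ [d /subFE/red_even[c dc] ->]|_ [c ->]].
  exists c; rewrite mulmxA -map_mxM; congr (map_mx _ _ *m _).
  by apply: two_inj; rewrite scalemxAl -dc -mulmxA A'A mul_mx_scalar.
exists (c *m A); last by rewrite /vecB map_mxM mulmxA.
by apply/subFE; rewrite -mulmxA AA' mul_mx_scalar redZ.
Qed.

Lemma is_lattice_full (B : 'M[Q2]_3) : B \in unitmx -> is_lattice (latt B (fun=> True)).
Proof. by move=> Bu; exists B; rewrite ?latt_full. Qed.

Lemma vertex_eq (v w : vertex) : sval v = sval w -> v = w.
Proof.
case: v w => [A hA] [A' hA'] /= e; case: _ / e in hA' *.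
by congr exist; exact: Prop_irrelevance.
Qed.

Lemma vertex_basis (v : vertex) : exists2 B : 'M[Q2]_3, B \in unitmx &
  sval v = homothety_class (latt B (fun=> True)).
Proof.
by have [_ [B Bu ->] ->] := svalP v; exists B; rewrite ?latt_full.
Qed.

Definition vertex_of L (hL : is_lattice L) : vertex :=
  exist _ (homothety_class L) (ex_intro2 _ _ L hL erefl).

Lemma simplex_chain (B : 'M[Q2]_3) k (U : 'I_k.+1 -> F23 -> Prop) (S : set vertex) :
  B \in unitmx -> (forall i, is_lattice (latt B (U i))) ->
  (forall c, U ord0 c) ->
  (forall i j : 'I_k.+1, (i < j)%N ->
    (forall c, U j c -> U i c) /\ exists2 c, U i c & ~ U j c) ->
  U ord_max zeroF -> (exists2 c, c != zeroF & U ord_max c) ->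
  S = [set v | exists i, sval v = homothety_class (latt B (U i))] -> is_simplex S.
Proof.
move=> Bu Ul U0 UU Uz [c c0 Uc] SE; exists k, (fun i => latt B (U i)); split=> //.
- by move=> i j /UU; rewrite latt_proper.
- have -> : latt B (U ord0) = Z2_span B.
    by rewrite latt_full; congr latt; apply/funext => d; apply/propext.
  rewrite latt_zero; apply/(latt_proper Bu); split=> [_ -> //|].
  by exists c => // /eqP; apply/negP.
Qed.

(** The graph has no triangle, so a clique has at most two elements; a smaller one is completed by
    an arbitrary neighbour. *)
Lemma clique_chamber (P : 'I_14 -> Prop) :
  (forall i j, P i -> P j -> i != j -> adj i j) ->
  exists i j : 'I_14, adj i j /\ forall k, P k -> k = i \/ k = j.
Proof.
move=> h.
have nb (i : 'I_14) : exists j : 'I_14, adj i j.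
  by have [j j14 aij] := adj_ex (ltn_ord i); exists (Ordinal j14).
have [[i Pi]|/forallNP nP] := pselect (exists i, P i); last first.
  by have [j aj] := nb ord0; exists ord0, j; split=> // k /nP.
have [[j [Pj /eqP ij]]|/forallNP nj] := pselect (exists j, P j /\ i <> j); last first.
  have [j aj] := nb i; exists i, j; split=> // k Pk; left.
  by apply: contrapT => ki; case: (nj k); split=> // /esym.
exists i, j; split=> [|k Pk]; first exact: h.
apply: contrapT => /not_orP[/eqP ki /eqP kj].
apply: (@adj_triangle i j k) => //; apply: h => //; by rewrite eq_sym.
Qed.

(* lk identifies the incidence graph with the link of v0. *)
Definition is_link (v0 : vertex) (lk : 'I_14 -> vertex) :=
  [/\ injective lk, forall i, lk i <> v0,
      forall S, is_simplex S -> S v0 -> exists i j : 'I_14, adj i j /\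
        forall v, S v -> [\/ v = v0, v = lk i | v = lk j]
    & forall i j : 'I_14, adj i j ->
        [/\ is_simplex [set v0], is_simplex [set v | v = v0 \/ v = lk i]
         & is_simplex [set v | [\/ v = v0, v = lk i | v = lk j]]]].

Lemma link_exists (v0 : vertex) : exists lk, is_link v0 lk.
Proof.
have [B Bu v0E] := vertex_basis v0.
have ne i : (i < 14)%N -> exists2 c, c != zeroF & is_true (subF i c).
  by move=> /subF_nonzero.
have neT : exists2 c : F23, c != zeroF & True by exists (true, true, true).
pose lk (i : 'I_14) := vertex_of (is_lattice_subF Bu (ltn_ord i)).
exists lk; split.
- move=> i j /(congr1 sval) /= e; apply/val_inj/(subF_inj (ltn_ord i) (ltn_ord j)) => c.
  by apply/idP/idP; [apply: (latt_class_inj Bu _ _ e)|apply: (latt_class_inj Bu _ _ (esym e))];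
    exact: ne.
- move=> i /(congr1 sval) /=; rewrite v0E => /esym e.
  have [c /negP] := subF_proper (ltn_ord i); apply.
  exact: (@latt_class_inj B (fun=> True) (subF i) Bu neT (ne _ (ltn_ord i)) e c I).
- move=> S [k [L [Llat Lch Lmax SE]]]; rewrite SE => -[m].
  rewrite v0E => /esym/homothety_class_eq[a a0 LmE].
  pose C : 'M[Q2]_3 := a *: B.
  have Cu : C \in unitmx by exact: unitmx_scale.
  have LmC : L m = Z2_span C by rewrite latt_full latt_scale.
  have two0 : (2 : Q2) != 0.
    exact: two_neq0F.
  (* The chain is rotated so as to start at [L m]: later lattices already lie between [L m] and its
     double, and earlier ones do so once doubled, which does not change their classes. *)
  pose M (n : 'I_k.+1) := if (m < n)%N then L n else dilate 2 (L n).
  have Mlat n : is_lattice (M n).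
    by rewrite /M; case: ifP => // _; apply: dilate_lattice.
  have Lle (n n' : 'I_k.+1) : (n <= n')%N -> L n' `<=` L n.
    rewrite leq_eqVlt => /orP[/eqP/val_inj -> //|/Lch[h _]]; exact: h.
  have dl (a' : Q2) (X Y : set 'rV[Q2]_3) : X `<=` Y -> dilate a' X `<=` dilate a' Y.
    by move=> XY _ [u Xu <-]; exists u => //; apply: XY.
  have Lpr (a1 a2 : 'I_k.+1) : dilate 2 (L a1) `<` L a2.
    have [h1 h2] := Lmax.
    have s1 : dilate 2 (L a1) `<=` dilate 2 (L ord0) by apply/dl/Lle.
    have s2 : L ord_max `<=` L a2 by apply/Lle; rewrite -ltnS.
    by split=> [|h3]; [exact/(subset_trans s1)/(subset_trans h1)|
      exact/h2/(subset_trans s2)/(subset_trans h3)].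
  have dp (X Y : set 'rV[Q2]_3) : X `<` Y -> dilate 2 X `<` dilate 2 Y.
    move=> [XY YX]; split; first exact: dl.
    by move=> /(dl 2^-1); rewrite !dilateVK.
  (* The index chosen at [n = m] is a dummy, since that lattice represents [v0] itself. *)
  have Mex n : exists i : 'I_14, n != m -> M n = latt C (subF i).
    have [->|nm] := eqVneq n m; first by exists ord0.
    have [||i i14 ->] := @between C (M n) Cu (Mlat n); last by exists (Ordinal i14).
    - rewrite -LmC /M; case: ltnP => [/Lch //|_]; exact: Lpr.
    - rewrite -LmC /M; case: ltnP => [_|]; first exact: Lpr.
      by rewrite leq_eqVlt -[_ == _]/(n == m) (negbTE nm) => /Lch; exact: dp.
  have [f fE] := choice Mex.
  have Mcomp n n' : M n `<=` M n' \/ M n' `<=` M n.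
    wlog : n n' / (n <= n')%N.
      by move=> h; have [/h//|/ltnW/h/or_comm] := leqP n n'.
    move=> nn'; rewrite /M; case: (ltnP m n) => mn; case: (ltnP m n') => mn'.
    - by right; apply: Lle.
    - by move: (leq_trans mn nn'); rewrite ltnNge mn'.
    - by left; have [] := Lpr n n'.
    - by right; apply/dl/Lle.
  have cliq n n' : n != m -> n' != m -> f n != f n' -> adj (f n) (f n').
    move=> nm n'm fnn'; have := Mcomp n n'; rewrite !fE //.
    case=> /(latt_sub Cu)/(subF_incl (ltn_ord _) (ltn_ord _)).
      by rewrite -[_ == _]/(f n == f n') (negbTE fnn').
    by rewrite -[_ == _]/(f n' == f n) eq_sym (negbTE fnn') adj_sym.
  have [i [j [aij h]]] := @clique_chamber (fun i => exists2 n, n != m & f n = i) ltac:(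
    by move=> _ _ [n nm <-] [n' n'm <-]; apply: cliq).
  exists i, j; split=> // v /= [n vE].
  have [nm|nm] := eqVneq n m.
    constructor 1; apply: vertex_eq.
    by rewrite vE nm v0E LmC latt_full latt_scale homothety_class_dilate.
  have vlk : v = lk (f n).
    apply: vertex_eq; rewrite vE /=.
    have -> : homothety_class (L n) = homothety_class (M n).
      by rewrite /M; case: ifP => // _; rewrite homothety_class_dilate.
    by rewrite fE // latt_scale homothety_class_dilate.
  by have [e|e] := h (f n) (ex_intro2 _ _ n nm erefl); rewrite vlk e;
    [constructor 2|constructor 3].
- pose full : F23 -> Prop := fun=> True.
  have fulllat : is_lattice (latt B full) by exact: is_lattice_full.
  have lat i : (i < 14)%N -> is_lattice (latt B (subF i)) by exact: is_lattice_subF.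
  have S0 : is_simplex [set v0].
    apply: (@simplex_chain B 0 (fun=> full)) => //.
    - by move=> i j; rewrite !ord1.
    - by apply/seteqP; split=> [v ->|v [_ vE]]; [exists ord0|apply: vertex_eq; rewrite vE].
  have S1 (i : 'I_14) : is_simplex [set v | v = v0 \/ v = lk i].
    have [c1 c1E] := subF_proper (ltn_ord i).
    pose U (n : 'I_2) : F23 -> Prop := if n == 0 then full else subF i.
    apply: (@simplex_chain B 1 U) => //.
    - by move=> n; rewrite /U; case: ifP => // _; apply: lat.
    - move=> [[|[|//]] hm] [[|[|//]] hn] //= _; rewrite /U /=; split=> //.
      by exists c1 => //; apply/negP.
    - exact: subF_zero.
    - exact: ne.
    apply/seteqP; split=> [v [->|->]|v [n]].
    + by exists 0; rewrite /U eqxx.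
    + by exists 1.
    + by rewrite /U; case: ifP => _ vE; [left|right]; apply: vertex_eq; rewrite vE.
  have S2 (i j : 'I_14) : adj i j -> (i < 7)%N ->
      is_simplex [set v | [\/ v = v0, v = lk i | v = lk j]].
    move=> aij i7.
    have [c1 c1E] := subF_proper (ltn_ord j).
    have [c2 c2j c2i] := adj_proper (ltn_ord _) (ltn_ord _) aij i7.
    have ij c : subF i c -> subF j c by apply: adj_incl.
    have [c3 c3E] := subF_proper (ltn_ord i).
    pose U (n : 'I_3) : F23 -> Prop :=
      if n == 0 then full else if n == 1 then subF j else subF i.
    apply: (@simplex_chain B 2 U) => //.
    - by move=> n; rewrite /U; case: ifP => // _; case: ifP => _; apply: lat.
    - move=> [[|[|[|//]]] hm] [[|[|[|//]]] hn] //= _; rewrite /U /=; split=> //.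
      + by exists c1 => //; apply/negP.
      + by exists c3 => //; apply/negP.
      + by exists c2 => //; apply/negP.
    - exact: subF_zero.
    - exact: ne.
    apply/seteqP; split=> [v [->|->|->]|v [n]].
    + by exists 0; rewrite /U eqxx.
    + by exists 2%:R.
    + by exists 1.
    + rewrite /U; case: ifP => _; last case: ifP => _; move=> vE;
        [constructor 1|constructor 3|constructor 2]; apply: vertex_eq; by rewrite vE.
  move=> i j aij; split=> //.
  have /orP[i7|j7] := adj_lt7 aij; first exact: S2.
  have -> : [set v | [\/ v = v0, v = lk i | v = lk j]] =
      [set v | [\/ v = v0, v = lk j | v = lk i]].
    by apply/seteqP; split=> v [] ->; by [constructor 1|constructor 2|constructor 3].
  by apply: S2; rewrite // adj_sym.
Qed.

(** * Quadratic forms on the cone over the incidence graph *)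

Section Forms.
Variable R : realType.
Implicit Types (K : nat -> nat -> R) (u v w : 'rV[R]_14).

Definition frm K u v : R :=
  \sum_(i < 14) \sum_(j < 14) K i j * u 0 i * v 0 j.

Lemma frmDl K u u' v : frm K (u + u') v = frm K u v + frm K u' v.
Proof.
rewrite /frm -big_split; apply: eq_bigr => i _; rewrite -big_split.
by apply: eq_bigr => j _; rewrite mxE mulrDr mulrDl.
Qed.

Lemma frmZl K a u v : frm K (a *: u) v = a * frm K u v.
Proof.
rewrite /frm mulr_sumr; apply: eq_bigr => i _; rewrite mulr_sumr.
by apply: eq_bigr => j _; rewrite mxE; ring.
Qed.

Lemma frmDr K u v v' : frm K u (v + v') = frm K u v + frm K u v'.
Proof.
rewrite /frm -big_split; apply: eq_bigr => i _; rewrite -big_split.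
by apply: eq_bigr => j _; rewrite mxE mulrDr.
Qed.

Lemma frmZr K a u v : frm K u (a *: v) = a * frm K u v.
Proof.
rewrite /frm mulr_sumr; apply: eq_bigr => i _; rewrite mulr_sumr.
by apply: eq_bigr => j _; rewrite mxE; ring.
Qed.

Lemma frmNl K u v : frm K (- u) v = - frm K u v.
Proof. by rewrite -scaleN1r frmZl mulN1r. Qed.

Lemma frmNr K u v : frm K u (- v) = - frm K u v.
Proof. by rewrite -scaleN1r frmZr mulN1r. Qed.

Lemma frm0l K v : frm K 0 v = 0.
Proof. by rewrite -(scale0r 0) frmZl mul0r. Qed.

Lemma frm0r K u : frm K u 0 = 0.
Proof. by rewrite -(scale0r 0) frmZr mul0r. Qed.

Lemma frm_sumr K (I : finType) u (f : I -> 'rV[R]_14) :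
  frm K u (\sum_i f i) = \sum_i frm K u (f i).
Proof.
elim: (index_enum I) => [|i s IH]; first by rewrite !big_nil frm0r.
by rewrite !big_cons frmDr IH.
Qed.

Lemma frm_suml K (I : finType) v (f : I -> 'rV[R]_14) :
  frm K (\sum_i f i) v = \sum_i frm K (f i) v.
Proof.
elim: (index_enum I) => [|i s IH]; first by rewrite !big_nil frm0l.
by rewrite !big_cons frmDl IH.
Qed.

Definition symk K := forall i j : 'I_14, K i j = K j i.

Lemma frm_sym K u v : symk K -> frm K u v = frm K v u.
Proof.
move=> sK; rewrite /frm exchange_big; apply: eq_bigr => i _; apply: eq_bigr => j _.
by rewrite sK mulrAC.
Qed.

Definition frmE := (frmDl, frmDr, frmNl, frmNr, frmZl, frmZr).

Lemma frm_sub K u v : symk K ->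
  frm K (u - v) (u - v) = frm K u u + frm K v v - 2 * frm K u v.
Proof. by move=> sK; rewrite !frmE (frm_sym v u sK); ring. Qed.

Lemma frm_kB K K' u v : frm (fun i j => K i j - K' i j) u v = frm K u v - frm K' u v.
Proof.
rewrite /frm -sumrB; apply: eq_bigr => i _; rewrite -sumrB.
by apply: eq_bigr => j _; ring.
Qed.

Lemma frm_kZ a K u v : frm (fun i j => a * K i j) u v = a * frm K u v.
Proof.
rewrite /frm mulr_sumr; apply: eq_bigr => i _; rewrite mulr_sumr.
by apply: eq_bigr => j _; ring.
Qed.

Lemma eq_frm K K' u v : (forall i j : 'I_14, K i j = K' i j) -> frm K u v = frm K' u v.
Proof. by move=> h; do 2!(apply: eq_bigr => ? _); rewrite h. Qed.

Definition psdk K := forall u, 0 <= frm K u u.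

Lemma frm_CS K u v : symk K -> psdk K -> frm K u v ^+ 2 <= frm K u u * frm K v v.
Proof.
move=> sK pK; set a := frm K v v; set b := frm K u v.
have a0 : 0 <= a := pK v.
have := pK (a *: u - b *: v); rewrite frm_sub // !frmE -/a -/b => h.
have [a_gt0|] := ltP 0 a.
  by rewrite -subr_ge0 -(pmulr_rge0 _ a_gt0); move: h; congr (_ <= _); ring.
move=> a_le0; have {}a0 : a = 0 by apply/eqP; rewrite eq_le a_le0.
have [->|b0] := eqVneq b 0; first by rewrite expr0n a0 mulr0.
(* When [v] is isotropic but not orthogonal to [u], this multiple of [v] is chosen to bring the form
   down to -1. *)
have := pK (u - ((frm K u u + 1) / (2 * b)) *: v).
rewrite frm_sub // !frmE -/a -/b a0.
have -> : frm K u u + (frm K u u + 1) / (2 * b) * ((frm K u u + 1) / (2 * b) * 0) -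
  2 * ((frm K u u + 1) / (2 * b) * b) = -1 by field.
by rewrite ler0N1.
Qed.

Lemma frm_CSsqrt K u v : symk K -> psdk K ->
  frm K u v <= Num.sqrt (frm K u u) * Num.sqrt (frm K v v).
Proof.
move=> sK pK; rewrite -sqrtrM //; apply: le_trans (ler_norm _) _.
by rewrite -sqrtr_sqr ler_wsqrtr // frm_CS.
Qed.

Lemma frm_triangle K u v : symk K -> psdk K ->
  Num.sqrt (frm K (u + v) (u + v)) <= Num.sqrt (frm K u u) + Num.sqrt (frm K v v).
Proof.
move=> sK pK; rewrite -(ler_pXn2r (n := 2)) ?nnegrE ?addr_ge0 ?sqrtr_ge0 //.
rewrite sqr_sqrtr // sqrrD !sqr_sqrtr // !frmE (frm_sym v u sK).
by have := frm_CSsqrt u v sK pK; lra.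
Qed.

Definition gramk (N : nat) (d : nat -> int) (l : nat -> nat -> int) (m : R) i j : R :=
  (gram N d l i j)%:~R / m.

Definition glin (l : nat -> nat -> int) (k : nat) u : R :=
  \sum_(i < 14) (l k i)%:~R * u 0 i.

Lemma frm_gram N d l m u v : frm (gramk N d l m) u v =
  \sum_(k < N) (d k)%:~R / m * glin l k u * glin l k v.
Proof.
under eq_bigr => k _.
  rewrite -mulrA /glin mulr_suml mulr_sumr.
  under eq_bigr => i _ do rewrite mulr_sumr mulr_sumr.
  over.
rewrite exchange_big; apply: eq_bigr => i _; rewrite exchange_big; apply: eq_bigr => j _.
rewrite /gramk gramE rmorph_sum !mulr_suml; apply: eq_bigr => k _.
by rewrite /= !rmorphM /=; ring.
Qed.

Lemma gramk_sym N d l m : symk (gramk N d l m).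
Proof.
move=> i j; rewrite /gramk !gramE; congr (_%:~R / _); apply: eq_bigr => k _.
by rewrite mulrAC.
Qed.

Lemma gramk_psd N d l m : (forall k, (k < N)%N -> 0 <= d k) -> 0 <= m ->
  psdk (gramk N d l m).
Proof.
move=> d0 m0 u; rewrite frm_gram sumr_ge0 // => k _.
by rewrite -mulrA mulr_ge0 ?divr_ge0 ?ler0z ?d0 // -expr2 sqr_ge0.
Qed.

(** The linear map to Euclidean space that pulls the standard form back to [gramk]; all realizations
    are built from it. *)
Definition gvec (N : nat) (d : nat -> int) (l : nat -> nat -> int) (m : R) u :
    'rV[R]_N :=
  \row_(k < N) (Num.sqrt ((d k)%:~R / m) * glin l k u).

Lemma glinD l k u v : glin l k (u + v) = glin l k u + glin l k v.
Proof. by rewrite /glin -big_split; apply: eq_bigr => i _; rewrite mxE mulrDr. Qed.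

Lemma glinZ l k a u : glin l k (a *: u) = a * glin l k u.
Proof. by rewrite /glin mulr_sumr; apply: eq_bigr => i _; rewrite mxE; ring. Qed.

Lemma gvecD N d l m u v : gvec N d l m (u + v) = gvec N d l m u + gvec N d l m v.
Proof. by apply/rowP => k; rewrite !mxE glinD mulrDr. Qed.

Lemma gvecZ N d l m a u : gvec N d l m (a *: u) = a *: gvec N d l m u.
Proof. by apply/rowP => k; rewrite !mxE glinZ mulrCA. Qed.

Lemma eucl_gvec N d l m u : (forall k, (k < N)%N -> 0 <= d k) -> 0 <= m ->
  eucl_norm (gvec N d l m u) = Num.sqrt (frm (gramk N d l m) u u).
Proof.
move=> d0 m0; rewrite /eucl_norm frm_gram; congr Num.sqrt; apply: eq_bigr => k _.
by rewrite mxE exprMn sqr_sqrtr ?divr_ge0 ?ler0z ?d0 // -mulrA expr2.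
Qed.

Definition cosk (i j : nat) : R := (cos2 i j)%:~R / 2.

Definition dst u w : R := frm cosk (u - w) (u - w).

(** Vanishing products, rather than a condition on supports, give a closed condition that passes to
    limits of germs. *)
Definition clique u := forall i j : 'I_14, i != j -> ~~ adj i j -> u 0 i * u 0 j = 0.

Definition in_supp (P : pred 'I_14) u := forall i, ~~ P i -> u 0 i = 0.

Definition pos_off (P : pred 'I_14) u := forall i, ~~ P i -> 0 <= u 0 i.

(** [P] contains the coordinates whose sign is free. The difference [K - cosk] has nonnegative
    entries and vanishes on the rows of [P] and on chambers. Hence [K] keeps distances to vectors
    supported in [P] ([folding_eq]) and does not increase the others ([folding_le]). *)
Definition folding (P : pred 'I_14) K :=
  [/\ symk K, psdk K & forall i j : 'I_14, cosk i j <= K i j /\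
    ([|| P i, i == j | adj i j] -> K i j = cosk i j)].

Lemma gdist_sym (i j : 'I_14) : gdist i j = gdist j i.
Proof. by rewrite /gdist eq_sym (adj_sym (ltn_ord i)) // [(i < 7)%N == _]eq_sym. Qed.

Lemma cosk_sym : symk cosk.
Proof. by move=> i j; rewrite /cosk /cos2 gdist_sym. Qed.

Section Folding.
Variables (P : pred 'I_14) (K : nat -> nat -> R).
Hypothesis fPK : folding P K.

Let E i j := K i j - cosk i j.

Let symK : symk K. Proof. by case: fPK. Qed.
Let symE : symk E. Proof. by move=> i j; rewrite /E symK cosk_sym. Qed.

Let E0 (i j : 'I_14) : [|| P i, i == j | adj i j] -> E i j = 0.
Proof. by case: fPK => _ _ /(_ i j)[_ h] /h; rewrite /E => ->; rewrite subrr. Qed.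

Let Ege0 (i j : 'I_14) : 0 <= E i j.
Proof. by case: fPK => _ _ /(_ i j)[h _]; rewrite subr_ge0. Qed.

Let frmEE u v : frm K u v = frm cosk u v + frm E u v.
Proof. by rewrite /E frm_kB addrC subrK. Qed.

Let E_clique u : clique u -> frm E u u = 0.
Proof.
move=> cu; apply: big1 => i _; apply: big1 => j _.
have [|] := boolP ((i == j) || adj i j).
  by move=> h; rewrite E0 ?mul0r // h orbT.
by rewrite negb_or => /andP[ij nij]; rewrite -mulrA cu // mulr0.
Qed.

Let E_pos u v : pos_off P u -> pos_off P v -> 0 <= frm E u v.
Proof.
move=> pu pv; apply: sumr_ge0 => i _; apply: sumr_ge0 => j _.
have [Pi|Pi] := boolP (P i); first by rewrite E0 ?Pi // !mul0r.
have [Pj|Pj] := boolP (P j); first by rewrite symE E0 ?Pj // !mul0r.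
by rewrite !mulr_ge0 // ?pu ?pv.
Qed.

Let E_supp u v : in_supp P v -> frm E u v = 0.
Proof.
move=> sv; apply: big1 => i _; apply: big1 => j _.
have [Pj|Pj] := boolP (P j); first by rewrite symE E0 ?Pj // !mul0r.
by rewrite sv // mulr0.
Qed.

Lemma folding_supp u v : in_supp P v -> frm K u v = frm cosk u v.
Proof. by move=> sv; rewrite frmEE E_supp // addr0. Qed.

Lemma folding_ge u v : pos_off P u -> pos_off P v -> frm cosk u v <= frm K u v.
Proof. by move=> pu pv; rewrite frmEE lerDl E_pos. Qed.

Lemma folding_diag u : clique u -> frm K u u = frm cosk u u.
Proof. by move=> cu; rewrite frmEE E_clique // addr0. Qed.

Lemma folding_le u v : pos_off P u -> pos_off P v -> clique u -> clique v ->
  frm K (u - v) (u - v) <= frm cosk (u - v) (u - v).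
Proof.
move=> pu pv cu cv; rewrite !frm_sub ?folding_diag //; last exact: cosk_sym.
by have := folding_ge pu pv; lra.
Qed.

Lemma folding_eq u v : clique u -> in_supp P v ->
  frm K (u - v) (u - v) = frm cosk (u - v) (u - v).
Proof.
move=> cu sv; rewrite !frm_sub ?(folding_supp _ sv) ?folding_diag //.
exact: cosk_sym.
Qed.

End Folding.

Lemma fold_folding (x y : 'I_14) : adj x y ->
  folding (pred2 x y) (gramk 2 fold_wt (fold_lin x y) 4).
Proof.
move=> axy; split.
- exact: gramk_sym.
- by apply: gramk_psd; [case=> [|[|]]|exact: ler0n].
move=> i j; have [h1 h2] := fold_ge (ltn_ord x) (ltn_ord y) axy (ltn_ord i) (ltn_ord j).
rewrite /gramk -/(fold_gram x y i j) /cosk; split.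
  rewrite ler_pdivrMr // mulrC mulrA ler_pdivlMr //.
  have : ((2 * cos2 i j)%:~R : R) <= (fold_gram x y i j)%:~R by rewrite ler_int.
  by rewrite rmorphM /=; lra.
move=> h; rewrite h2; first by rewrite rmorphM /=; field.
by move: h; rewrite -orbA -!val_eqE.
Qed.

Lemma book_folding (x : 'I_14) : folding (pred1 x) (gramk 3 book_wt (book_lin x) 16).
Proof.
split.
- exact: gramk_sym.
- by apply: gramk_psd; [case=> [|[|[|]]]|exact: ler0n].
move=> i j; have [h1 h2] := book_ge (ltn_ord x) (ltn_ord i) (ltn_ord j).
rewrite /gramk -/(book_gram x i j) /cosk; split.
  have : ((8 * cos2 i j)%:~R : R) <= (book_gram x i j)%:~R by rewrite ler_int.
  by rewrite rmorphM /=; lra.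
move=> h; rewrite h2; first by rewrite rmorphM /=; field.
by move: h; rewrite -!val_eqE.
Qed.

Definition apexk := gramk 15 apex_wt apex_lin (64 * 70).

Lemma apex_folding : folding pred0 apexk.
Proof.
split.
- exact: gramk_sym.
- apply: gramk_psd; last by rewrite mulr_ge0.
  by move=> k _; exact: apex_wt_ge0.
move=> i j; rewrite /apexk /gramk -/(apex_gram i j) apex_gramE // /cosk /cos2.
have : [|| gdist i j == 0%N, gdist i j == 1%N, gdist i j == 2%N | gdist i j == 3%N].
  by rewrite /gdist; do 3!case: ifP => //.
move=> /or4P[] /eqP e; rewrite e /=; split; try lra.
all: by move: e; rewrite /gdist val_eqE; do 3!case: ifP => //.
Qed.

End Forms.

(** * Apartments *)

Section Plane.
Variable R : realType.
Implicit Types a b : R.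

(* The plane is given the coordinates (a, b) in a basis at angle pi/3; the
   three lines a = 0, b = 0, a + b = 0 cut it into six sectors. *)
Definition pnorm2 a b : R := a ^+ 2 + a * b + b ^+ 2.

Lemma pnorm2_ge0 a b : 0 <= pnorm2 a b.
Proof.
have -> : pnorm2 a b = (a + b / 2) ^+ 2 + 3 / 4 * b ^+ 2 by rewrite /pnorm2; field.
apply: addr_ge0; [exact: sqr_ge0|apply: mulr_ge0; [lra|exact: sqr_ge0]].
Qed.

Definition sector (k : nat) a b : Prop :=
  match k with
  | 0%N => 0 <= a /\ 0 <= b
  | 1%N => a <= 0 /\ 0 <= a + b
  | 2%N => a + b <= 0 /\ 0 <= b
  | 3%N => a <= 0 /\ b <= 0
  | 4%N => 0 <= a /\ a + b <= 0
  | _ => b <= 0 /\ 0 <= a + b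
  end.

(** The part of an apartment inside the open star: in each sector the two coefficients along the
    bounding rays have sum less than 1. *)
Definition in_hexagon a b : Prop :=
  [/\ -1 < a < 1, -1 < b < 1 & -1 < a + b < 1].

Lemma in_hexagon_conv a b a' b' s : 0 <= s <= 1 -> in_hexagon a b ->
  in_hexagon a' b' -> in_hexagon ((1 - s) * a + s * a') ((1 - s) * b + s * b').
Proof.
move=> /andP[s0 s1].
have aux x x' : -1 < x < 1 -> -1 < x' < 1 -> -1 < (1 - s) * x + s * x' < 1.
  move=> /andP[h1 h2] /andP[h3 h4].
  have [->|sn0] := eqVneq s 0; first by rewrite subr0 mul1r mul0r addr0 h1 h2.
  have sp : 0 < s by rewrite lt_neqAle eq_sym sn0.
  have t1 : 0 < s * (x' + 1) by rewrite mulr_gt0 //; lra.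
  have t2 : 0 < s * (1 - x') by rewrite mulr_gt0 //; lra.
  have t3 : 0 <= (1 - s) * (x + 1) by rewrite mulr_ge0 //; lra.
  have t4 : 0 <= (1 - s) * (1 - x) by rewrite mulr_ge0 //; lra.
  by apply/andP; split; lra.
move=> [h1 h2 h3] [h1' h2' h3']; split; [exact: aux|exact: aux|].
have -> : (1 - s) * a + s * a' + ((1 - s) * b + s * b') =
  (1 - s) * (a + b) + s * (a' + b') by ring.
exact: aux.
Qed.

Definition chg (x x' : R) : bool := x * x' < 0.

Lemma chg_conv x x' s : 0 <= s <= 1 ->
  (chg x ((1 - s) * x + s * x') -> chg x x') /\
  (chg ((1 - s) * x + s * x') x' -> chg x x').
Proof.
by rewrite /chg => /andP[s0 s1]; split=> h; rewrite ltNge; apply/negP => h'; nra.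
Qed.

Lemma nchg x x' : ~~ chg x x' -> (0 <= x /\ 0 <= x') \/ (x <= 0 /\ x' <= 0).
Proof.
rewrite /chg -leNgt => h; have [x0|x0] := ltP 0 x.
  by left; split; [exact: ltW|rewrite -(pmulr_rge0 _ x0)].
have [x'0|] := ltP 0 x'; last by right.
by left; split; [rewrite -(pmulr_lge0 _ x'0)|exact: ltW].
Qed.

Lemma sector_ex a b a' b' : ~~ chg a a' -> ~~ chg b b' -> ~~ chg (a + b) (a' + b') ->
  exists2 k, (k < 6)%N & sector k a b /\ sector k a' b'.
Proof.
move=> /nchg[] [h1 h1'] /nchg[] [h2 h2'] /nchg[] [h3 h3'].
- by exists 0%N.
- by exists 0%N.
- by exists 5%N.
- by exists 4%N.
- by exists 1%N.
- by exists 2%N.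
- by exists 3%N.
- by exists 3%N.
Qed.

Lemma pnorm2Z s a b : 0 <= s ->
  Num.sqrt (pnorm2 (s * a) (s * b)) = s * Num.sqrt (pnorm2 a b).
Proof.
move=> s0; have -> : pnorm2 (s * a) (s * b) = s ^+ 2 * pnorm2 a b by rewrite /pnorm2; ring.
by rewrite sqrtrM ?sqr_ge0 // sqrtr_sqr ger0_norm.
Qed.

Lemma drop_bool (x y w x' y' w' : bool) n : (x -> x') -> (y -> y') -> (w -> w') ->
  [|| x' && ~~ x, y' && ~~ y | w' && ~~ w] -> (x' + y' + w' < n.+1)%N ->
  (x + y + w < n)%N.
Proof.
case: x => /= [/(_ isT) ->|_]; case: y => /= [/(_ isT) ->|_];
case: w => /= [/(_ isT) ->|_] //=; rewrite ?andbT ?andbF ?orbF /=.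
all: by case: x' => //; case: y' => //; case: w' => //= _; rewrite ?ltnS;
  case: n => // -[|[|[]]].
Qed.

(* A segment of the plane is cut at the lines it crosses, each cut decreasing
   the number of linear forms changing sign. *)
Lemma planar_connect (con : R -> R -> R -> R -> R -> Prop) :
  (forall a b a' b' a'' b'' l l', con a b a' b' l -> con a' b' a'' b'' l' ->
     con a b a'' b'' (l + l')) ->
  (forall k a b a' b', (k < 6)%N -> in_hexagon a b -> in_hexagon a' b' ->
     sector k a b -> sector k a' b' ->
     con a b a' b' (Num.sqrt (pnorm2 (a - a') (b - b')))) ->
  forall a b a' b', in_hexagon a b -> in_hexagon a' b' ->
    con a b a' b' (Num.sqrt (pnorm2 (a - a') (b - b'))).
Proof.
move=> ctrans cstep a b a' b'.
have [n le_n] := ubnP (chg a a' + chg b b' + chg (a + b) (a' + b'))%N.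
elim: n => // n IH in a b a' b' le_n *; move=> h h'.
suff cut s : 0 <= s <= 1 ->
    (let m := (1 - s) * a + s * a' in let m' := (1 - s) * b + s * b' in
     [\/ chg a a' /\ m = 0, chg b b' /\ m' = 0
      | chg (a + b) (a' + b') /\ m + m' = 0]) ->
    con a b a' b' (Num.sqrt (pnorm2 (a - a') (b - b'))).
  have root x x' : chg x x' -> exists2 s, 0 <= s <= 1 & (1 - s) * x + s * x' = 0.
    rewrite /chg => xx'.
    have d0 : x - x' != 0 
      by apply: contraTneq xx' => /subr0_eq ->; rewrite -leNgt -expr2 sqr_ge0.
    exists (x / (x - x')); last by field.
    have xp : 0 <= x / (x - x').
      have -> : x / (x - x') = (x * (x - x')) / (x - x') ^+ 2 by field.
      by rewrite divr_ge0 ?sqr_ge0 //; nra.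
    rewrite xp /= -subr_ge0.
    have -> : 1 - x / (x - x') = (- x' * (x - x')) / (x - x') ^+ 2 by field.
    by rewrite divr_ge0 ?sqr_ge0 //; nra.
  have [ca|ca] := boolP (chg a a').
    by have [s s01 e] := root _ _ ca; apply: (cut s) => //; constructor 1.
  have [cb|cb] := boolP (chg b b').
    by have [s s01 e] := root _ _ cb; apply: (cut s) => //; constructor 2.
  have [cc|cc] := boolP (chg (a + b) (a' + b')).
    have [s s01 e] := root _ _ cc; apply: (cut s) => //; constructor 3; split=> //.
    by rewrite -[RHS]e; ring.
  by have [k k6 [sk sk']] := sector_ex ca cb cc; apply: (cstep k).
move=> s01; set m := _ + _; set m' := _ + _ => /= z.
have hm : in_hexagon m m' by exact: in_hexagon_conv.
have e1 : a - m = s * (a - a') by rewrite /m; ring.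
have e2 : b - m' = s * (b - b') by rewrite /m'; ring.
have e3 : m - a' = (1 - s) * (a - a') by rewrite /m; ring.
have e4 : m' - b' = (1 - s) * (b - b') by rewrite /m'; ring.
have e5 : m + m' = (1 - s) * (a + b) + s * (a' + b') by rewrite /m /m'; ring.
have [s0 s1] := andP s01.
have -> : Num.sqrt (pnorm2 (a - a') (b - b')) =
   Num.sqrt (pnorm2 (a - m) (b - m')) + Num.sqrt (pnorm2 (m - a') (m' - b')).
  by rewrite e1 e2 e3 e4 !pnorm2Z ?subr_ge0 //; ring.
have [la la'] := @chg_conv a a' s s01.
have [lb lb'] := @chg_conv b b' s s01.
have [lc lc'] := @chg_conv (a + b) (a' + b') s s01.
rewrite -/m in la la'; rewrite -/m' in lb lb'; rewrite -e5 in lc lc'.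
have chg0l x : chg 0 x = false by rewrite /chg mul0r ltxx.
have chg0r x : chg x 0 = false by rewrite /chg mulr0 ltxx.
apply: (ctrans _ _ m m'); apply: IH => //.
- apply: (drop_bool la lb lc) le_n.
  by case: z => -[z zz]; rewrite z zz chg0r ?orbT.
- apply: (drop_bool la' lb' lc') le_n.
  by case: z => -[z zz]; rewrite z zz chg0l ?orbT.
Qed.

Definition pos (t : R) : R := Num.max 0 t.

(** Coefficient along the ray numbered [m], the rays 0 and 1 being the basis vectors. One formula
    serves all sectors: it vanishes unless the ray bounds the sector of the point. *)
Definition hexcoef (m : nat) a b : R :=
  match m with
  | 0%N => pos (Num.min a (a + b))
  | 1%N => pos (Num.min b (a + b))
  | 2%N => pos (Num.min (- a) b)
  | 3%N => pos (Num.min (- a) (- (a + b)))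
  | 4%N => pos (Num.min (- b) (- (a + b)))
  | _ => pos (Num.min a (- b))
  end.

(** Coordinates in the basis formed by the two rays bounding sector [k]. *)
Definition hexcoef2 (k : nat) a b : R * R :=
  match k with
  | 0%N => (a, b)
  | 1%N => (a + b, - a)
  | 2%N => (b, - (a + b))
  | 3%N => (- a, - b)
  | 4%N => (- (a + b), a)
  | _ => (- b, a + b)
  end.

Lemma pos_id t : 0 <= t -> pos t = t. Proof. by move=> t0; rewrite /pos max_r. Qed.
Lemma pos_0 t : t <= 0 -> pos t = 0. Proof. by move=> t0; rewrite /pos max_l. Qed.

Lemma pos_minl x y : 0 <= x -> x <= y -> pos (Num.min x y) = x.
Proof. by move=> x0 xy; rewrite min_l // pos_id. Qed.
Lemma pos_minr x y : 0 <= y -> y <= x -> pos (Num.min x y) = y.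
Proof. by move=> x0 xy; rewrite min_r // pos_id. Qed.
Lemma pos_min0l x y : x <= 0 -> pos (Num.min x y) = 0.
Proof. by move=> x0; rewrite pos_0 // ge_min x0. Qed.
Lemma pos_min0r x y : y <= 0 -> pos (Num.min x y) = 0.
Proof. by move=> y0; rewrite pos_0 // ge_min y0 orbT. Qed.

Lemma hexcoefE k m a b : (k < 6)%N -> (m < 6)%N -> sector k a b ->
  hexcoef m a b = if m == k then (hexcoef2 k a b).1
    else if m == (k.+1 %% 6)%N then (hexcoef2 k a b).2 else 0.
Proof.
case: k => [|[|[|[|[|[|//]]]]]] _; case: m => [|[|[|[|[|[|//]]]]]] _ /= [h1 h2];
  by [rewrite pos_minl //; lra|rewrite pos_minr //; lra|rewrite pos_min0l //; lra|
      rewrite pos_min0r //; lra].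
Qed.

Lemma hexcoef2_ge0 k a b : sector k a b ->
  0 <= (hexcoef2 k a b).1 /\ 0 <= (hexcoef2 k a b).2.
Proof. by case: k => [|[|[|[|[|k]]]]] /= [h1 h2]; lra. Qed.

Lemma sector_cover a b : exists2 k, (k < 6)%N & sector k a b.
Proof.
have nc (x : R) : ~~ chg x x by rewrite /chg -leNgt -expr2 sqr_ge0.
by have [k k6 [s _]] := sector_ex (nc a) (nc b) (nc (a + b)); exists k.
Qed.

Definition hexx (m : nat) : R := nth 0 [:: 1; 0; -1; -1; 0; 1] m.
Definition hexy (m : nat) : R := nth 0 [:: 0; 1; 1; 0; -1; -1] m.

Lemma hexcos (m n : nat) : (m < 6)%N -> (n < 6)%N ->
  hexx m * hexx n + (hexx m * hexy n + hexy m * hexx n) / 2 + hexy m * hexy n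
  = (nth 0 [:: 2; 1; -1; -2] (hexdist m n))%:~R / 2.
Proof.
case: m => [|[|[|[|[|[|//]]]]]] _; case: n => [|[|[|[|[|[|//]]]]]] _;
  by rewrite /hexx /hexy /hexdist /=; field.
Qed.

Lemma big_ord6 (V : zmodType) (f : nat -> V) :
  \sum_(m < 6) f m = f 0%N + f 1%N + f 2%N + f 3%N + f 4%N + f 5%N.
Proof. by rewrite !big_ord_recr big_ord0 /= add0r. Qed.

Lemma hexcoef_sum k (V : zmodType) (f : R -> nat -> V) a b : (k < 6)%N ->
  sector k a b -> (forall m, f 0 m = 0) ->
  \sum_(m < 6) f (hexcoef m a b) m =
  f (hexcoef2 k a b).1 k + f (hexcoef2 k a b).2 (k.+1 %% 6)%N.
Proof.
move=> k6 sk f0; rewrite (big_ord6 (fun m => f (hexcoef m a b) m)).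
rewrite !(hexcoefE k6 _ sk) //.
by move: k6 sk; case: k => [|[|[|[|[|[|//]]]]]] _ _ /=; rewrite !f0 ?addr0 ?add0r // addrC.
Qed.

Lemma hexcoef_xy a b : \sum_(m < 6) hexcoef m a b * hexx m = a /\
  \sum_(m < 6) hexcoef m a b * hexy m = b.
Proof.
have [k k6 sk] := sector_cover a b.
rewrite (hexcoef_sum (f := fun t m => t * hexx m) k6 sk); last by move=> m; rewrite mul0r.
rewrite (hexcoef_sum (f := fun t m => t * hexy m) k6 sk); last by move=> m; rewrite mul0r.
move: k6 sk; case: k => [|[|[|[|[|[|//]]]]]] _ _; rewrite /hexx /hexy /=;
  by split; ring.
Qed.

Lemma hexcoef2_sum k a b : (k < 6)%N -> in_hexagon a b ->
  (hexcoef2 k a b).1 + (hexcoef2 k a b).2 < 1.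
Proof.
move=> k6 [/andP[h1 h2] /andP[h3 h4] /andP[h5 h6]].
move: k6; case: k => [|[|[|[|[|[|//]]]]]] _ /=; lra.
Qed.

Lemma hexcoef2_inv k (p q : R) : (k < 6)%N -> 0 <= p -> 0 <= q ->
  exists a b, [/\ sector k a b, hexcoef2 k a b = (p, q)
    & p + q < 1 -> in_hexagon a b].
Proof.
move=> k6 p0 q0.
have aux (a b : R) : sector k a b -> hexcoef2 k a b = (p, q) ->
    (p + q < 1 -> in_hexagon a b) -> exists a b, [/\ sector k a b, hexcoef2 k a b = (p, q)
    & p + q < 1 -> in_hexagon a b] by move=> ? ? ?; exists a, b.
move: k6 aux; case: k => [|[|[|[|[|[|//]]]]]] _ aux.
- apply: (aux p q) => //= h; split; lra.
- apply: (aux (- q) (p + q)) => /=; [lra|congr (_, _); ring|move=> h; split; lra].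
- apply: (aux (- (p + q)) p) => /=; [lra|congr (_, _); ring|move=> h; split; lra].
- apply: (aux (- p) (- q)) => /=; [lra|congr (_, _); ring|move=> h; split; lra].
- apply: (aux q (- (p + q))) => /=; [lra|congr (_, _); ring|move=> h; split; lra].
- apply: (aux (p + q) (- p)) => /=; [lra|congr (_, _); ring|move=> h; split; lra].
Qed.

Lemma frm_delta (K : nat -> nat -> R) (i j : 'I_14) :
  frm K (delta_mx 0 i) (delta_mx 0 j) = K i j.
Proof.
rewrite /frm (bigD1 i) //= (bigD1 j) //= !mxE !eqxx !mulr1 big1 => [|l /negbTE lj].
  rewrite addr0 big1 ?addr0 // => l /negbTE li; apply: big1 => n _.
  by rewrite !mxE li andbF mulr0 mul0r.
by rewrite !mxE lj andbF mulr0.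
Qed.

Section Lift.
Variable h : nat -> 'I_14.
Hypothesis hexh : forall m n, (m < 6)%N -> (n < 6)%N ->
  gdist (h m) (h n) = hexdist m n.

Definition hexlift a b : 'rV[R]_14 := \sum_(m < 6) hexcoef m a b *: delta_mx 0 (h m).

Lemma hexliftE k a b : (k < 6)%N -> sector k a b ->
  hexlift a b = (hexcoef2 k a b).1 *: delta_mx 0 (h k) +
                (hexcoef2 k a b).2 *: delta_mx 0 (h (k.+1 %% 6)%N).
Proof.
move=> k6 sk.
by rewrite /hexlift (hexcoef_sum (f := fun t m => t *: delta_mx 0 (h m)) k6 sk)
   // => m; rewrite scale0r.
Qed.

(** The lift is only piecewise linear, but it is a section ([hexcoef_xy]) of the linear map sending
    the vertex [h m] to the corner [m] of a regular hexagon. By [hexcos], on the span of these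
    vertices [D] is the pullback of the planar form under this map. *)
Lemma hexlift_dist a b a' b' :
  frm (@cosk R) (hexlift a b - hexlift a' b') (hexlift a b - hexlift a' b') =
  pnorm2 (a - a') (b - b').
Proof.
pose g m := hexcoef m a b - hexcoef m a' b'.
have gx : \sum_(m < 6) g m * hexx m = a - a'.
  rewrite -{1}(hexcoef_xy a b).1 -{1}(hexcoef_xy a' b').1 -sumrB.
  by apply: eq_bigr => m _; rewrite mulrBl.
have gy : \sum_(m < 6) g m * hexy m = b - b'.
  rewrite -{1}(hexcoef_xy a b).2 -{1}(hexcoef_xy a' b').2 -sumrB.
  by apply: eq_bigr => m _; rewrite mulrBl.
have -> : hexlift a b - hexlift a' b' = \sum_(m < 6) g m *: delta_mx 0 (h m).
  by rewrite /hexlift -sumrB; apply: eq_bigr => m _; rewrite scalerBl.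
rewrite frm_suml; under eq_bigr => m _.
  rewrite frm_sumr; under eq_bigr => n _.
    rewrite frmZl frmZr frm_delta /cosk /cos2 hexh // -hexcos //.
    over.
  over.
have -> : pnorm2 (a - a') (b - b') = (a - a') * (a - a') + ((a - a') * (b - b')
   + (b - b') * (a - a')) / 2 + (b - b') * (b - b') by rewrite /pnorm2; field.
rewrite -gx -gy !mulr_suml -!big_split /= mulr_suml -!big_split /=.
apply: eq_bigr => m _; rewrite !mulr_sumr -!big_split /= mulr_suml -!big_split /=.
by apply: eq_bigr => n _; field.
Qed.

End Lift.

End Plane.

(** * The building near a vertex *)

Lemma simplex_seq (S : set vertex) : is_simplex S ->
  exists2 r : seq vertex, uniq r & forall v, S v -> v \in r.
Proof.
move=> [k [L [Llat _ _ ->]]].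
exists (undup [seq vertex_of (Llat i) | i <- enum 'I_k.+1]); first exact: undup_uniq.
move=> v [i vE]; rewrite mem_undup; apply/mapP; exists i; first by rewrite mem_enum.
exact: vertex_eq.
Qed.

Lemma vertex_sum (V : zmodType) (r : seq vertex) (f : vertex -> V) : uniq r ->
  (forall v, f v != 0 -> v \in r) ->
  \sum_(v \in [set: vertex]) f v = \sum_(v <- r) f v.
Proof.
move=> ur fr; rewrite (fsbigE r f ur) //; last first.
  by move=> v _; apply: contraNeq => /fr.
by apply: eq_bigl => v; rewrite in_setT.
Qed.

(** * Lengths of strings and Lipschitz functions along them *)

Section Strings.
Variables (R : realType) (side : R).
Hypothesis side_gt0 : 0 < side.
Implicit Types x y : building R.

Lemma sum_sq_ge0 (r : seq vertex) (f : vertex -> R) : 0 <= \sum_(v <- r) f v ^+ 2.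
Proof. by apply: sumr_ge0 => v _; rewrite sqr_ge0. Qed.

Lemma simplex_dist_ge0 x y : 0 <= simplex_dist side x y.
Proof. by rewrite mulr_ge0 ?sqrtr_ge0 // ltW. Qed.

Lemma building_seq x y : exists2 r : seq vertex, uniq r &
  forall v, (x v != 0) || (y v != 0) -> v \in r.
Proof.
have [r _ hr] := simplex_seq (coord_simplex x).
have [r' _ hr'] := simplex_seq (coord_simplex y).
exists (undup (r ++ r')); first exact: undup_uniq.
by move=> v /orP[/hr|/hr']; rewrite mem_undup mem_cat => ->; rewrite ?orbT.
Qed.

Lemma coord_lipschitz_step x y v :
  side * `|x v - y v| <= Num.sqrt 2 * simplex_dist side x y.
Proof.
have [r ur hr] := building_seq x y.
have xyr w : (x w - y w) ^+ 2 != 0 -> w \in r.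
  rewrite sqrf_eq0 subr_eq0 => xy; apply: hr; apply: contraNT xy.
  by rewrite negb_or !negbK => /andP[/eqP-> /eqP->].
rewrite /simplex_dist mulrCA ler_pM2l // (vertex_sum ur xyr) -sqrtrM //.
rewrite mulrC divfK // -sqrtr_sqr ler_sqrt ?sum_sq_ge0 //.
have [/xyr vr|/negPn/eqP->] := boolP ((x v - y v) ^+ 2 != 0); last exact: sum_sq_ge0.
by rewrite (bigD1_seq v) //= lerDl sumr_ge0 // => w _; rewrite sqr_ge0.
Qed.

Definition joined x y (l : R) := exists m z, is_string x y m z /\
  string_length side m z <= l.

Lemma string_length_ge0 m (z : nat -> building R) : 0 <= string_length side m z.
Proof. by apply: sumr_ge0 => i _; exact: simplex_dist_ge0. Qed.

Lemma string_prefix x y m z i : is_string x y m z -> (i <= m)%N ->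
  is_string x (z i) i z /\ string_length side i z <= string_length side m z.
Proof.
move=> [z0 zm zs] im; split; first by split=> // j ji; apply: zs; apply: leq_trans im.
rewrite /string_length -(big_mkord xpredT (fun i => simplex_dist side (z i) (z i.+1))).
rewrite -[X in _ <= X](big_mkord xpredT (fun i => simplex_dist side (z i) (z i.+1))).
rewrite (@big_cat_nat _ _ _ i 0 m) //= lerDl.
by apply: sumr_ge0 => j _; exact: simplex_dist_ge0.
Qed.

Lemma joined_trans x y (w0 : building R) l l' : joined x y l -> joined y w0 l' ->
  joined x w0 (l + l').
Proof.
move=> [m [s [[s0 sm ss] sl]]] [m' [s' [[s'0 s'm ss'] sl']]].
pose w n := if (n <= m)%N then s n else s' (n - m)%N.
have wl n : (n <= m)%N -> w n = s n by rewrite /w => ->.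
have wr n : w (m + n)%N = s' n.
  rewrite /w; case: ifP => [|_]; last by rewrite addKn.
  rewrite -{2}(addn0 m) leq_add2l leqn0 => /eqP->; by rewrite addn0 sm s'0.
exists (m + m')%N, w; split.
  split; [by rewrite wl|by rewrite wr|].
  move=> i; have [im _|mi] := ltnP i m; first by rewrite !wl ?(ltnW im) //; apply: ss.
  by rewrite -(subnKC mi) ltn_add2l -addnS !wr; apply: ss'.
rewrite /string_length big_split_ord /=; apply: lerD.
  by rewrite (eq_bigr (fun i : 'I_m => simplex_dist side (s i) (s i.+1))) // => i _;
    rewrite !wl // ltnW.
by rewrite (eq_bigr (fun i : 'I_m' => simplex_dist side (s' i) (s' i.+1))) // => i _;
  rewrite -addnS !wr.
Qed.

Lemma joined_step x y : in_common_simplex x y -> joined x y (simplex_dist side x y).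
Proof.
move=> xy; exists 1%N, (fun n => if n == 0%N then x else y); split.
  by split=> // -[].
by rewrite /string_length big_ord1.
Qed.

Lemma building_dist_le x y l : joined x y l -> building_dist side x y <= l.
Proof.
move=> [m [z [xyz zl]]]; apply: le_trans zl; apply: ge_inf; last by exists m, z.
by exists 0 => _ [m' [z' [_ ->]]]; exact: string_length_ge0.
Qed.

Lemma building_dist_ge x y a : (exists l, joined x y l) ->
  (forall l, joined x y l -> a <= l) -> a <= building_dist side x y.
Proof.
move=> [l [m [z [xyz zl]]]] h; apply: lb_le_inf; first by exists (string_length side m z), m, z.
by move=> _ [m' [z' [xyz' ->]]]; apply: h; exists m', z'.
Qed.

Lemma building_dist_joined x y : 0 < building_dist side x y -> exists l, joined x y l.
Proof.
(* The infimum of the empty set is 0, so a positive distance guarantees that a string exists. *)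
move=> h; apply: contrapT => n; move: h; rewrite /building_dist.
rewrite (_ : [set _ | _] = set0) ?inf0 ?ltxx //.
apply/seteqP; split=> // l [m [z [xyz _]]]; apply: n.
by exists (string_length side m z), m, z.
Qed.

Lemma string_lipschitz (phi : building R -> R) (P : building R -> Prop) c x y m z :
  (forall u w, in_common_simplex u w -> P u -> P w ->
     phi u - phi w <= c * simplex_dist side u w) ->
  is_string x y m z -> (forall i, (i <= m)%N -> P (z i)) ->
  phi x - phi y <= c * string_length side m z.
Proof.
move=> lip [<- <- zs] Pz; rewrite /string_length mulr_sumr.
elim: m zs Pz => [|m IH] zs Pz; first by rewrite big_ord0 subrr.
rewrite big_ord_recr /=.
have -> : phi (z 0%N) - phi (z m.+1) =
  (phi (z 0%N) - phi (z m)) + (phi (z m) - phi (z m.+1)) by ring.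
apply: lerD.
  by apply: IH => i im; [apply: zs|apply: Pz]; [exact: leqW|exact: leqW].
by apply: lip; [exact: zs|apply: Pz|exact: Pz].
Qed.

(** This keeps short strings inside an open star: a coordinate that is positive at [x] cannot vanish
    along a short string. *)
Lemma coord_lipschitz x y v l : joined x y l ->
  side * `|x v - y v| <= Num.sqrt 2 * l.
Proof.
move=> [m [z [xyz zl]]]; apply: (@le_trans _ _ (Num.sqrt 2 * string_length side m z)).
  have s2 : 0 <= Num.sqrt 2 :> R by rewrite sqrtr_ge0.
  have key (a : R) : a ^+ 2 = 1 ->
      side * (a * (x v - y v)) <= Num.sqrt 2 * string_length side m z.
    move=> a1.
    have -> : side * (a * (x v - y v)) = side * (a * x v) - side * (a * y v) by ring.
    apply: (@string_lipschitz (fun u => side * (a * u v)) (fun=> True)) xyz _ => //.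
    move=> u w _ _ _; apply: le_trans (coord_lipschitz_step u w v).
    have -> : side * (a * u v) - side * (a * w v) = side * (a * (u v - w v)) by ring.
    rewrite ler_pM2l //; apply: le_trans (ler_norm _) _.
    by rewrite normrM -sqrtr_sqr a1 sqrtr1 mul1r.
  have [h1|h1] := leP 0 (x v - y v).
    by rewrite ger0_norm // -[x v - y v]mul1r; apply: key; rewrite expr1n.
  by rewrite ltr0_norm // -mulN1r; apply: key; rewrite sqrrN expr1n.
by rewrite ler_wpM2l // sqrtr_ge0.
Qed.

End Strings.

Section Chambers.
Variable R : realType.
Implicit Types u w : 'rV[R]_14.

Lemma frm_subC K u w : frm K (u - w) (u - w) = frm K (w - u) (w - u).
Proof. by rewrite -opprB frmNl frmNr opprK. Qed.

Lemma adj_ord_neq (i j : 'I_14) : adj i j -> i != j.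
Proof. by move=> /(adj_neq (ltn_ord i) (ltn_ord j)). Qed.

Lemma pair_sum (V : zmodType) (i j : 'I_14) (f : 'I_14 -> V) : i != j ->
  (forall k, ~~ pred2 i j k -> f k = 0) -> \sum_k f k = f i + f j.
Proof.
move=> ij h; rewrite (bigD1 i) //= (bigD1 j) 1?eq_sym //= big1 ?addr0 // => k /andP[ki kj].
by apply: h; rewrite /= negb_or ki kj.
Qed.

Lemma in_supp_clique (i j : 'I_14) u : adj i j -> in_supp (pred2 i j) u -> clique u.
Proof.
move=> aij su k l kl akl.
have [Pk|/su->] := boolP (pred2 i j k); last by rewrite mul0r.
have [Pl|/su->] := boolP (pred2 i j l); last by rewrite mulr0.
have aji : adj j i by rewrite adj_sym.
by case/orP: Pk Pl akl kl => /eqP-> /orP[] /eqP->; rewrite ?eqxx ?aij ?aji.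
Qed.

Lemma in_supp_pair (i j : 'I_14) u : i != j -> in_supp (pred2 i j) u ->
  u = u 0 i *: delta_mx 0 i + u 0 j *: delta_mx 0 j.
Proof.
move=> ij su; apply/rowP => k; rewrite !mxE /=.
have [->|ki] := eqVneq k i; first by rewrite (negbTE ij) mulr1 mulr0 addr0.
have [->|kj] := eqVneq k j; first by rewrite mulr1 mulr0 add0r.
by rewrite !mulr0 addr0 su //= negb_or ki kj.
Qed.

Lemma cosk_id (i : 'I_14) : cosk R i i = 1.
Proof. by rewrite /cosk /cos2 /gdist eqxx /= divff. Qed.

Lemma cosk_adj (i j : 'I_14) : adj i j -> cosk R i j = 1 / 2.
Proof.
by move=> aij; rewrite /cosk /cos2 /gdist -[_ == _]/(i == j) (negbTE (adj_ord_neq aij)) aij.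
Qed.

Lemma frm_pair (i j : 'I_14) u : adj i j -> in_supp (pred2 i j) u ->
  frm (@cosk R) u u = u 0 i ^+ 2 + u 0 i * u 0 j + u 0 j ^+ 2.
Proof.
move=> aij su; rewrite [in LHS](in_supp_pair (adj_ord_neq aij) su) !frmE !frm_delta.
by rewrite !cosk_id !cosk_adj // ?(adj_sym (ltn_ord j)) //; field.
Qed.

Lemma chamber2 u w : clique u -> clique w ->
  (forall i j : 'I_14, i != j -> ~~ adj i j -> u 0 i * w 0 j = 0) ->
  exists i j : 'I_14, [/\ adj i j, in_supp (pred2 i j) u & in_supp (pred2 i j) w].
Proof.
move=> cu cw cuw.
have [|i [j [aij h]]] := @clique_chamber (fun k => u 0 k <> 0 \/ w 0 k <> 0).
  move=> k l hk hl kl; apply: contrapT => /negP akl.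
  have lk : l != k by rewrite eq_sym.
  have alk : ~~ adj l k by rewrite adj_sym.
  have uu := cu _ _ kl akl; have ww := cw _ _ kl akl.
  have uw := cuw _ _ kl akl; have wu := cuw _ _ lk alk.
  move: hk hl => [/eqP hk|/eqP hk] [/eqP hl|/eqP hl].
  - by move/eqP: uu; rewrite mulf_eq0 (negbTE hk) (negbTE hl).
  - by move/eqP: uw; rewrite mulf_eq0 (negbTE hk) (negbTE hl).
  - by move/eqP: wu; rewrite mulf_eq0 (negbTE hk) (negbTE hl).
  - by move/eqP: ww; rewrite mulf_eq0 (negbTE hk) (negbTE hl).
exists i, j; split=> // k /=; rewrite negb_or => /andP[/eqP ki /eqP kj];
  apply: contrapT => hk; by have [] := h k ltac:(by [left|right]).
Qed.

Lemma chamber1 u : clique u -> exists i j : 'I_14, adj i j /\ in_supp (pred2 i j) u.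
Proof.
by move=> cu; have [i [j [? ? _]]] := chamber2 cu cu cu; exists i, j.
Qed.

End Chambers.

(** * The open star of a vertex in link coordinates *)

Section Star.
Variables (R : realType) (side : R).
Hypothesis side_gt0 : 0 < side.
Variables (v0 : vertex) (lk : 'I_14 -> vertex).
Hypothesis lkP : is_link v0 lk.
Implicit Types x y : building R.

Let lk_inj : injective lk. Proof. by case: lkP. Qed.
Let lk_v0 i : lk i <> v0. Proof. by case: lkP => _ h _ _; exact: h. Qed.

Definition lg x : 'rV[R]_14 := \row_i x (lk i).


Lemma lg_ge0 x i : 0 <= lg x 0 i.
Proof. by rewrite mxE coord_ge0. Qed.

Lemma star_simplex x : x v0 != 0 -> exists i j : 'I_14, adj i j /\
  forall v, x v != 0 -> [\/ v = v0, v = lk i | v = lk j].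
Proof.
by move=> xv0; case: lkP => _ _ h _; apply: h xv0; exact: coord_simplex.
Qed.

Lemma in_supp_lg x (i j : 'I_14) : (forall v, x v != 0 -> [\/ v = v0, v = lk i | v = lk j]) ->
  in_supp (pred2 i j) (lg x).
Proof.
move=> h k; rewrite /= negb_or mxE => /andP[ki kj]; apply/eqP/negPn/negP => /h[].
- exact: lk_v0.
- by move=> /lk_inj /eqP; rewrite (negbTE ki).
- by move=> /lk_inj /eqP; rewrite (negbTE kj).
Qed.

Lemma star_sum (f : vertex -> R) (i j : 'I_14) : adj i j ->
  (forall v, f v != 0 -> [\/ v = v0, v = lk i | v = lk j]) ->
  \sum_(v \in [set: vertex]) f v = f v0 + f (lk i) + f (lk j).
Proof.
move=> aij h; rewrite (@vertex_sum _ [:: v0; lk i; lk j]).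
- by rewrite !big_cons big_nil addr0 addrA.
- rewrite /= mem_seq2 mem_seq1 negb_or andbT -andbA; apply/and3P; split.
  + by apply/eqP => /esym/lk_v0.
  + by apply/eqP => /esym/lk_v0.
  + by apply/eqP => /lk_inj/eqP; rewrite (negbTE (adj_ord_neq aij)).
- by move=> v /h[] ->; rewrite !in_cons eqxx ?orbT.
Qed.

Lemma lg_sum x : x v0 != 0 -> x v0 = 1 - \sum_i lg x 0 i.
Proof.
move=> /star_simplex[i [j [aij h]]].
have := coord_sum x; rewrite (star_sum aij h) => <-.
rewrite (pair_sum (adj_ord_neq aij)) ?mxE; first by ring.
by move=> k /(in_supp_lg h).
Qed.

Lemma lg_clique x : x v0 != 0 -> clique (lg x).
Proof.
by move=> /star_simplex[i [j [aij h]]]; exact: in_supp_clique aij (in_supp_lg h).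
Qed.

(** The coordinate at [v0] is minus the sum of the other two, up to a constant. Eliminating it turns
    half the sum of three squares into [a^2 + a b + b^2], the form of a basis at angle pi / 3. *)
Lemma star_dist_pair x y (i j : 'I_14) : adj i j ->
  (forall v, x v != 0 -> [\/ v = v0, v = lk i | v = lk j]) ->
  (forall v, y v != 0 -> [\/ v = v0, v = lk i | v = lk j]) ->
  simplex_dist side x y = side * Num.sqrt (dst (lg x) (lg y)).
Proof.
move=> aij hx hy; rewrite /simplex_dist (star_sum aij); last first.
  move=> v; rewrite sqrf_eq0 subr_eq0 => xy.
  have [xv|/hx//] := eqVneq (x v) 0.
  by apply: hy; apply: contraNneq xy => yv; rewrite xv yv.
congr (_ * Num.sqrt _).
have sx := in_supp_lg hx; have sy := in_supp_lg hy.
rewrite /dst (frm_pair aij); last first.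
  by move=> k hk; have := sx _ hk; have := sy _ hk; rewrite !mxE => -> ->; rewrite subrr.
have ex := coord_sum x; have ey := coord_sum y.
rewrite (star_sum aij hx) in ex; rewrite (star_sum aij hy) in ey.
have e : x v0 - y v0 = - ((x (lk i) - y (lk i)) + (x (lk j) - y (lk j))).
  by apply/eqP; rewrite -subr_eq0 -(subrr 1) -{1}ex -ey; apply/eqP; ring.
by rewrite e !mxE; field.
Qed.

Lemma star_dist x y : in_common_simplex x y -> x v0 != 0 -> y v0 != 0 ->
  simplex_dist side x y = side * Num.sqrt (dst (lg x) (lg y)).
Proof.
move=> [S [Ss xS yS]] x0 y0; case: lkP => _ _ /(_ S Ss (xS _ x0))[i [j [aij h]]] _.
by apply: (star_dist_pair aij) => v hv; apply: h; [apply: xS|apply: yS].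
Qed.

(* The lower bound: inside the open star of v0 a string is mapped to the
   plane by a folding centred at a chamber of x, while leaving the open star
   costs at least the decrease of the coordinate at v0. *)
Lemma joined_lower x y l : x v0 != 0 -> joined side x y l ->
  side * Num.sqrt (dst (lg x) (lg y)) <= l \/ side * x v0 <= Num.sqrt 2 * l.
Proof.
move=> x0 [m [z [xyz zl]]].
have [out|inside] := pselect (exists2 i, (i <= m)%N & z i v0 = 0).
  right; have [i im zi] := out; have [xz zlen] := string_prefix side_gt0 xyz im.
  have := @coord_lipschitz _ _ side_gt0 x (z i) v0 l.
  rewrite zi subr0 ger0_norm ?coord_ge0 //; apply.
  by exists i, z; split=> //; apply: le_trans zl.
left; have y0 : y v0 != 0.
  apply/eqP => y0; apply: inside; exists m => //; by case: xyz => _ -> _.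
have [i [j [aij h]]] := star_simplex x0; have sx := in_supp_lg h.
have fK := fold_folding R aij; set K := gramk _ _ _ _ in fK.
have [sK pK _] := fK.
apply: le_trans zl.
have pos z' (w : building R) : pos_off z' (lg w) by move=> k _; exact: lg_ge0.
have -> : dst (lg x) (lg y) = frm K (lg y - lg x) (lg y - lg x).
  rewrite (folding_eq fK) //; last exact: lg_clique.
  by rewrite /dst frm_subC.
pose phi u := - (side * Num.sqrt (frm K (lg u - lg x) (lg u - lg x))).
have := @string_lipschitz _ side phi (fun u => u v0 != 0) 1 x y m z _ xyz _.
rewrite /phi {phi}.
rewrite mul1r subrr frm0l sqrtr0 mulr0 oppr0 opprK add0r; apply; last first.
  by move=> k km; apply/eqP => zk; apply: inside; exists k.
move=> u w uw u0 w0; rewrite mul1r star_dist // opprK addrC -mulrBr ler_pM2l //.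
rewrite lerBlDl; have -> : lg w - lg x = (lg u - lg x) + (lg w - lg u).
  by rewrite [RHS]addrC addrA subrK.
apply: le_trans (frm_triangle _ _ sK pK) _; rewrite lerD2l; apply: ler_wsqrtr.
have -> : dst (lg u) (lg w) = dst (lg w) (lg u) by rewrite /dst frm_subC.
by apply: (folding_le fK) => //; exact: lg_clique.
Qed.

(** The missing weight goes to [v0]. The four cases are the possible supports, each of which has to
    be a simplex. *)
Lemma star_point (c : 'rV[R]_14) : (forall i, 0 <= c 0 i) -> clique c ->
  \sum_i c 0 i < 1 -> exists x, x v0 != 0 /\ lg x = c.
Proof.
move=> c0 cc c1; have [i [j [aij sc]]] := chamber1 cc.
have ij := adj_ord_neq aij.
pose f v := (1 - \sum_i c 0 i) * (v == v0)%:R + \sum_i c 0 i * (v == lk i)%:R.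
have f_v0 : f v0 = 1 - \sum_i c 0 i.
  rewrite /f eqxx mulr1 [X in _ + X]big1 ?addr0 // => k _.
  by case: eqP => [/esym/lk_v0//|_]; rewrite mulr0.
have f_lk k : f (lk k) = c 0 k.
  rewrite /f; case: eqP => [/lk_v0//|_]; rewrite mulr0 add0r (bigD1 k) //= eqxx mulr1.
  rewrite big1 ?addr0 // => l lk'; case: eqP => [/lk_inj e|_]; last by rewrite mulr0.
  by rewrite e eqxx in lk'.
have f_out v : f v != 0 -> [\/ v = v0, v = lk i | v = lk j].
  have [->|vv0] := eqVneq v v0; first by constructor 1.
  rewrite /f (negbTE vv0) mulr0 add0r.
  rewrite (pair_sum ij) => [|k /sc->]; last by rewrite mul0r.
  have [->|vi] := eqVneq v (lk i); first by constructor 2.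
  have [->|vj] := eqVneq v (lk j); first by constructor 3.
  by rewrite !mulr0 addr0 eqxx.
have f_ge0 v : 0 <= f v.
  rewrite addr_ge0 ?mulr_ge0 ?subr_ge0 ?(ltW c1) // sumr_ge0 // => k _.
  by rewrite mulr_ge0.
have f_sum : \sum_(v \in [set: vertex]) f v = 1.
  rewrite (star_sum aij f_out) f_v0 !f_lk (pair_sum ij) => [|k /sc //]; ring.
have f_v0_neq : f v0 != 0 by rewrite f_v0 gt_eqF // subr_gt0.
have f_simplex : is_simplex [set v | f v != 0].
  case: lkP => _ _ _ /(_ _ _ aij)[S0 S1 S2].
  have S1' : is_simplex [set v | v = v0 \/ v = lk j].
    by case: lkP => _ _ _ /(_ j i); rewrite adj_sym // aij => /(_ isT)[].
  have [ci|ci] := eqVneq (c 0 i) 0; have [cj|cj] := eqVneq (c 0 j) 0.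
  - rewrite (_ : [set v | _] = [set v0]) //; apply/seteqP; split=> [v /= fv|v -> //].
    by case: (f_out v fv) => // ve; move: fv; rewrite ve f_lk ?ci ?cj eqxx.
  - rewrite (_ : [set v | _] = [set v | v = v0 \/ v = lk j]) //; apply/seteqP.
    split=> [v /= fv|v /= [->|->]]; rewrite ?f_lk //.
    case: (f_out v fv) => [->|ve|->]; [by left| |by right].
    by move: fv; rewrite ve f_lk ci eqxx.
  - rewrite (_ : [set v | _] = [set v | v = v0 \/ v = lk i]) //; apply/seteqP.
    split=> [v /= fv|v /= [->|->]]; rewrite ?f_lk //.
    case: (f_out v fv) => [->|->|ve]; [by left|by right|].
    by move: fv; rewrite ve f_lk cj eqxx.
  - rewrite (_ : [set v | _] = [set v | [\/ v = v0, v = lk i | v = lk j]]) //.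
    by apply/seteqP; split=> [v /f_out //|v /= [] ->]; rewrite ?f_lk.
exists (Building f_ge0 f_sum f_simplex); split=> //=.
by apply/rowP => k; rewrite mxE /= f_lk.
Qed.

Lemma star_common x y (i j : 'I_14) : adj i j -> x v0 != 0 -> y v0 != 0 ->
  in_supp (pred2 i j) (lg x) -> in_supp (pred2 i j) (lg y) -> in_common_simplex x y.
Proof.
move=> aij x0 y0 sx sy.
have aux (u : building R) : u v0 != 0 -> in_supp (pred2 i j) (lg u) ->
    [set v | u v != 0] `<=` [set v | [\/ v = v0, v = lk i | v = lk j]].
  move=> u0 su v /= uv; have [k [l [akl h]]] := star_simplex u0.
  have aux' n : v = lk n -> [\/ v = v0, v = lk i | v = lk j].
    move=> vn; have [/orP[] /eqP ni|nP] := boolP (pred2 i j n).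
    - by constructor 2; rewrite vn ni.
    - by constructor 3; rewrite vn ni.
    - by move: (su _ nP) uv; rewrite mxE -vn => ->; rewrite eqxx.
  by case: (h v uv) => [->|/aux'|/aux'] //; constructor 1.
case: lkP => _ _ _ /(_ _ _ aij)[_ _ S2].
by exists [set v | [\/ v = v0, v = lk i | v = lk j]]; split=> //; apply: aux.
Qed.

End Star.

Lemma gdist_adj i j : gdist i j = 1%N -> adj i j.
Proof. by rewrite /gdist; do 3!case: ifP => //. Qed.

Lemma adj_gdist (i j : 'I_14) : adj i j -> gdist i j = 1%N.
Proof.
by move=> aij; rewrite /gdist -[_ == _]/(i == j) (negbTE (adj_ord_neq aij)) aij.
Qed.

Lemma hexdist1 m n : (m < 6)%N -> (n < 6)%N -> hexdist m n = 1%N ->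
  n = (m.+1 %% 6)%N \/ m = (n.+1 %% 6)%N.
Proof.
case: m => [|[|[|[|[|[|//]]]]]] _; case: n => [|[|[|[|[|[|//]]]]]] _ //= _;
  by [left|right].
Qed.

Lemma hexdist_succ m : (m < 6)%N -> hexdist m (m.+1 %% 6) = 1%N.
Proof. by case: m => [|[|[|[|[|[|//]]]]]]. Qed.

Section HexParam.
Variables (R : realType) (h : nat -> 'I_14).
Hypothesis hexh : forall m n, (m < 6)%N -> (n < 6)%N ->
  gdist (h m) (h n) = hexdist m n.

Lemma hex_adj m : (m < 6)%N -> adj (h m) (h (m.+1 %% 6)%N).
Proof. by move=> m6; apply: gdist_adj; rewrite hexh ?ltn_pmod // hexdist_succ. Qed.

Lemma delta_sum (i : 'I_14) : \sum_k (delta_mx 0 i : 'rV[R]_14) 0 k = 1.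
Proof.
rewrite (bigD1 i) //= mxE !eqxx big1 ?addr0 // => k /negbTE ki.
by rewrite mxE ki andbF.
Qed.

Lemma hexlift_supp k (a b : R) : (k < 6)%N -> sector k a b ->
  in_supp (pred2 (h k) (h (k.+1 %% 6)%N)) (hexlift h a b).
Proof.
move=> k6 sk l /=; rewrite negb_or => /andP[/negbTE l1 /negbTE l2].
by rewrite (hexliftE h k6 sk) !mxE l1 l2 !mulr0 addr0.
Qed.

Lemma hexlift_cone (a b : R) : [/\ forall i, 0 <= hexlift h a b 0 i, clique (hexlift h a b)
  & in_hexagon a b -> \sum_i hexlift h a b 0 i < 1].
Proof.
have [k k6 sk] := sector_cover a b; have [p0 q0] := hexcoef2_ge0 sk; split.
- by move=> i; rewrite (hexliftE h k6 sk) !mxE addr_ge0 // mulr_ge0.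
- exact: in_supp_clique (hex_adj k6) (hexlift_supp k6 sk).
- move=> hab; rewrite (hexliftE h k6 sk).
  under eq_bigr do rewrite mxE mxE [X in _ + X]mxE.
  by rewrite big_split /= -!mulr_sumr !delta_sum !mulr1; exact: hexcoef2_sum.
Qed.

Lemma hex_param (c : 'rV[R]_14) m n : (m < 6)%N -> (n < 6)%N -> adj (h m) (h n) ->
  (forall i, 0 <= c 0 i) -> in_supp (pred2 (h m) (h n)) c -> \sum_i c 0 i < 1 ->
  exists a b, c = hexlift h a b /\ in_hexagon a b.
Proof.
move=> m6 n6 amn c0 sc c1.
wlog nm : m n m6 n6 amn sc / n = (m.+1 %% 6)%N.
  move=> hw; have := adj_gdist amn; rewrite hexh // => /(hexdist1 m6 n6)[/hw|]; first exact.
  move/(hw n m n6 m6); apply; first by rewrite adj_sym.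
  by move=> k; rewrite /= orbC; exact: sc.
have ij := adj_ord_neq amn.
have [a [b [sk e hab]]] := hexcoef2_inv m6 (c0 (h m)) (c0 (h n)).
exists a, b; split.
  by rewrite (hexliftE h m6 sk) e /= -nm; exact: in_supp_pair.
by apply: hab; rewrite -(pair_sum ij (f := fun i => c 0 i)).
Qed.

End HexParam.

Section Local.
Variables (R : realType) (side : R).
Hypothesis side_gt0 : 0 < side.
Variables (v0 : vertex) (lk : 'I_14 -> vertex).
Hypothesis lkP : is_link v0 lk.
Implicit Types x y : building R.

Local Notation lg := (@lg R lk).

Lemma lg_sum_lt1 x : x v0 != 0 -> \sum_i lg x 0 i < 1.
Proof.
move=> x0; rewrite -subr_gt0 -(lg_sum lkP x0) lt_neqAle eq_sym x0.
exact: coord_ge0.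
Qed.

(** A hexagon containing the chambers of both points places them in one plane; [planar_connect] cuts
    the straight segment there into pieces inside sectors, and these lift to a string of the same
    length. *)
Lemma joined_upper x y : x v0 != 0 -> y v0 != 0 ->
  joined side x y (side * Num.sqrt (dst (lg x) (lg y))).
Proof.
move=> x0 y0.
have [i [j [aij sx]]] := chamber1 (lg_clique lkP x0).
have [k [l [akl sy]]] := chamber1 (lg_clique lkP y0).
have [s [si sj sk sl] [ss hs]] :=
  hexagon_ex (ltn_ord i) (ltn_ord j) (ltn_ord k) (ltn_ord l) aij akl.
pose h m : 'I_14 := insubd ord0 (nth 0%N s m).
have hE m : (m < 6)%N -> h m = nth 0%N s m :> nat.
  by move=> m6; rewrite /h val_insubd; have [->] := hs m m m6 m6.
have hexh m n : (m < 6)%N -> (n < 6)%N -> gdist (h m) (h n) = hexdist m n.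
  by move=> m6 n6; rewrite !hE //; have [_ ->] := hs m n m6 n6.
have idx (n : 'I_14) : val n \in s -> exists2 m, (m < 6)%N & n = h m.
  move=> ns; have i6 : (index (val n) s < 6)%N by move: ns; rewrite -index_mem ss.
  by exists (index (val n) s) => //; apply: val_inj => /=; rewrite hE ?nth_index.
have [mi mi6 iE] := idx _ si; have [mj mj6 jE] := idx _ sj.
have [mk mk6 kE] := idx _ sk; have [ml ml6 lE] := idx _ sl.
rewrite iE jE in aij sx; rewrite kE lE in akl sy.
have [a [b [xE hab]]] := hex_param hexh mi6 mj6 aij (lg_ge0 lk x) sx (lg_sum_lt1 x0).
have [a' [b' [yE hab']]] := hex_param hexh mk6 ml6 akl (lg_ge0 lk y) sy (lg_sum_lt1 y0).
(* The end point is required to lie in the open hexagon so that, in [ctrans], the intermediate point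
   can be lifted to the building. *)
pose con a b a' b' l := in_hexagon a' b' /\ forall x y, x v0 != 0 -> y v0 != 0 ->
  lg x = hexlift h a b -> lg y = hexlift h a' b' -> joined side x y (side * l).
have ctrans a1 b1 a2 b2 a3 b3 l1 l2 :
    con a1 b1 a2 b2 l1 -> con a2 b2 a3 b3 l2 -> con a1 b1 a3 b3 (l1 + l2).
  move=> [h2 c12] [h3 c23]; split=> // x1 x3 x10 x30 e1 e3.
  have [n1 n2 /(_ h2) n3] := hexlift_cone hexh a2 b2.
  have [x2 [x20 e2]] := star_point lkP n1 n2 n3.
  rewrite mulrDr; apply: (joined_trans (y := x2)); first exact: c12.
  exact: c23.
have cstep m a1 b1 a2 b2 : (m < 6)%N -> in_hexagon a1 b1 -> in_hexagon a2 b2 ->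
    sector m a1 b1 -> sector m a2 b2 ->
    con a1 b1 a2 b2 (Num.sqrt (pnorm2 (a1 - a2) (b1 - b2))).
  move=> m6 h1 h2 s1 s2; split=> // x1 x2 x10 x20 e1 e2.
  rewrite -(hexlift_dist hexh) -e1 -e2.
  have su1 : in_supp (pred2 (h m) (h (m.+1 %% 6)%N)) (lg x1).
    by rewrite e1; apply: hexlift_supp.
  have su2 : in_supp (pred2 (h m) (h (m.+1 %% 6)%N)) (lg x2).
    by rewrite e2; apply: hexlift_supp.
  have cs := star_common lkP (hex_adj hexh m6) x10 x20 su1 su2.
  by rewrite -(star_dist side lkP cs) //; exact: joined_step.
have [_ hc] := planar_connect ctrans cstep hab hab'.
by rewrite xE yE /dst hexlift_dist //; exact: hc.
Qed.

Lemma star_building_dist_le x y : x v0 != 0 -> y v0 != 0 ->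
  building_dist side x y <= side * Num.sqrt (dst (lg x) (lg y)).
Proof. by move=> x0 y0; apply: building_dist_le => //; exact: joined_upper. Qed.

(** The last hypothesis makes any string leaving the open star at least as long as the direct
    route. *)
Lemma star_building_dist x y : x v0 != 0 -> y v0 != 0 ->
  Num.sqrt 2 * Num.sqrt (dst (lg x) (lg y)) <= x v0 ->
  building_dist side x y = side * Num.sqrt (dst (lg x) (lg y)).
Proof.
move=> x0 y0 small; apply/eqP; rewrite eq_le star_building_dist_le //=.
apply: building_dist_ge; first by eexists; exact: joined_upper.
move=> l /(joined_lower side_gt0 lkP x0)[//|xl].
have s2 : 0 < Num.sqrt 2 :> R by rewrite sqrtr_gt0.
rewrite -(ler_pM2l s2); apply: le_trans xl.
by rewrite mulrCA ler_pM2l.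
Qed.

Lemma building_coord_lipschitz x y v : 0 < building_dist side x y ->
  side * `|x v - y v| <= Num.sqrt 2 * building_dist side x y.
Proof.
move=> /building_dist_joined ex.
have s2 : 0 < Num.sqrt 2 :> R by rewrite sqrtr_gt0.
rewrite -ler_pdivrMl //; apply: building_dist_ge => // l /coord_lipschitz.
by move=> /(_ side_gt0 v); rewrite ler_pdivrMl.
Qed.

(** An estimate for the indefinite form that is obtained from the building: [dst] gives the length
    of a string, and coordinates are Lipschitz along strings. *)
Lemma cos_coord_le (u w : 'rV[R]_14) i : (forall i, 0 <= u 0 i) -> (forall i, 0 <= w 0 i) ->
  clique u -> clique w -> \sum_i u 0 i < 1 -> \sum_i w 0 i < 1 ->
  `|u 0 i - w 0 i| <= Num.sqrt 2 * Num.sqrt (dst u w).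
Proof.
move=> u0 w0 cu cw u1 w1.
have [x [x0 <-]] := star_point lkP u0 cu u1; have [y [y0 <-]] := star_point lkP w0 cw w1.
have := coord_lipschitz side_gt0 (lk i) (joined_upper x0 y0).
by rewrite mulrCA ler_pM2l // !mxE.
Qed.

End Local.

(** * The tangent cone *)

Section Tang.
Variable R : realType.
Implicit Types b u w : 'rV[R]_14.

(* The vectors pointing from b into the cone of nonnegative vectors supported
   on a clique. *)
Definition tang b u := [/\ forall i, b 0 i = 0 -> 0 <= u 0 i, clique u
  & forall i j : 'I_14, i != j -> ~~ adj i j -> b 0 i * u 0 j = 0].

Definition in_cone b := (forall i, 0 <= b 0 i) /\ clique b.

Lemma frm_subZ s t u w : frm (@cosk R) (s *: u - t *: w) (s *: u - t *: w) =
  s ^+ 2 * frm (@cosk R) u u + t ^+ 2 * frm (@cosk R) w w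
  - 2 * s * t * frm (@cosk R) u w.
Proof. by rewrite frm_sub ?frmZl ?frmZr; [ring|exact: cosk_sym]. Qed.

Lemma clique0 : clique (0 : 'rV[R]_14).
Proof. by move=> i j _ _; rewrite !mxE mulr0. Qed.

Lemma tang0 b : tang b 0.
Proof. by split; [move=> i _; rewrite mxE|exact: clique0|move=> i j _ _; rewrite mxE mulr0]. Qed.

Lemma tangZ b a u : 0 <= a -> tang b u -> tang b (a *: u).
Proof.
move=> a0 [h1 h2 h3]; split.
- by move=> i /h1 ui; rewrite mxE mulr_ge0.
- by move=> i j ij aij; rewrite !mxE mulrACA h2 // mulr0.
- by move=> i j ij aij; rewrite !mxE mulrCA h3 // mulr0.
Qed.

Lemma in_suppD (P : pred 'I_14) u w : in_supp P u -> in_supp P w -> in_supp P (u + w).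
Proof. by move=> su sw i Pi; rewrite mxE su ?sw ?addr0. Qed.

Lemma in_suppZ (P : pred 'I_14) a u : in_supp P u -> in_supp P (a *: u).
Proof. by move=> su i Pi; rewrite mxE su ?mulr0. Qed.

Lemma tang_chamber b u : in_cone b -> tang b u ->
  exists i j : 'I_14, [/\ adj i j, in_supp (pred2 i j) b & in_supp (pred2 i j) u].
Proof. by move=> [_ cb] [_ cu cbu]; exact: chamber2. Qed.

Lemma tang_pos_off b u (P : pred 'I_14) : in_supp P b -> tang b u -> pos_off P u.
Proof. by move=> sb [h _ _] i /sb/h. Qed.

Lemma tang_clique b u s : in_cone b -> tang b u -> clique (b + s *: u).
Proof.
move=> hb hu; have [i [j [aij sb su]]] := tang_chamber hb hu.
exact/(in_supp_clique aij)/in_suppD/in_suppZ.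
Qed.

Lemma tang_diff b w : in_cone b -> in_cone w -> (forall i, w 0 i = 0 -> b 0 i = 0) ->
  tang b (w - b).
Proof.
move=> [b0 cb] [w0 cw] wb; have [i [j [aij sw]]] := chamber1 cw.
have sb : in_supp (pred2 i j) b by move=> k /sw/wb.
have swb : in_supp (pred2 i j) (w - b) by move=> k hk; rewrite !mxE sw ?sb ?subrr.
split.
- by move=> k bk; rewrite !mxE bk subr0.
- exact: in_supp_clique swb.
- move=> k l kl akl.
  have [Pk|/sb->] := boolP (pred2 i j k); last by rewrite mul0r.
  have [Pl|/swb->] := boolP (pred2 i j l); last by rewrite mulr0.
  have aji : adj j i by rewrite adj_sym.
  by case/orP: Pk Pl akl kl => /eqP-> /orP[] /eqP->; rewrite ?eqxx ?aij ?aji.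
Qed.

(** Positivity comes from folding onto an apartment through a chamber containing [b] and [w], which
    preserves both norms and the product with [w]. *)
Lemma tang_CS b u w : in_cone b -> tang b u -> tang b w ->
  `|frm (@cosk R) u w| <= Num.sqrt (frm (@cosk R) u u) * Num.sqrt (frm (@cosk R) w w).
Proof.
move=> hb hu hw; have [i [j [aij sb sw]]] := tang_chamber hb hw.
have fK := fold_folding R aij; set K := gramk _ _ _ _ in fK.
have [sK pK _] := fK; have [_ cu _] := hu; have [_ cw _] := hw.
rewrite -(folding_supp fK u sw) -(folding_diag fK cu) -(folding_diag fK cw).
rewrite -sqrtrM ?pK // -sqrtr_sqr; apply: ler_wsqrtr.
exact: frm_CS.
Qed.

Lemma tang_frm_ge0 b u w : in_cone b -> tang b u -> tang b w ->
  0 <= frm (@cosk R) (u - w) (u - w).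
Proof.
move=> hb hu hw; have [i [j [aij sb sw]]] := tang_chamber hb hw.
have fK := fold_folding R aij; have [sK pK _] := fK; have [_ cu _] := hu.
by rewrite -(folding_eq fK cu sw); exact: pK.
Qed.

Lemma tang_small b u : in_cone b -> \sum_i b 0 i < 1 -> tang b u ->
  exists2 e, 0 < e & forall s, 0 <= s <= e ->
    [/\ in_cone (b + s *: u) & \sum_i (b + s *: u) 0 i < 1].
Proof.
move=> hb b1 hu.
pose f i := if 0 < b 0 i then b 0 i / (1 + `|u 0 i|) else 1.
pose g := (1 - \sum_i b 0 i) / (1 + `|\sum_i u 0 i|) / 2.
have n1 (a : R) : 0 < 1 + `|a| by rewrite ltr_pwDl.
exists (Num.min g (\big[Num.min/1]_i f i)).
  rewrite lt_min !divr_gt0 ?subr_gt0 //=; apply/bigmin_gtP; split=> // i _.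
  by rewrite /f; case: ifP => // bi; rewrite divr_gt0.
move=> s /andP[s0]; rewrite le_min => /andP[sg /bigmin_geP[_ sf]]; split.
  split; last exact: tang_clique.
  move=> i; rewrite !mxE; have [bi|bi] := ltP 0 (b 0 i).
    have := sf i isT; rewrite /f bi ler_pdivlMr // mulrDr mulr1 => h.
    have : - (s * u 0 i) <= s * `|u 0 i| by rewrite -mulrN ler_wpM2l // -normrN ler_norm.
    by lra.
  have b0 : b 0 i = 0 by apply/eqP; rewrite eq_le bi; have [->] := hb.
  by rewrite b0 add0r mulr_ge0 //; have [->] := hu.
under eq_bigr do rewrite mxE [X in _ + X]mxE.
rewrite big_split /= -mulr_sumr; move: sg; rewrite /g.
set S := \sum_i u 0 i; set B := \sum_i b 0 i in b1 *.
rewrite ler_pdivlMr // ler_pdivlMr // => h.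
have : s * S <= s * `|S| by rewrite ler_wpM2l // ler_norm.
have : 0 <= s * `|S| by rewrite mulr_ge0.
have e : s * 2 * (1 + `|S|) = 2 * s + 2 * (s * `|S|) by ring.
by rewrite e in h; lra.
Qed.

End Tang.

Lemma limf_esup_near_cst (R : realType) (F : set_system (R * R)%type)
    (f : R * R -> \bar R) (a : \bar R) :
  ProperFilter F -> (\forall x \near F, f x = a) -> limf_esup f F = a.
Proof.
move=> PF Fa; rewrite limf_esupE; apply/eqP; rewrite eq_le; apply/andP; split.
  apply: ereal_inf_lbound; exists [set x | f x = a] => //.
  have [x xa] := @filter_ex _ F PF _ Fa.
  rewrite (_ : [set f x | x in _] = [set a]) ?ereal_sup1 //.
  by apply/seteqP; split=> [_ [y ya <-] //|_ ->]; exists x.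
apply: le_ereal_inf_tmp => _ [V FV <-].
have [x [Vx xa]] := @filter_ex _ F PF _ (filterI FV Fa).
by apply: ereal_sup_ubound; exists x.
Qed.

Lemma building_vertex (R : realType) (p : building R) : exists v0, p v0 != 0.
Proof.
have [k [L [Llat _ _ e]]] := coord_simplex p.
suff : [set v | p v != 0] (vertex_of (Llat ord0)) by exists (vertex_of (Llat ord0)).
by rewrite e; exists ord0.
Qed.

(** * Geodesics issuing from a point and their angles *)

Section Geodesics.
Variables (R : realType) (side : R).
Hypothesis side_gt0 : 0 < side.
Variables (v0 : vertex) (lk : 'I_14 -> vertex).
Hypothesis lkP : is_link v0 lk.
Variable p : building R.
Hypothesis p0 : p v0 != 0.

Local Notation lg := (@lg R lk).
Local Notation bd := (building_dist side).
Let b := lg p.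

(** Smallness is asked of the building distance, the quantity known along a geodesic, instead of
    [dst]. *)
Lemma star_building_dist_near (x y : building R) : x v0 != 0 -> y v0 != 0 ->
  Num.sqrt 2 * bd x y < side * x v0 ->
  bd x y = side * Num.sqrt (dst (lg x) (lg y)).
Proof.
move=> x0 y0 small; apply/eqP; rewrite eq_le; apply/andP; split.
  exact: (star_building_dist_le side_gt0 lkP x0 y0).
have s2 : 0 < Num.sqrt 2 :> R by rewrite sqrtr_gt0.
have : Num.min (side * Num.sqrt (dst (lg x) (lg y)))
    ((Num.sqrt 2)^-1 * (side * x v0)) <= bd x y.
  apply: building_dist_ge; first by eexists; exact: (joined_upper side lkP x0 y0).
  move=> l /(joined_lower side_gt0 lkP x0)[h|h]; rewrite ge_min ?h //.
  by rewrite ler_pdivrMl // h orbT.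
by rewrite ge_min ler_pdivrMl // [_ * _ <= _ * bd x y]leNgt small orbF.
Qed.

Lemma in_cone_lg (x : building R) : x v0 != 0 -> in_cone (lg x).
Proof. by move=> x0; split; [exact: lg_ge0|exact: (lg_clique lkP)]. Qed.

Let hb : in_cone b. Proof. exact: in_cone_lg. Qed.

(** Both sides are homogeneous, so [cos_coord_le] is applied to [b + s *: u] and [b + s *: w] with
    [s] small. It yields definiteness on tangent vectors ([tang_eq]). *)
Lemma tang_coord_le u w i : tang b u -> tang b w ->
  `|u 0 i - w 0 i| <= Num.sqrt 2 * Num.sqrt (dst u w).
Proof.
move=> hu hw; have b1 := lg_sum_lt1 lkP p0.
have [e e0 he] := tang_small hb b1 hu; have [e' e'0 he'] := tang_small hb b1 hw.
pose s := Num.min e e'; have s0 : 0 < s by rewrite lt_min e0 e'0.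
have [[u1 u2] u3] := he s ltac:(by rewrite (ltW s0) ge_min lexx).
have [[w1 w2] w3] := he' s ltac:(by rewrite (ltW s0) ge_min lexx orbT).
have := cos_coord_le side_gt0 lkP i u1 w1 u2 w2 u3 w3.
have -> : dst (b + s *: u) (b + s *: w) = s ^+ 2 * dst u w.
  have e1 : b + s *: u - (b + s *: w) = s *: (u - w).
    by rewrite opprD addrACA subrr add0r scalerBr.
  by rewrite /dst e1 frmZl frmZr mulrA.
have -> : (b + s *: u) 0 i - (b + s *: w) 0 i = s * (u 0 i - w 0 i) by rewrite !mxE; ring.
rewrite sqrtrM ?sqr_ge0 // sqrtr_sqr normrM (gtr0_norm s0) mulrCA.
by rewrite ler_pM2l.
Qed.

Lemma tang_eq u w : tang b u -> tang b w -> dst u w = 0 -> u = w.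
Proof.
move=> hu hw e; apply/rowP => i; apply/eqP; rewrite -subr_eq0 -normr_le0.
by apply: le_trans (tang_coord_le i hu hw) _; rewrite e sqrtr0 mulr0.
Qed.

(** The factor occurs because [D] measures lengths in units of [side]. *)
Definition unit_tang u := tang b u /\ side ^+ 2 * frm (@cosk R) u u = 1.

Lemma unit_tang_eq u w : unit_tang u -> unit_tang w ->
  side ^+ 2 * frm (@cosk R) u w = 1 -> u = w.
Proof.
move=> [hu u1] [hw w1] uw; apply: tang_eq => //.
have s0 : side ^+ 2 != 0 by rewrite sqrf_eq0 gt_eqF.
apply: (mulfI s0); rewrite mulr0 /dst frm_sub; last exact: cosk_sym.
by rewrite mulrBr mulrDr u1 w1 mulrCA uw; ring.
Qed.

Lemma unit_tang_cos u w : unit_tang u -> unit_tang w ->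
  -1 <= side ^+ 2 * frm (@cosk R) u w <= 1.
Proof.
move=> [hu u1] [hw w1]; rewrite -ler_norml normrM ger0_norm ?sqr_ge0 //.
have := tang_CS hb hu hw; rewrite -(ler_pM2l (x := side ^+ 2)) ?exprn_gt0 //.
move/le_trans; apply.
have e a : side ^+ 2 * a = 1 -> Num.sqrt a = side^-1.
  move=> h; have -> : a = side^-1 ^+ 2.
    by rewrite -[RHS]mulr1 -h; field; rewrite gt_eqF.
  by rewrite sqrtr_sqr gtr0_norm // invr_gt0.
rewrite (e _ u1) (e _ w1) (_ : _ * _ = 1) //.
by field; rewrite gt_eqF.
Qed.

(** The displacement divided by time, [xi s], is a unit tangent vector. As [c] is isometric between
    times [s] and [e], the product of [xi s] and [xi e] is 1, so they are equal and the geodesic is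
    straight near [p]. *)
Lemma geodesic_germ (c : geodesic bd p) : exists u, unit_tang u /\
  exists2 e, 0 < e & forall s, 0 <= s <= e -> c s v0 != 0 /\ lg (c s) = b + s *: u.
Proof.
have s2 : 0 < Num.sqrt 2 :> R by rewrite sqrtr_gt0.
(* Within the margin [mb] no positive link coordinate of [p] can vanish, and the coordinate at [v0]
   stays above half its value; hence displacements from [p] are tangent vectors. *)
pose beta i := if 0 < b 0 i then b 0 i else 1.
pose mb := Num.min (p v0 / 2) (\big[Num.min/1]_i beta i).
have pv0 : 0 < p v0 by rewrite lt_neqAle eq_sym p0 coord_ge0.
have mb0 : 0 < mb.
  rewrite lt_min divr_gt0 //=; apply/bigmin_gtP; split=> // i _.
  by rewrite /beta; case: ifP.
pose e := Num.min (geo_len c) (side * mb / Num.sqrt 2 / 2).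
have e0 : 0 < e by rewrite lt_min geo_len_gt0 !divr_gt0 ?mulr_gt0.
have cd s t : 0 <= s <= e -> 0 <= t <= e -> bd (c s) (c t) = `|s - t|.
  move=> /andP[s0 se] /andP[t0 te]; apply: geo_isometric; rewrite in_itv /=.
    by rewrite s0 (le_trans se) // ge_min lexx.
  by rewrite t0 (le_trans te) // ge_min lexx.
have e00 : 0 <= (0 : R) <= e by apply/andP; split=> //; exact: ltW.
have cp s : 0 <= s <= e -> forall v, side * `|p v - c s v| < side * mb.
  move=> hs v; have [s0 se] := andP hs.
  have [->|sn] := eqVneq s 0; first by rewrite geo_start subrr normr0 mulr0 mulr_gt0.
  have sp : 0 < s by rewrite lt_neqAle eq_sym sn.
  have pcs : bd p (c s) = s by have := cd 0 s e00 hs; rewrite geo_start sub0r normrN gtr0_norm.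
  have := building_coord_lipschitz side_gt0 (x := p) (y := c s) v; rewrite pcs => /(_ sp) h.
  apply: le_lt_trans h _; rewrite mulrC -ltr_pdivlMr //.
  apply: le_lt_trans se _; rewrite gt_min; apply/orP; right.
  have : 0 < side * mb / Num.sqrt 2 by rewrite divr_gt0 ?mulr_gt0.
  by lra.
have cpos s v : 0 <= s <= e -> mb <= p v -> 0 < c s v.
  move=> hs pv; have := cp s hs v; rewrite ltr_pM2l // => h.
  have := ler_norm (p v - c s v); lra.
have cv0 s : 0 <= s <= e -> p v0 / 2 < c s v0.
  move=> hs; have := cp s hs v0; rewrite ltr_pM2l // => h.
  have := ler_norm (p v0 - c s v0).
  have : mb <= p v0 / 2 by rewrite ge_min lexx.
  by lra.
have cv0n s : 0 <= s <= e -> c s v0 != 0.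
  by move=> /cv0 h; rewrite gt_eqF //; lra.
have cs_tang s : 0 <= s <= e -> tang b (lg (c s) - b).
  move=> hs; apply: tang_diff => //; first exact: in_cone_lg (cv0n s hs).
  move=> i; rewrite mxE => ci; apply/eqP; rewrite eq_le {2}/b lg_ge0 andbT.
  rewrite leNgt; apply/negP => bi.
  suff : 0 < c s (lk i) by rewrite ci ltxx.
  apply: cpos => //; rewrite ge_min; apply/orP; right.
  have /bigmin_geP[_ /(_ i isT)] := lexx (\big[Num.min/1]_i beta i).
  by rewrite {2}/beta bi /b mxE.
have cs_dst s t : 0 <= s <= e -> 0 <= t <= e ->
    side ^+ 2 * dst (lg (c s)) (lg (c t)) = (s - t) ^+ 2.
  move=> hs ht; have [s0 se] := andP hs; have [t0 te] := andP ht.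
  have pos : 0 <= dst (lg (c s)) (lg (c t)).
    have := tang_frm_ge0 hb (cs_tang s hs) (cs_tang t ht).
    by rewrite opprB addrA subrK.
  have small : Num.sqrt 2 * `|s - t| < side * c s v0.
    apply: (@lt_le_trans _ _ (side * mb)); last first.
      rewrite ler_pM2l //; apply: le_trans (ltW (cv0 s hs)).
      by rewrite ge_min lexx.
    have : `|s - t| <= e by rewrite ler_norml; apply/andP; split; lra.
    rewrite mulrC -ltr_pdivlMr // => /le_lt_trans; apply.
    rewrite /e gt_min; apply/orP; right.
    have : 0 < side * mb / Num.sqrt 2 by rewrite divr_gt0 ?mulr_gt0.
    by lra.
  have := @star_building_dist_near (c s) (c t) (cv0n s hs) (cv0n t ht).
  rewrite cd // => /(_ small) h.
  by rewrite -[RHS]real_normK ?num_real // h exprMn sqr_sqrtr.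
have side2 : side ^+ 2 != 0 by rewrite sqrf_eq0 gt_eqF.
pose xi s := s^-1 *: (lg (c s) - b).
have xiE s : 0 < s -> lg (c s) = b + s *: xi s.
  by move=> s0; rewrite /xi scalerA divff ?gt_eqF // scale1r addrC subrK.
have xi_unit s : 0 < s <= e -> unit_tang (xi s).
  move=> /andP[s0 se]; have hs : 0 <= s <= e by rewrite (ltW s0).
  split; first by apply: tangZ (cs_tang s hs); rewrite invr_ge0 ltW.
  have := cs_dst s 0 hs e00; rewrite geo_start subr0 xiE // /dst -/b.
  rewrite addrC addKr frmZl frmZr => h.
  have sn : s ^+ 2 != 0 by rewrite sqrf_eq0 gt_eqF.
  by apply: (mulfI sn); rewrite mulr1 -[RHS]h; ring.
have xi_eq s : 0 < s <= e -> xi s = xi e.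
  move=> /[dup] hs /andP[s0 se]; have he : 0 < e <= e by rewrite e0 lexx.
  have [us us1] := xi_unit s hs; have [ue ue1] := xi_unit e he.
  apply: unit_tang_eq; [exact: xi_unit|exact: xi_unit|].
  have hs' : 0 <= s <= e by rewrite (ltW s0).
  have he' : 0 <= e <= e by rewrite (ltW e0) lexx.
  have := cs_dst s e hs' he'; rewrite !xiE // /dst.
  have -> : b + s *: xi s - (b + e *: xi e) = s *: xi s - e *: xi e.
    by rewrite opprD addrACA subrr add0r.
  rewrite frm_subZ => h.
  have se0 : s * e != 0 by rewrite mulf_neq0 ?gt_eqF.
  apply: (mulfI se0); rewrite mulr1.
  have {}h : s ^+ 2 * (side ^+ 2 * frm (@cosk R) (xi s) (xi s)) +
    e ^+ 2 * (side ^+ 2 * frm (@cosk R) (xi e) (xi e)) -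
    2 * (s * e * (side ^+ 2 * frm (@cosk R) (xi s) (xi e))) = (s - e) ^+ 2.
    by rewrite -h; ring.
  rewrite us1 ue1 in h; lra.
exists (xi e); split; first by apply: xi_unit; rewrite e0 lexx.
exists e => // s hs; split; first exact: cv0n.
have [s0 se] := andP hs; have [->|sn] := eqVneq s 0.
  by rewrite geo_start scale0r addr0.
have sp : 0 < s by rewrite lt_neqAle eq_sym sn.
by rewrite -(xi_eq s) ?sp // -xiE.
Qed.

Definition germ (c : geodesic bd p) : 'rV[R]_14 := projT1 (cid (geodesic_germ c)).

Lemma germ_unit (c : geodesic bd p) : unit_tang (germ c).
Proof. by rewrite /germ; case: cid => u []. Qed.

Lemma germP (c : geodesic bd p) : exists2 e, 0 < e & forall s, 0 <= s <= e ->
  c s v0 != 0 /\ lg (c s) = b + s *: germ c.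
Proof. by rewrite /germ; case: cid => u []. Qed.

Lemma tang_sub_dst u w s t :
  dst (b + s *: u) (b + t *: w) = frm (@cosk R) (s *: u - t *: w) (s *: u - t *: w).
Proof. by rewrite /dst opprD addrACA subrr add0r. Qed.

Lemma unit_tang_dist u w s t : unit_tang u -> unit_tang w ->
  side ^+ 2 * frm (@cosk R) (s *: u - t *: w) (s *: u - t *: w) =
  s ^+ 2 + t ^+ 2 - 2 * s * t * (side ^+ 2 * frm (@cosk R) u w).
Proof.
move=> [_ u1] [_ w1]; rewrite frm_subZ.
have -> : s ^+ 2 + t ^+ 2 = s ^+ 2 * (side ^+ 2 * frm (@cosk R) u u)
    + t ^+ 2 * (side ^+ 2 * frm (@cosk R) w w) by rewrite u1 w1 !mulr1.
by ring.
Qed.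

(* For small parameters two germs are compared inside the cone, so that the
   comparison angle is constant. *)
Lemma angle_germ (c c' : geodesic bd p) :
  angle c c' = acos (side ^+ 2 * frm (@cosk R) (germ c) (germ c')).
Proof.
have [e e0 he] := germP c; have [e' e'0 he'] := germP c'.
have uc := germ_unit c; have uc' := germ_unit c'.
have pv0 : 0 < p v0 by rewrite lt_neqAle eq_sym p0 coord_ge0.
have s2 : 0 < Num.sqrt 2 :> R by rewrite sqrtr_gt0.
set S := \sum_i germ c 0 i.
have n1 : 0 < 1 + `|S| by rewrite ltr_pwDl.
(* The bound involving [S] keeps the coordinate at [v0] above half its value at [p]; the last one
   makes the two points close enough for [star_building_dist]. *)
pose r := Num.min (Num.min e e')
  (Num.min (p v0 / 2 / (1 + `|S|)) (side * p v0 / Num.sqrt 2 / 4)).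
have r0 : 0 < r by rewrite !lt_min e0 e'0 !divr_gt0 ?mulr_gt0.
have dist s t : 0 < s <= r -> 0 < t <= r ->
    bd (c s) (c' t) ^+ 2 = s ^+ 2 + t ^+ 2 -
      2 * s * t * (side ^+ 2 * frm (@cosk R) (germ c) (germ c')).
  rewrite /r !le_min => /andP[s0 /andP[/andP[se _] /andP[sp sq]]].
  move=> /andP[t0 /andP[/andP[_ te] /andP[_ tq]]].
  have [cs0 csE] := he s ltac:(by rewrite (ltW s0)).
  have [ct0 ctE] := he' t ltac:(by rewrite (ltW t0)).
  have ge0 : 0 <= frm (@cosk R) (s *: germ c - t *: germ c') (s *: germ c - t *: germ c').
    by apply: (tang_frm_ge0 hb); apply: tangZ; rewrite ?ltW //; [case: uc|case: uc'].
  have csv : p v0 / 2 <= c s v0.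
    rewrite (lg_sum lkP cs0) csE.
    have -> : \sum_i (b + s *: germ c) 0 i = \sum_i b 0 i + s * S.
      by under eq_bigr do rewrite mxE [X in _ + X]mxE; rewrite big_split /= -mulr_sumr.
    have pE := lg_sum lkP p0; rewrite -/b in pE.
    rewrite ler_pdivlMr // in sp.
    have : s * S <= s * `|S| by rewrite ler_wpM2l ?(ltW s0) ?ler_norm.
    by lra.
  have nrm : side ^+ 2 * frm (@cosk R) (s *: germ c - t *: germ c')
      (s *: germ c - t *: germ c') <= (s + t) ^+ 2.
    rewrite unit_tang_dist //; have /andP[h1 h2] := unit_tang_cos uc uc'.
    set x := side ^+ 2 * _ in h1 h2 *.
    have : 0 <= (s * t) * (x + 1) by rewrite mulr_ge0 ?mulr_ge0 ?(ltW s0) ?(ltW t0) //; lra.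
    by rewrite mulrDr mulr1 => h; rewrite sqrrD -mulr_natl; lra.
  have small : Num.sqrt 2 * Num.sqrt (dst (lg (c s)) (lg (c' t))) <= c s v0.
    rewrite csE ctE tang_sub_dst; apply: le_trans csv.
    rewrite -(ler_pM2l side_gt0) mulrCA -{1}(ger0_norm (ltW side_gt0)) -sqrtr_sqr.
    rewrite -sqrtrM ?sqr_ge0 //.
    apply: (@le_trans _ _ (Num.sqrt 2 * (s + t))).
      rewrite ler_pM2l // -[X in _ <= X](ger0_norm (addr_ge0 (ltW s0) (ltW t0))).
      by rewrite -sqrtr_sqr; apply: ler_wsqrtr.
    rewrite mulrC -ler_pdivlMr //.
    have e4 : side * p v0 / Num.sqrt 2 / 4 = side * (p v0 / 2) / Num.sqrt 2 / 2.
      by field; rewrite gt_eqF.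
    by rewrite e4 in sq tq; lra.
  rewrite (star_building_dist side_gt0 lkP cs0 ct0 small) exprMn sqr_sqrtr; last first.
    by rewrite csE ctE tang_sub_dst.
  by rewrite csE ctE tang_sub_dst unit_tang_dist.
rewrite /angle (_ : limf_esup _ _ =
  (acos (side ^+ 2 * frm (@cosk R) (germ c) (germ c')))%:E) //.
apply: limf_esup_near_cst.
have nr : \forall s \near (0 : R)^'+, 0 < s <= r.
  by near=> s; apply/andP; split; near: s; [exact: nbhs_right_gt|exact: nbhs_right_le].
exists ([set s | 0 < s <= r], [set s | 0 < s <= r]) => //= -[s t] /= [hs ht].
congr (_%:E); rewrite /comparison_angle dist //; congr acos.
have [s0 t0] : 0 < s /\ 0 < t by case/andP: hs; case/andP: ht.
by field; rewrite !gt_eqF.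
Unshelve. all: by end_near.
Qed.

Lemma germ_ex u : unit_tang u -> exists c : geodesic bd p, germ c = u.
Proof.
move=> uu; have [hu u1] := uu.
have b1 := lg_sum_lt1 lkP p0.
have [e e0 he] := tang_small hb b1 hu.
have pv0 : 0 < p v0 by rewrite lt_neqAle eq_sym p0 coord_ge0.
have s2 : 0 < Num.sqrt 2 :> R by rewrite sqrtr_gt0.
set S := \sum_i u 0 i.
have n1 : 0 < 1 + `|S| by rewrite ltr_pwDl.
pose r := Num.min e (Num.min (p v0 / 2 / (1 + `|S|)) (side * p v0 / Num.sqrt 2 / 4)).
have r0 : 0 < r by rewrite !lt_min e0 !divr_gt0 ?mulr_gt0.
(* The value at 0 is prescribed to be [p] itself, since a geodesic has to start at that very
   point. *)
have ex s : exists x : building R,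
    (0 <= s <= r -> x v0 != 0 /\ lg x = b + s *: u) /\ (s = 0 -> x = p).
  have [->|s0] := eqVneq s 0.
    by exists p; split=> // _; rewrite scale0r addr0.
  have [hs|hs] := boolP (0 <= s <= r); last by exists p; split=> // /eqP; rewrite (negbTE s0).
  have /he[[h1 h2] h3] : 0 <= s <= e.
    by move: hs; rewrite /r le_min => /andP[-> /andP[-> _]].
  have [x [x0 xE]] := star_point lkP h1 h2 h3.
  by exists x; split=> // /eqP; rewrite (negbTE s0).
have [f fE] := choice ex.
have f0 : f 0 = p by have [_ ->] := fE 0.
have fiso s t : s \in `[0, r] -> t \in `[0, r] -> bd (f s) (f t) = `|s - t|.
  rewrite !in_itv /= => hs ht; have [fs0 fsE] := (fE s).1 hs.
  have [ft0 ftE] := (fE t).1 ht.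
  have dE : dst (lg (f s)) (lg (f t)) = (s - t) ^+ 2 * frm (@cosk R) u u.
    by rewrite fsE ftE tang_sub_dst -scalerBl frmZl frmZr mulrA.
  have sdE : side * Num.sqrt (dst (lg (f s)) (lg (f t))) = `|s - t|.
    rewrite dE -{1}(ger0_norm (ltW side_gt0)) -sqrtr_sqr -sqrtrM ?sqr_ge0 //.
    by rewrite mulrCA u1 mulr1 sqrtr_sqr.
  rewrite (star_building_dist side_gt0 lkP fs0 ft0) //.
  rewrite -(ler_pM2l side_gt0) mulrCA sdE.
  move: hs ht; rewrite /r !le_min => /and3P[s0 se /andP[sp sq]] /and3P[t0 te /andP[_ tq]].
  have csv : p v0 / 2 <= f s v0.
    rewrite (lg_sum lkP fs0) fsE.
    have -> : \sum_i (b + s *: u) 0 i = \sum_i b 0 i + s * S.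
      by under eq_bigr do rewrite mxE [X in _ + X]mxE; rewrite big_split /= -mulr_sumr.
    have pE := lg_sum lkP p0; rewrite -/b in pE.
    rewrite ler_pdivlMr // in sp.
    have : s * S <= s * `|S| by rewrite ler_wpM2l ?ler_norm.
    by lra.
  apply: (@le_trans _ _ (side * (p v0 / 2))); last by rewrite ler_pM2l.
  have e4 : side * p v0 / Num.sqrt 2 / 4 = side * (p v0 / 2) / Num.sqrt 2 / 2.
    by field; rewrite gt_eqF.
  rewrite e4 in sq tq; rewrite mulrC -ler_pdivlMr // ler_norml; apply/andP; split; lra.
pose c := Geodesic r0 f0 fiso; exists c.
have [e' e'0 he'] := germP c.
pose s := Num.min r e'; have s0 : 0 < s by rewrite lt_min r0.
have [_ E1] := he' s ltac:(by rewrite (ltW s0) ge_min lexx orbT).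
have [_ E2] := (fE s).1 ltac:(by rewrite (ltW s0) ge_min lexx).
have /addrI : b + s *: germ c = b + s *: u by rewrite -E1 -E2.
by move/(scalerI (lt0r_neq0 s0)).
Qed.

(** Needed for the apex, which is represented by a pair of some direction and 0. *)
Lemma unit_tang_ex : exists u, unit_tang u.
Proof.
have [_ cb] := hb; have [i [j [aij sb]]] := chamber1 cb.
have sd : in_supp (pred2 i j) (delta_mx 0 i : 'rV[R]_14).
  by move=> k /=; rewrite negb_or => /andP[/negbTE ki _]; rewrite mxE ki.
exists (side^-1 *: delta_mx 0 i); split.
  apply: tangZ; first by rewrite invr_ge0 ltW.
  split; first by move=> k _; rewrite mxE ler0n.
    exact: in_supp_clique aij sd.
  have h : tang b (b + delta_mx 0 i - b).
    apply: tang_diff => //.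
      split; last exact: in_supp_clique aij (in_suppD sb sd).
      by move=> k; rewrite mxE addr_ge0 ?(lg_ge0 lk p k) // mxE ler0n.
    move=> k; rewrite mxE [X in _ + X]mxE => /eqP.
    by rewrite paddr_eq0 ?(lg_ge0 lk p k) ?ler0n // => /andP[/eqP].
  by move: h; rewrite addrC addKr => -[].
by rewrite frmZl frmZr frm_delta cosk_id mulr1 -expr2 -exprMn divff ?expr1n // gt_eqF.
Qed.

End Geodesics.

Section Limits.
Variable R : realType.

Lemma cvgnP (u : nat -> R) (l : R) : (u n @[n --> \oo] --> l) <->
  (forall e : R, 0 < e -> exists N, forall n, (N <= n)%N -> `|l - u n| < e).
Proof.
split=> [/cvgrPdist_lt h e e0|h].
  by have [N _ hN] := h e e0; exists N => n; exact: hN.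
by apply/cvgrPdist_lt => e e0; have [N hN] := h e e0; exists N.
Qed.

Lemma cvg_ord_sum n (f : 'I_n -> nat -> R) (l : 'I_n -> R) :
  (forall i, f i k @[k --> \oo] --> l i) ->
  (\sum_i f i k) @[k --> \oo] --> \sum_i l i.
Proof.
move=> h; elim: (index_enum _) => [|i s IH].
  by under eq_fun do rewrite big_nil; rewrite big_nil; exact: cvg_cst.
under eq_fun do rewrite big_cons.
by rewrite big_cons; apply: cvgD.
Qed.

Lemma cvg_frm K (u w : nat -> 'rV[R]_14) (u' w' : 'rV[R]_14) :
  (forall i, u k 0 i @[k --> \oo] --> u' 0 i) ->
  (forall i, w k 0 i @[k --> \oo] --> w' 0 i) ->
  frm K (u k) (w k) @[k --> \oo] --> frm K u' w'.
Proof.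
move=> hu hw; rewrite /frm; apply: cvg_ord_sum => i; apply: cvg_ord_sum => j.
by apply: cvgM => //; apply: cvgM => //; exact: cvg_cst.
Qed.

Lemma cvg_cauchy_seq (u : nat -> R) :
  (forall e : R, 0 < e -> exists N, forall m n, (N <= m)%N -> (N <= n)%N ->
     `|u m - u n| < e) ->
  u n @[n --> \oo] --> limn u.
Proof.
move=> h; apply: cauchy_cvg; apply: cauchy_exP => e e0.
have [N hN] := h e e0; exists (u N); exists N => // n /= Nn.
by apply: hN.
Qed.

(** The end points -1 and 1 are included, so the limit is derived from the strict monotonicity of
    the cosine on the interval from 0 to pi. *)
Lemma cvg_acos (x : nat -> R) (l : R) : (forall n, -1 <= x n <= 1) -> -1 <= l <= 1 ->
  x n @[n --> \oo] --> l -> acos (x n) @[n --> \oo] --> acos l.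
Proof.
move=> hx hl /cvgnP xl; apply/cvgnP => e e0.
have ac (y : R) : -1 <= y <= 1 -> acos y \in `[0, pi].
  by move=> hy; rewrite in_itv /=; apply/andP; split; [exact: acos_ge0|exact: acos_lepi].
have cK (y : R) : -1 <= y <= 1 -> cos (acos y) = y by move=> hy; rewrite acosK // in_itv.
have up : exists N, forall n, (N <= n)%N -> acos (x n) < acos l + e.
  have [big|small] := ltP pi (acos l + e).
    by exists 0%N => n _; apply: le_lt_trans big; exact: acos_lepi.
  have t1 : acos l + e \in `[0, pi].
    by rewrite in_itv /= small andbT addr_ge0 ?acos_ge0 // ltW.
  have d0 : 0 < l - cos (acos l + e).
    by rewrite subr_gt0 -{2}(cK l hl) ltr_cos ?ac // ltrDl.
  have [N hN] := xl _ d0; exists N => n /hN h.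
  rewrite -ltr_cos ?ac // cK //; have := ler_norm (l - x n); lra.
have dn : exists N, forall n, (N <= n)%N -> acos l - e < acos (x n).
  have [big|small] := ltP (acos l - e) 0.
    by exists 0%N => n _; apply: lt_le_trans big _; exact: acos_ge0.
  have t1 : acos l - e \in `[0, pi].
    by rewrite in_itv /= small; have := acos_lepi hl; lra.
  have d0 : 0 < cos (acos l - e) - l.
    by rewrite subr_gt0 -{1}(cK l hl) ltr_cos ?ac //; lra.
  have [N hN] := xl _ d0; exists N => n /hN h.
  rewrite -ltr_cos ?ac // cK //; have := ler_norm (- (l - x n)); rewrite normrN; lra.
have [N hN] := up; have [M hM] := dn; exists (maxn N M) => n.
rewrite geq_max => /andP[/hN h1 /hM h2].
by rewrite ltr_norml; apply/andP; split; lra.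
Qed.

Lemma acos_small (e : R) : 0 < e -> exists2 d, 0 < d & forall x, -1 <= x <= 1 ->
  acos x < d -> 1 - x < e.
Proof.
move=> e0; have /cvgrPdist_lt/(_ e e0) := @continuous_cos R 0.
move=> /nbhs_ballP[d /= d0 hd]; exists d => // x hx xd.
have := hd (acos x); rewrite /ball /= sub0r normrN ger0_norm ?acos_ge0 // => /(_ xd).
rewrite cos0 acosK ?in_itv //; have := ler_norm (1 - x); lra.
Qed.

End Limits.

(** The representative selected by choice may differ from the point used to define the class. *)
Lemma mq_repr_eq (R : realType) (T : Type) (d : T -> T -> R) (x : T)
    (h : exists y, [set z | d x z = 0] = [set z | d y z = 0]) :
  (forall y, d y y = 0) -> d x (mq_repr (exist _ [set z | d x z = 0] h)) = 0.
Proof.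
move=> d0; rewrite /mq_repr; case: cid => y /= e.
have : [set z | d x z = 0] y by rewrite e /= d0.
by [].
Qed.

Section Directions.
Variables (R : realType) (side : R).
Hypothesis side_gt0 : 0 < side.
Variables (v0 : vertex) (lk : 'I_14 -> vertex).
Hypothesis lkP : is_link v0 lk.
Variable p : building R.
Hypothesis p0 : p v0 != 0.

Local Notation lg := (@lg R lk).
Local Notation bd := (building_dist side).
Let b := lg p.
Let hb : in_cone b. Proof. exact: (in_cone_lg lkP p0). Qed.
Local Notation germ := (@germ R side side_gt0 v0 lk lkP p p0).
Local Notation unit_tang := (@unit_tang R side lk p).
Local Notation K := (@cosk R).

Let germ_cos (c c' : geodesic bd p) : -1 <= side ^+ 2 * frm K (germ c) (germ c') <= 1.
Proof. by apply: (unit_tang_cos side_gt0 lkP p0); exact: germ_unit. Qed.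

(** Completion adds no direction: sequences that are Cauchy for the angle have germs converging in
    each coordinate, and unit tangent vectors form a closed set. *)
Definition cdir (u : cauchy_seq (@angle _ _ bd p)) : 'rV[R]_14 :=
  \row_i limn (fun n => germ (u n) 0 i).

Implicit Types u w : cauchy_seq (@angle R (building R) bd p).

Lemma cdir_cvg u i : germ (u n) 0 i @[n --> \oo] --> cdir u 0 i.
Proof.
rewrite mxE; apply: cvg_cauchy_seq => e e0.
have s2 : 0 < Num.sqrt 2 :> R by rewrite sqrtr_gt0.
(* For unit tangent vectors [side ^+ 2] times [dst] is [2 (1 - cos)]; this threshold makes the bound
   of [tang_coord_le] smaller than [e]. *)
have q0 : 0 < (side * e / 2) ^+ 2 by rewrite exprn_gt0 // divr_gt0 ?mulr_gt0.
have [d d0 hd] := acos_small q0.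
have [N hN] := cs_cauchy u d0; exists N => m n /hN h /h {h hN}.
rewrite (angle_germ side_gt0 lkP p0) => /(hd _ (germ_cos _ _)).
have um := germ_unit side_gt0 lkP p0 (u m); have un := germ_unit side_gt0 lkP p0 (u n).
move=> small; apply: le_lt_trans (tang_coord_le side_gt0 lkP p0 i (proj1 um) (proj1 un)) _.
have := unit_tang_dist 1 1 um un; rewrite !scale1r -/(dst _ _) => e1.
have e2 : side ^+ 2 * dst (germ (u m)) (germ (u n)) =
    2 * (1 - side ^+ 2 * frm K (germ (u m)) (germ (u n))) by rewrite e1; ring.
rewrite -(ltr_pM2l side_gt0) -sqrtrM // -{1}(ger0_norm (ltW side_gt0)) -sqrtr_sqr.
rewrite -sqrtrM ?sqr_ge0 // mulrCA e2 -[X in _ < X]ger0_norm ?mulr_ge0 ?ltW //.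
rewrite -sqrtr_sqr ltr_sqrt ?exprn_gt0 ?mulr_gt0 //.
have e3 : (side * e / 2) ^+ 2 = (side * e) ^+ 2 / 4 by field.
by rewrite e3 in small; lra.
Qed.

Lemma cdir_unit u : unit_tang (cdir u).
Proof.
have un n := germ_unit side_gt0 lkP p0 (u n).
split; last first.
  have h : side ^+ 2 * frm K (germ (u n)) (germ (u n)) @[n --> \oo] -->
      side ^+ 2 * frm K (cdir u) (cdir u).
    by apply: cvgM; [exact: cvg_cst|apply: cvg_frm => i; exact: cdir_cvg].
  have <- := cvg_lim (@Rhausdorff R) h.
  rewrite (_ : (fun _ => _) = fun=> 1) ?lim_cst //.
  by apply/funext => n; have [_ ->] := un n.
have zero (f : nat -> R) (l : R) : f n @[n --> \oo] --> l -> (forall n, f n = 0) -> l = 0.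
  move=> fl f0; rewrite -(cvg_lim (@Rhausdorff R) fl) (_ : (fun _ => _) = fun=> 0) ?lim_cst //.
  exact/funext.
split.
- move=> i bi; rewrite mxE; apply: limr_ge; first by have := cdir_cvg (i := i) (u := u); exact: cvgP.
  by apply: nearW => n; have [[h _ _] _] := un n; exact: h.
- move=> i j ij aij; apply: (zero (fun n => germ (u n) 0 i * germ (u n) 0 j)).
    by apply: cvgM; exact: cdir_cvg.
  by move=> n; have [[_ h _] _] := un n; exact: h.
- move=> i j ij aij; apply: (zero (fun n => b 0 i * germ (u n) 0 j)).
    by apply: cvgM; [exact: cvg_cst|exact: cdir_cvg].
  by move=> n; have [[_ _ h] _] := un n; exact: h.
Qed.

Lemma cs_dist_cdir u w : cs_dist u w = acos (side ^+ 2 * frm K (cdir u) (cdir w)).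
Proof.
have cu := cdir_unit u; have cw := cdir_unit w.
rewrite /cs_dist; apply: (cvg_lim (@Rhausdorff R)).
under eq_fun do rewrite (angle_germ side_gt0 lkP p0).
apply: cvg_acos => //; first exact: (unit_tang_cos side_gt0 lkP p0).
by apply: cvgM; [exact: cvg_cst|apply: cvg_frm => i; exact: cdir_cvg].
Qed.

Lemma cos_cs_dist u w : cos (cs_dist u w) = side ^+ 2 * frm K (cdir u) (cdir w).
Proof.
rewrite cs_dist_cdir acosK // in_itv; apply: (unit_tang_cos side_gt0 lkP p0); exact: cdir_unit.
Qed.

Lemma cs_dist_refl u : cs_dist u u = 0.
Proof. by rewrite cs_dist_cdir; have [_ ->] := cdir_unit u; exact: acos1. Qed.

Definition ddir (V : directions bd p) : 'rV[R]_14 := cdir (mq_repr V).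

Lemma cos_direction_dist V W :
  cos (direction_dist V W) = side ^+ 2 * frm K (ddir V) (ddir W).
Proof. exact: cos_cs_dist. Qed.

Lemma ddir_ex (u : 'rV[R]_14) : unit_tang u -> exists V, ddir V = u.
Proof.
move=> uu; have [c cE] := germ_ex side_gt0 lkP p0 uu.
have ac : angle c c = 0.
  rewrite (angle_germ side_gt0 lkP p0).
  by have [_ ->] := germ_unit side_gt0 lkP p0 c; exact: acos1.
have hc e : 0 < e -> exists N, forall m n : nat, (N <= m)%N -> (N <= n)%N ->
    angle ((fun=> c) m) ((fun=> c) n) < e.
  by move=> e0; exists 0%N => m n _ _; rewrite ac.
pose w := CauchySeq hc.
have wE : cdir w = u.
  by apply/rowP => i; rewrite mxE -cE (_ : (fun _ => _) = fun=> germ c 0 i) ?lim_cst.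
pose V : directions bd p := exist _ [set z | cs_dist w z = 0] (ex_intro _ w erefl).
exists V; rewrite /ddir; set z := mq_repr V.
have : cs_dist w z = 0 by apply: mq_repr_eq; exact: cs_dist_refl.
move=> /(congr1 cos); rewrite cos_cs_dist cos0 wE => h.
by apply/esym/(unit_tang_eq side_gt0 lkP p0) => //; exact: cdir_unit.
Qed.

Definition cone_vec (x : directions bd p * {nonneg R}) : 'rV[R]_14 :=
  x.2%:num *: ddir x.1.

Lemma tang_cone_vec x : tang b (cone_vec x).
Proof. by apply: tangZ => //; have [] := cdir_unit (mq_repr x.1). Qed.

Lemma cone_pdist_vec x y : cone_pdist x y = side * Num.sqrt (dst (cone_vec x) (cone_vec y)).
Proof.
rewrite /cone_pdist cos_direction_dist.
rewrite -(unit_tang_dist _ _ (cdir_unit (mq_repr x.1)) (cdir_unit (mq_repr y.1))).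
by rewrite sqrtrM ?sqr_ge0 // sqrtr_sqr gtr0_norm.
Qed.

Lemma cone_vec_ex m : tang b m -> exists x, cone_vec x = m.
Proof.
move=> hm; have [m0|m0] := eqVneq m 0.
  have [u uu] := unit_tang_ex side_gt0 lkP p0; have [V VE] := ddir_ex uu.
  by exists (V, 0%:nng); rewrite /cone_vec /= scale0r m0.
have mm0 : 0 < frm K m m.
  have := tang_frm_ge0 hb hm (tang0 b); rewrite subr0 le_eqVlt => /orP[/eqP e|//].
  have : m = 0.
    apply: (tang_eq side_gt0 lkP p0) => //; first exact: tang0.
    by rewrite /dst subr0.
  by move/eqP; rewrite (negbTE m0).
pose t := side * Num.sqrt (frm K m m).
have t0 : 0 < t by rewrite mulr_gt0 // sqrtr_gt0.
have uu : unit_tang (t^-1 *: m).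
  split; first by apply: tangZ => //; rewrite invr_ge0 ltW.
  have t2 : t ^+ 2 = side ^+ 2 * frm K m m by rewrite exprMn sqr_sqrtr // ltW.
  rewrite frmZl frmZr.
  have -> : side ^+ 2 * (t^-1 * (t^-1 * frm K m m)) = (side ^+ 2 * frm K m m) / t ^+ 2.
    by field; rewrite gt_eqF.
  by rewrite t2 divff // -t2 gt_eqF // exprn_gt0.
have [V VE] := ddir_ex uu.
by exists (V, NngNum (ltW t0)); rewrite /cone_vec /= VE scalerA divff ?scale1r // gt_eqF.
Qed.

Definition tc_vec (A : tangent_cone bd p) : 'rV[R]_14 := cone_vec (mq_repr A).

Lemma tc_vec_ex m : tang b m -> exists A, tc_vec A = m.
Proof.
move=> hm; have [x xE] := cone_vec_ex hm.
pose A : tangent_cone bd p := exist _ [set z | cone_pdist x z = 0] (ex_intro _ x erefl).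
exists A; rewrite /tc_vec; set z := mq_repr A.
have : cone_pdist x z = 0.
  apply: mq_repr_eq => y.
  by rewrite cone_pdist_vec /dst subrr frm0l sqrtr0 mulr0.
rewrite cone_pdist_vec => /eqP; rewrite mulf_eq0 gt_eqF //= sqrtr_eq0 => h.
rewrite -xE; apply/esym/(tang_eq side_gt0 lkP p0); [exact: tang_cone_vec|exact: tang_cone_vec|].
by apply/eqP; rewrite eq_le h; apply: (tang_frm_ge0 hb); exact: tang_cone_vec.
Qed.

End Directions.

(** Surjectivity of [F] is what later supplies the points competing with the barycenter. *)
Theorem tangent_cone_model (R : realType) (side : R) (p : building R) : 0 < side ->
  exists (b : 'rV[R]_14) (F : tangent_cone (building_dist side) p -> 'rV[R]_14),
  [/\ in_cone b, forall A, tang b (F A), forall m, tang b m -> exists A, F A = m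
    & forall A B, tangent_cone_dist (building_dist side) p A B =
        side * Num.sqrt (dst (F A) (F B))].
Proof.
move=> side_gt0; have [v0 p0] := building_vertex p.
have [lk lkP] := link_exists v0.
exists (lg lk p), (@tc_vec R side side_gt0 v0 lk lkP p p0); split.
- exact: (in_cone_lg lkP p0).
- by move=> A; exact: tang_cone_vec.
- by move=> m; exact: tc_vec_ex.
- by move=> A B; exact: cone_pdist_vec.
Qed.

(** * The invariant delta *)

Section Norms.
Variable R : realType.

Lemma eucl_normZ N (a : R) (w : 'rV[R]_N) : 0 <= a -> eucl_norm (a *: w) = a * eucl_norm w.
Proof.
move=> a0; rewrite /eucl_norm.
have -> : \sum_j (a *: w) 0 j ^+ 2 = a ^+ 2 * \sum_j w 0 j ^+ 2.
  by rewrite mulr_sumr; apply: eq_bigr => j _; rewrite mxE exprMn.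
by rewrite sqrtrM ?sqr_ge0 // sqrtr_sqr ger0_norm.
Qed.

Lemma jensen_sq n (t h : 'I_n -> R) : (forall i, 0 < t i) -> \sum_i t i = 1 ->
  (\sum_i t i * h i) ^+ 2 <= \sum_i t i * h i ^+ 2.
Proof.
move=> t0 t1.
have e (m : R) : \sum_i t i * (h i - m) ^+ 2 =
    \sum_i t i * h i ^+ 2 - 2 * m * (\sum_i t i * h i) + m ^+ 2 * \sum_i t i.
  by rewrite !mulr_sumr -sumrB -big_split; apply: eq_bigr => i _ /=; ring.
have : 0 <= \sum_i t i * (h i - \sum_i t i * h i) ^+ 2.
  by apply: sumr_ge0 => i _; rewrite mulr_ge0 ?sqr_ge0 // ltW.
by rewrite e t1 expr2; lra.
Qed.

Lemma gvec_sum N d l m n (x : 'I_n -> 'rV[R]_14) :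
  gvec N d l m (\sum_i x i) = \sum_i gvec N d l m (x i).
Proof.
elim: (index_enum _) => [|i s IH]; last by rewrite !big_cons gvecD IH.
by rewrite !big_nil -[X in gvec _ _ _ _ X](scale0r 0) gvecZ scale0r.
Qed.

Lemma gvecB N d l m (u w : 'rV[R]_14) :
  gvec N d l m (u - w) = gvec N d l m u - gvec N d l m w.
Proof. by rewrite -scaleN1r gvecD gvecZ scaleN1r. Qed.

Lemma pnorm2_CS (a b c d : R) :
  a * c + (a * d + b * c) / 2 + b * d <= Num.sqrt (pnorm2 a b) * Num.sqrt (pnorm2 c d).
Proof.
rewrite -sqrtrM ?pnorm2_ge0 //; apply: le_trans (ler_norm _) _.
rewrite -sqrtr_sqr; apply: ler_wsqrtr; rewrite -subr_ge0.
have -> : pnorm2 a b * pnorm2 c d - (a * c + (a * d + b * c) / 2 + b * d) ^+ 2 =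
  3 / 4 * (a * d - b * c) ^+ 2 by rewrite /pnorm2; field.
by rewrite mulr_ge0 ?sqr_ge0 //; lra.
Qed.

End Norms.

Section Variation.
Variables (R : realType) (b beta : 'rV[R]_14).
Hypotheses (hb : in_cone b) (hbeta : tang b beta).
Local Notation K := (@cosk R).

(** Where [b] vanishes and [beta] does not, [beta] is positive and tolerates a small change of
    either sign; only where both vanish must [eta] be nonnegative. *)
Lemma tang_variation (k l : 'I_14) eta : adj k l -> in_supp (pred2 k l) b ->
  in_supp (pred2 k l) beta -> in_supp (pred2 k l) eta ->
  (forall z, b 0 z = 0 -> beta 0 z = 0 -> 0 <= eta 0 z) ->
  exists2 e0, 0 < e0 & forall e, 0 < e <= e0 -> tang b (beta + e *: eta).
Proof.
move=> akl sb sbeta seta heta.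
pose f z := if 0 < beta 0 z then beta 0 z / (1 + `|eta 0 z|) else 1.
have n1 (a : R) : 0 < 1 + `|a| by rewrite ltr_pwDl.
exists (\big[Num.min/1]_z f z).
  apply/bigmin_gtP; split=> // z _; rewrite /f; case: ifP => // h.
  by rewrite divr_gt0.
move=> e /andP[e0 /bigmin_geP[_ ef]].
have sv : in_supp (pred2 k l) (beta + e *: eta) by apply/in_suppD/in_suppZ.
split.
- move=> z bz; have [pb _ _] := hbeta; have bz0 := pb z bz; rewrite !mxE.
  have [bp|] := ltP 0 (beta 0 z); last first.
    move=> bn; have bz' : beta 0 z = 0 by apply/eqP; rewrite eq_le bn bz0.
    by rewrite bz' add0r mulr_ge0 ?(ltW e0) // heta.
  have := ef z isT; rewrite /f bp ler_pdivlMr // mulrDr mulr1 => h.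
  have : - (e * eta 0 z) <= e * `|eta 0 z|.
    by rewrite -mulrN ler_wpM2l ?(ltW e0) // -normrN ler_norm.
  by lra.
- exact: in_supp_clique sv.
- move=> z w zw azw; have : clique (b + (beta + e *: eta)).
    exact/(in_supp_clique akl)/in_suppD.
  have [Pz|/sb->] := boolP (pred2 k l z); last by rewrite mul0r.
  have [Pw|/sv->] := boolP (pred2 k l w); last by rewrite mulr0.
  have alk : adj l k by rewrite adj_sym.
  by case/orP: Pz Pw azw zw => /eqP-> /orP[] /eqP->; rewrite ?eqxx ?akl ?alk.
Qed.

Lemma first_variation_le n (x : 'I_n -> 'rV[R]_14) (t : 'I_n -> R) eta e0 :
  0 < e0 -> \sum_i t i = 1 ->
  (forall e, 0 < e <= e0 -> \sum_i t i * dst (x i) beta <=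
     \sum_i t i * dst (x i) (beta + e *: eta)) ->
  frm K eta (\sum_i t i *: (x i - beta)) <= 0.
Proof.
move=> e0_gt0 t1 h; set s := \sum_i _.
have key e : 0 < e <= e0 -> 2 * frm K eta s <= e * frm K eta eta.
  move=> he; have := h e he; have [ep _] := andP he.
  have -> : \sum_i t i * dst (x i) (beta + e *: eta) =
      \sum_i t i * dst (x i) beta - 2 * e * frm K eta s + e ^+ 2 * frm K eta eta.
    rewrite -[X in e ^+ 2 * X]mul1r -[X in X * frm K eta eta]t1 frm_sumr.
    rewrite !mulr_suml !mulr_sumr -sumrB -big_split.
    apply: eq_bigr => i _ /=; rewrite frmZr /dst.
    have -> : x i - (beta + e *: eta) = (x i - beta) - e *: eta by rewrite opprD addrA.
    rewrite [in LHS]frm_sub; last exact: cosk_sym.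
    rewrite (frm_sym (x i - beta) (e *: eta)); last exact: cosk_sym.
    by rewrite !frmZl !frmZr; ring.
  move=> h2; rewrite -(ler_pM2l ep) -subr_ge0.
  have -> : e * (e * frm K eta eta) - e * (2 * frm K eta s) =
    e ^+ 2 * frm K eta eta - 2 * e * frm K eta s by ring.
  by lra.
rewrite leNgt; apply/negP => pos.
set Q := frm K eta eta in key.
have n1 : 0 < 1 + `|Q| by rewrite ltr_pwDl.
(* Small enough that [e * Q] is at most the first-order term, contradicting the inequality with
   factor 2. *)
pose e := Num.min e0 (frm K eta s / (1 + `|Q|)).
have ep : 0 < e by rewrite lt_min e0_gt0 divr_gt0.
have := key e; rewrite ep ge_min lexx => /(_ isT) h1.
have : e * Q <= e * `|Q| by rewrite ler_pM2l // ler_norm.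
have : e <= frm K eta s / (1 + `|Q|) by rewrite ge_min lexx orbT.
by rewrite ler_pdivlMr // mulrDr mulr1; lra.
Qed.

End Variation.

(** * The three estimates, by kind of support *)

Section Bounds.
Variable R : realType.
Local Notation K := (@cosk R).
Implicit Types (u w s : 'rV[R]_14).

Lemma frm_delta_gram N d l m (i : 'I_14) u : frm (gramk N d l m) (delta_mx 0 i) u =
  \sum_(k < N) (d k)%:~R / m * (l k i)%:~R * glin l k u.
Proof.
rewrite frm_gram; apply: eq_bigr => k _; congr (_ * _ * _).
rewrite /glin (bigD1 i) //= mxE !eqxx mulr1 big1 ?addr0 // => j /negbTE ji.
by rewrite mxE ji andbF mulr0.
Qed.

Lemma frm_delta_l kk (i : 'I_14) u : frm kk (delta_mx 0 i) u = \sum_(z < 14) kk i z * u 0 z.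
Proof.
rewrite /frm (bigD1 i) //= [X in _ + X]big1 => [|k /negbTE ki]; last first.
  by apply: big1 => j _; rewrite mxE ki andbF mulr0 mul0r.
by rewrite addr0; apply: eq_bigr => z _; rewrite mxE !eqxx mulr1.
Qed.

(** The images of the two vertices are a basis of the plane, and the image of [s] is orthogonal to
    both. *)
Lemma fold_bound (i j : 'I_14) s : adj i j ->
  frm K (delta_mx 0 i) s = 0 -> frm K (delta_mx 0 j) s = 0 ->
  frm (gramk 2 fold_wt (fold_lin i j) 4) s s = 0.
Proof.
move=> aij hi hj; have fK := fold_folding R aij.
have sd (k : 'I_14) : pred2 i j k -> in_supp (pred2 i j) (delta_mx 0 k : 'rV[R]_14).
  move=> Pk l hl; rewrite mxE; case: eqP => //= _.
  by case: eqP => // e; rewrite e Pk in hl.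
have [sK _ _] := fK.
have gE (k : 'I_14) : pred2 i j k ->
    frm (gramk 2 fold_wt (fold_lin i j) 4) (delta_mx 0 k) s = frm K (delta_mx 0 k) s.
  move=> /sd dk; rewrite (frm_sym _ _ sK) (folding_supp fK _ dk).
  by apply: frm_sym; exact: cosk_sym.
have gi := gE i ltac:(by rewrite /= eqxx); have gj := gE j ltac:(by rewrite /= eqxx orbT).
rewrite hi in gi; rewrite hj in gj.
have pi0 : fold_pos i j i = (1, 0) by rewrite /fold_pos /gdist eqxx.
have pj0 : fold_pos i j j = (0, 1).
  by rewrite /fold_pos adj_gdist // {1}/gdist eqxx.
move: gi gj; rewrite !frm_delta_gram frm_gram !big_ord_recr !big_ord0 /=.
rewrite /fold_lin pi0 pj0 /fold_wt /= !add0r.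
set L0 := glin _ 0 s; set L1 := glin _ 1 s => gi gj.
have L00 : L0 = 0 by lra.
have L10 : L1 = 0 by move: gj; rewrite L00; lra.
by rewrite L00 L10 !mulr0 addr0.
Qed.

Section Book.
Variable i : 'I_14.

(** Up to the factor [sqrt 3 / 2], the distance from the binding contributed by page [j]. *)
Definition page_sum (j : nat) u : R :=
  \sum_(z < 14) (offaxis i z && (page i z == j))%:R * u 0 z.

Lemma page_sumD j u w : page_sum j (u + w) = page_sum j u + page_sum j w.
Proof. by rewrite /page_sum -big_split; apply: eq_bigr => z _; rewrite mxE mulrDr. Qed.

Lemma page_sumZ j a u : page_sum j (a *: u) = a * page_sum j u.
Proof. by rewrite /page_sum mulr_sumr; apply: eq_bigr => z _; rewrite mxE; ring. Qed.

Lemma page_sum_sum j n (x : 'I_n -> 'rV[R]_14) :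
  page_sum j (\sum_k x k) = \sum_k page_sum j (x k).
Proof.
elim: (index_enum _) => [|k r IH]; last by rewrite !big_cons page_sumD IH.
by rewrite !big_nil -(scale0r 0) page_sumZ mul0r.
Qed.

Lemma offaxis_self : offaxis i i = false.
Proof. by rewrite /offaxis /gdist eqxx. Qed.

Lemma page_sum_axis j u : in_supp (pred1 i) u -> page_sum j u = 0.
Proof.
move=> su; apply: big1 => z _; have [/eqP->|/su->] := boolP (pred1 i z); last by rewrite mulr0.
by rewrite offaxis_self mul0r.
Qed.

Lemma page_sum_ge0 j u : pos_off (pred1 i) u -> 0 <= page_sum j u.
Proof.
move=> pu; apply: sumr_ge0 => z _; have [/eqP->|/pu h] := boolP (pred1 i z).
  by rewrite offaxis_self mul0r.
by rewrite mulr_ge0 // ler0n.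
Qed.

Lemma page_cases z : (z < 14)%N -> offaxis i z ->
  [\/ page i z = 0%N, page i z = 1%N | page i z = 2%N].
Proof.
move=> z14 oz; have := page_lt (ltn_ord i) z14 oz.
by case: (page i z) => [|[|[|//]]] _; [constructor 1|constructor 2|constructor 3].
Qed.

Lemma book_lin1 u : glin (book_lin i) 1 u = 2 * page_sum 0 u - page_sum 1 u - page_sum 2 u.
Proof.
rewrite /glin /page_sum mulr_sumr -!sumrB; apply: eq_bigr => z _; rewrite /book_lin /=.
case: (boolP (offaxis i z)) => [oz|_] /=; last by ring.
by have [->|->|->] := page_cases (ltn_ord z) oz => /=; ring.
Qed.

Lemma book_lin2 u : glin (book_lin i) 2 u = page_sum 1 u - page_sum 2 u.
Proof.
rewrite /glin /page_sum -!sumrB; apply: eq_bigr => z _; rewrite /book_lin /=.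
case: (boolP (offaxis i z)) => [oz|_] /=; last by ring.
by have [->|->|->] := page_cases (ltn_ord z) oz => /=; ring.
Qed.

Lemma book_lin0 u : glin (book_lin i) 0 u = 2 * frm K (delta_mx 0 i) u.
Proof.
rewrite frm_delta_l mulr_sumr; apply: eq_bigr => z _; rewrite /book_lin /cosk /=.
by field.
Qed.

Lemma book_gramE u w : frm (gramk 3 book_wt (book_lin i) 16) u w =
  frm K (delta_mx 0 i) u * frm K (delta_mx 0 i) w
  + 3 / 16 * (2 * page_sum 0 u - page_sum 1 u - page_sum 2 u)
      * (2 * page_sum 0 w - page_sum 1 w - page_sum 2 w)
  + 9 / 16 * (page_sum 1 u - page_sum 2 u) * (page_sum 1 w - page_sum 2 w).
Proof.
rewrite frm_gram !big_ord_recr big_ord0 /= book_lin0 book_lin1 book_lin2.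
by rewrite book_lin0 book_lin1 book_lin2 /book_wt /=; field.
Qed.

(** Adjacent vertices off the axis lie on the same page, so a clique cannot meet two pages. *)
Lemma page_sum_disj j k u : clique u -> j != k -> page_sum j u * page_sum k u = 0.
Proof.
move=> cu jk; rewrite /page_sum mulr_suml big1 // => z _; rewrite mulr_sumr big1 // => w _.
have [/andP[oz /eqP pz]|_] := boolP (offaxis i z && (page i z == j)); last by rewrite !mul0r.
have [/andP[ow /eqP pw]|_] := boolP (offaxis i w && (page i w == k)); last by rewrite mul0r mulr0.
have zw : z != w by apply: contraNneq jk => zw; rewrite -pz -pw zw.
have azw : ~~ adj z w.
  apply: contraNN jk => azw; rewrite -pz -pw; apply/eqP.
  exact: page_adj (ltn_ord i) (ltn_ord z) (ltn_ord w) azw oz ow.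
by rewrite !mul1r cu.
Qed.

Definition height u := page_sum 0 u + page_sum 1 u + page_sum 2 u.

(** As [u] meets a single page, the products of its page sums vanish and only the squares remain in
    [book_gramE]. *)
Lemma height_le u beta : clique u -> in_supp (pred1 i) beta ->
  3 / 4 * height u ^+ 2 <= frm (gramk 3 book_wt (book_lin i) 16) (u - beta) (u - beta).
Proof.
move=> cu sb; rewrite book_gramE -scaleN1r !page_sumD !page_sumZ !(page_sum_axis _ sb).
rewrite !mulr0 !addr0 /height.
have := page_sum_disj (j := 0) (k := 1) cu isT; have := page_sum_disj (j := 0) (k := 2) cu isT.
have := page_sum_disj (j := 1) (k := 2) cu isT.
have := sqr_ge0 (frm K (delta_mx 0 i) (u + -1 *: beta)); rewrite expr2.
set A := page_sum 0 u; set B := page_sum 1 u; set C := page_sum 2 u; set D := _ * frm _ _ _.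
by move=> h1 h2 h3 h4; rewrite !sqrrD ?expr2; lra.
Qed.

(** Since the axis term is zero, [page_cos2] turns the condition on each neighbour into a triangle
    inequality: each of the page sums A, B, C is at most the sum of the other two. Multiplying these
    by A, B, C and adding gives [A^2 + B^2 + C^2 <= 2 (A B + B C + C A)], which is equivalent to the
    claim. *)
Lemma book_axis_le s : pos_off (pred1 i) s -> frm K (delta_mx 0 i) s = 0 ->
  (forall y : 'I_14, adj i y -> frm K (delta_mx 0 y) s <= 0) ->
  frm (gramk 3 book_wt (book_lin i) 16) s s <= 3 / 16 * height s ^+ 2.
Proof.
move=> ps s0 sy; rewrite book_gramE s0 mul0r add0r /height.
have A0 := page_sum_ge0 0 ps; have A1 := page_sum_ge0 1 ps; have A2 := page_sum_ge0 2 ps.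
have key j : (j < 3)%N -> \sum_(z < 14)
    (if offaxis i z then (if page i z == j then 1 else -1) else 0) * s 0 z <= 0 :> R.
  move=> j3; have [y14 aiy hy] := page_cos2 (ltn_ord i) j3.
  have e (z : 'I_14) : (cos2 (nth 0%N (nbr i) j) z)%:~R =
     ((cos2 i z)%:~R +
       (if offaxis i z then (if page i z == j then 3 else -3) else 0)) / 2 :> R.
    have /(congr1 (fun a : int => a%:~R : R)) := hy z (ltn_ord z).
    rewrite !rmorphD rmorphM /= => h; apply: (mulfI (x := 2)) => //.
    rewrite h; case: ifP => _; last by field.
    by case: ifP => _; field.
  have := sy (Ordinal y14) aiy; rewrite frm_delta_l.
  have -> : \sum_(z < 14) K (Ordinal y14) z * s 0 z = frm K (delta_mx 0 i) s / 2
     + 3 / 4 * \sum_(z < 14)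
         (if offaxis i z then (if page i z == j then 1 else -1) else 0) * s 0 z.
    rewrite frm_delta_l mulr_suml mulr_sumr -big_split; apply: eq_bigr => z _ /=.
    rewrite /cosk e; case: ifP => _; last by field.
    by case: ifP => _; field.
  by rewrite s0; lra.
have E0 : page_sum 0 s - page_sum 1 s - page_sum 2 s <= 0.
  apply: le_trans (key 0%N isT); rewrite /page_sum -!sumrB le_eqVlt; apply/orP; left.
  apply/eqP/eq_bigr => z _; case: (boolP (offaxis i z)) => [oz|_] /=; last by ring.
  by have [->|->|->] := page_cases (ltn_ord z) oz => /=; ring.
have E1 : page_sum 1 s - page_sum 0 s - page_sum 2 s <= 0.
  apply: le_trans (key 1%N isT); rewrite /page_sum -!sumrB le_eqVlt; apply/orP; left.
  apply/eqP/eq_bigr => z _; case: (boolP (offaxis i z)) => [oz|_] /=; last by ring.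
  by have [->|->|->] := page_cases (ltn_ord z) oz => /=; ring.
have E2 : page_sum 2 s - page_sum 0 s - page_sum 1 s <= 0.
  apply: le_trans (key 2%N isT); rewrite /page_sum -!sumrB le_eqVlt; apply/orP; left.
  apply/eqP/eq_bigr => z _; case: (boolP (offaxis i z)) => [oz|_] /=; last by ring.
  by have [->|->|->] := page_cases (ltn_ord z) oz => /=; ring.
move: A0 A1 A2 E0 E1 E2.
set A := page_sum 0 s; set B := page_sum 1 s; set C := page_sum 2 s => A0 B0 C0 E0 E1 E2.
have p0 : 0 <= A * (B + C - A) by rewrite mulr_ge0 //; lra.
have p1 : 0 <= B * (A + C - B) by rewrite mulr_ge0 //; lra.
have p2 : 0 <= C * (A + B - C) by rewrite mulr_ge0 //; lra.
by nra.
Qed.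

End Book.

Definition vnorm u : R := Num.sqrt (frm K u u).

Lemma apexkE (z w : 'I_14) : apexk R z w = nth 0 [:: 64; 32; -6; -17] (gdist z w) / 64.
Proof.
rewrite /apexk /gramk -/(apex_gram z w) apex_gramE // rmorphM /=.
have -> : (nth 0 [:: 64; 32; -6; -17] (gdist z w) : int)%:~R =
   (nth 0 [:: 64; 32; -6; -17] (gdist z w)) :> R.
  by case: (gdist z w) => [|[|[|[|n]]]] //=; rewrite ?rmorphN ?nth_nil.
by field.
Qed.

(* 19/32 = 1 - 13/32 *)
Definition apexh (z w : nat) : R := (apexk R z w - 19 / 32 * K z w) / (13 / 32).

Lemma apexhE (z w : 'I_14) : apexh z w = nth 0 [:: 1; 1/2; 1/2; 21/26] (gdist z w).
Proof.
rewrite /apexh apexkE /cosk /cos2.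
have : (gdist z w < 4)%N by rewrite /gdist; do 3!case: ifP => //.
by case: (gdist z w) => [|[|[|[|n]]]] //= _; field.
Qed.

Lemma apexh_le1 (z w : 'I_14) : apexh z w <= 1.
Proof. by rewrite apexhE; case: (gdist z w) => [|[|[|[|n]]]] /=; rewrite ?nth_nil; lra. Qed.

Lemma apexh_half (z w : 'I_14) : (gdist z w == 1%N) || (gdist z w == 2%N) -> apexh z w = 1 / 2.
Proof. by rewrite apexhE => /orP[] /eqP ->. Qed.

Lemma gdist_chambers (i j k l : 'I_14) : adj i j -> adj k l ->
  (((gdist i k == 1%N) || (gdist i k == 2%N)) && ((gdist j l == 1%N) || (gdist j l == 2%N))) ||
  (((gdist i l == 1%N) || (gdist i l == 2%N)) && ((gdist j k == 1%N) || (gdist j k == 2%N))).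
Proof.
pose Q (i j k l : nat) := 
  ((((gdist i k == 1) || (gdist i k == 2)) && ((gdist j l == 1) || (gdist j l == 2))) ||
  (((gdist i l == 1) || (gdist i l == 2)) && ((gdist j k == 1) || (gdist j k == 2))))%N.
move=> aij akl.
have /allb2/(_ i j (ltn_ord i) (ltn_ord j))/implyP/(_ aij) :
    allb 14 (fun i => allb 14 (fun j => adj i j ==>
      allb 14 (fun k => allb 14 (fun l => adj k l ==> Q i j k l)))).
  by vm_compute.
by move=> /allb2/(_ k l (ltn_ord k) (ltn_ord l))/implyP/(_ akl).
Qed.

(** After division by 13/32 the claim is that [apexh] is at most the product of the norms. One
    matching of the two chambers has entries 1/2 ([gdist_chambers]) and the other has entries at
    most 1, so [apexh] is dominated by a planar inner product in a basis at angle pi / 3, to which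
    Cauchy-Schwarz applies. *)
Lemma apex_pair u w : (forall z, 0 <= u 0 z) -> (forall z, 0 <= w 0 z) ->
  clique u -> clique w ->
  frm (apexk R) u w <= 13 / 32 * (vnorm u * vnorm w) + 19 / 32 * frm K u w.
Proof.
move=> u0 w0 cu cw.
have [i [j [aij su]]] := chamber1 cu; have [k [l [akl sw]]] := chamber1 cw.
suff h : frm apexh u w <= vnorm u * vnorm w.
  have e : frm apexh u w = (13 / 32)^-1 * (frm (apexk R) u w - 19 / 32 * frm K u w).
    rewrite -frm_kZ -frm_kB -frm_kZ; apply: eq_frm => z z'; rewrite /apexh mulrC //.
  by rewrite e ler_pdivrMl in h; lra.
rewrite /vnorm (frm_pair aij su) (frm_pair akl sw).
rewrite [X in frm _ X _](in_supp_pair (adj_ord_neq aij) su).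
rewrite [X in frm _ _ X](in_supp_pair (adj_ord_neq akl) sw) !frmE !frm_delta.
have := apexh_le1 i k; have := apexh_le1 i l; have := apexh_le1 j k; have := apexh_le1 j l.
move: (u0 i) (u0 j) (w0 k) (w0 l).
set a := u 0 i; set b := u 0 j; set c := w 0 k; set d := w 0 l => a0 b0 c0 d0 g4 g3 g2 g1.
have ac : 0 <= a * c by rewrite mulr_ge0.
have ad : 0 <= a * d by rewrite mulr_ge0.
have bc : 0 <= b * c by rewrite mulr_ge0.
have bd : 0 <= b * d by rewrite mulr_ge0.
have := gdist_chambers aij akl => /orP[] /andP[/apexh_half h1 /apexh_half h2].
- have := pnorm2_CS a b d c; rewrite /pnorm2.
  have -> : d ^+ 2 + d * c + c ^+ 2 = c ^+ 2 + c * d + d ^+ 2 by ring.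
  apply: le_trans; rewrite h1 h2.
  have t1 : a * d * apexh i l <= a * d * 1 by rewrite ler_wpM2l.
  have t2 : b * c * apexh j k <= b * c * 1 by rewrite ler_wpM2l.
  by lra.
- have := pnorm2_CS a b c d; rewrite /pnorm2; apply: le_trans; rewrite h1 h2.
  have t1 : a * c * apexh i k <= a * c * 1 by rewrite ler_wpM2l.
  have t2 : b * d * apexh j l <= b * d * 1 by rewrite ler_wpM2l.
  by lra.
Qed.

End Bounds.

(** * Realizations from foldings, and the bound for one configuration *)

Section DeltaBound.
Variables (R : realType) (side : R) (T : Type) (d : T -> T -> R).
Variables (b : 'rV[R]_14) (F : T -> 'rV[R]_14).
Hypothesis side_gt0 : 0 < side.
Hypothesis hb : in_cone b.
Hypothesis F_tang : forall A, tang b (F A).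
Hypothesis F_ex : forall m, tang b m -> exists A, F A = m.
Hypothesis F_dist : forall A B, d A B = side * Num.sqrt (dst (F A) (F B)).
Variables (n : nat) (v : 'I_n -> T) (t : 'I_n -> R) (q : T).
Hypothesis t_gt0 : forall i, 0 < t i.
Hypothesis t_sum : \sum_i t i = 1.
Hypothesis q_bary : is_barycenter d v t q.

Local Notation K := (@cosk R).
Let x i := F (v i).
Let beta := F q.
Let s := \sum_i t i *: (x i - beta).

Let x_tang i : tang b (x i). Proof. exact: F_tang. Qed.
Let beta_tang : tang b beta. Proof. exact: F_tang. Qed.
Let x_clique i : clique (x i). Proof. by case: (x_tang i). Qed.

Let bary_le eta (k l : 'I_14) : adj k l -> in_supp (pred2 k l) b ->
  in_supp (pred2 k l) beta -> in_supp (pred2 k l) eta ->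
  (forall z, b 0 z = 0 -> beta 0 z = 0 -> 0 <= eta 0 z) -> frm K eta s <= 0.
Proof.
move=> akl sb sbeta seta eta0.
have [e0 e0_gt0 he] := tang_variation beta_tang akl sb sbeta seta eta0.
apply: (first_variation_le e0_gt0 t_sum) => e /he ht; have [q' q'E] := F_ex ht.
rewrite -q'E -(ler_pM2l (x := side ^+ 2)) ?exprn_gt0 // !mulr_sumr.
have dE A i : side ^+ 2 * (t i * dst (x i) (F A)) = t i * d (v i) A ^+ 2.
  rewrite F_dist exprMn sqr_sqrtr; first by rewrite mulrCA.
  by apply: (tang_frm_ge0 hb).
under eq_bigr do rewrite dE; under [X in _ <= X]eq_bigr do rewrite dE.
have [->//|/q_bary/ltW//] := pselect (q' = q).
Qed.

(** The realization is [gvec] applied to the [x i - beta]. Its norms are exact because [beta] is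
    supported in [P], and it does not expand because coordinates of tangent vectors can be negative
    only on the support of [b]. *)
Let delta_at_le (P : pred 'I_14) N wt l (m kappa : R) :
  (forall k, (k < N)%N -> 0 <= wt k) -> 0 <= m -> folding P (gramk N wt l m) ->
  in_supp P b -> in_supp P beta -> 0 <= kappa ->
  frm (gramk N wt l m) s s <=
    kappa * \sum_i t i * frm (gramk N wt l m) (x i - beta) (x i - beta) ->
  (delta_at d v t q <= kappa%:E)%E.
Proof.
move=> wt0 m0 fK sb sbeta kappa0 hs; set G := gramk N wt l m in fK hs.
have [sG pG _] := fK.
pose w i := side *: gvec N wt l m (x i - beta).
have wE i : eucl_norm (w i) = side * Num.sqrt (frm G (x i - beta) (x i - beta)).
  by rewrite eucl_normZ ?(ltW side_gt0) // eucl_gvec.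
apply: ge_ereal_inf; exists (realization_ratio t w)%:E.
  exists N, w; split=> //; split=> i.
    by rewrite wE F_dist (folding_eq fK) // frm_subC.
  move=> j; rewrite /w -scalerBr -gvecB eucl_normZ ?(ltW side_gt0) // eucl_gvec //.
  have -> : x i - beta - (x j - beta) = x i - x j by rewrite opprB addrA subrK.
  rewrite F_dist ler_pM2l //; apply: ler_wsqrtr.
  by apply: (folding_le fK) => //; exact: tang_pos_off sb (x_tang _).
rewrite lee_fin /realization_ratio.
have -> : \sum_i t i *: w i = side *: gvec N wt l m s.
  rewrite /s gvec_sum scaler_sumr; apply: eq_bigr => i _.
  by rewrite gvecZ !scalerA mulrC.
rewrite eucl_normZ ?(ltW side_gt0) // eucl_gvec // exprMn sqr_sqrtr //.
have -> : \sum_i t i * eucl_norm (w i) ^+ 2 =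
    side ^+ 2 * \sum_i t i * frm G (x i - beta) (x i - beta).
  rewrite mulr_sumr; apply: eq_bigr => i _.
  by rewrite wE exprMn sqr_sqrtr // mulrCA.
set D := \sum_i _ in hs *.
have D0 : 0 <= D by apply: sumr_ge0 => i _; rewrite mulr_ge0 // ltW.
(* If the denominator vanishes, the ratio is 0 by the convention on division. *)
move: D0; rewrite le_eqVlt => /orP[/eqP <-|D0]; first by rewrite mulr0 invr0 mulr0.
rewrite ler_pdivrMr ?mulr_gt0 ?exprn_gt0 // mulrCA.
by rewrite ler_pM2l ?exprn_gt0.
Qed.

Lemma delta_at_bound : (delta_at d v t q <= (13 / 32)%:E)%E.
Proof.
have [i [j [aij sb sbeta]]] := tang_chamber hb beta_tang.
have aji : adj j i by rewrite adj_sym.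
(* Coordinates in which [beta] can be moved both ways; the two signs give equality in the first
   variation ([zeroD]). *)
pose S z := (b 0 z != 0) || (beta 0 z != 0).
have sd (k l z : 'I_14) : pred2 k l z -> in_supp (pred2 k l) (delta_mx 0 z : 'rV[R]_14).
  move=> Pz w hw; rewrite mxE; case: eqP => //= _.
  by case: eqP => // e; rewrite e Pz in hw.
have sN (P : pred 'I_14) (u : 'rV[R]_14) : in_supp P u -> in_supp P (- u).
  by move=> su z hz; rewrite mxE su ?oppr0.
have zeroD (k l z : 'I_14) : adj k l -> in_supp (pred2 k l) b -> in_supp (pred2 k l) beta ->
    pred2 k l z -> S z -> frm K (delta_mx 0 z) s = 0.
  move=> akl skb skbeta Pz Sz; apply/eqP; rewrite eq_le; apply/andP; split.
    apply: (bary_le akl) => //; first exact: sd.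
    by move=> y by0 bey; rewrite mxE ler0n.
  rewrite -oppr_le0 -frmNl; apply: (bary_le akl) => //; first by apply/sN/sd.
  move=> y by0 bey; rewrite !mxE eqxx /=; case: eqP => [e|_]; last by rewrite oppr0.
  by move: Sz; rewrite /S -e by0 bey eqxx.
have one_axis (k l : 'I_14) : adj k l -> in_supp (pred2 k l) b -> in_supp (pred2 k l) beta ->
    S k -> ~~ S l -> (delta_at d v t q <= (13 / 32)%:E)%E.
  move=> akl skb skbeta Sk Sl.
  have [bl bel] : b 0 l = 0 /\ beta 0 l = 0.
    by move: Sl; rewrite negb_or !negbK => /andP[/eqP ? /eqP].
  have s1 (u : 'rV[R]_14) : in_supp (pred2 k l) u -> u 0 l = 0 -> in_supp (pred1 k) u.
    move=> su ul z zk; have [/orP[|]|/su//] := boolP (pred2 k l z).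
      by move=> zk'; rewrite /= zk' in zk.
    by move=> /eqP->.
  have sb1 := s1 _ skb bl; have sbe1 := s1 _ skbeta bel.
  have s2 (u : 'rV[R]_14) y : in_supp (pred1 k) u -> in_supp (pred2 k y) u.
    by move=> su z /= h; apply: su; move: h; rewrite negb_or => /andP[].
  have fK := book_folding R k.
  apply: (delta_at_le _ _ fK sb1 sbe1); [by case=> [|[|[|]]]|exact: ler0n|lra|].
  have ps : pos_off (pred1 k) s.
    move=> z hz; rewrite summxE; apply: sumr_ge0 => a _.
    rewrite !mxE (sbe1 _ hz) subr0 mulr_ge0 ?(ltW (t_gt0 _)) //.
    exact: (tang_pos_off sb1 (x_tang a)).
  have h1 : frm K (delta_mx 0 k) s = 0 by apply: (zeroD k l) => //=; rewrite eqxx.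
  have h2 (y : 'I_14) : adj k y -> frm K (delta_mx 0 y) s <= 0.
    move=> aky; apply: (bary_le aky); [exact: s2|exact: s2|by apply: sd; rewrite /= eqxx orbT|].
    by move=> z _ _; rewrite mxE ler0n.
  apply: le_trans (book_axis_le ps h1 h2) _.
  have -> : height k s = \sum_a t a * height k (x a).
    have e r : page_sum k r s = \sum_a t a * page_sum k r (x a).
      rewrite /s page_sum_sum; apply: eq_bigr => a _.
      by rewrite page_sumZ -scaleN1r page_sumD page_sumZ (page_sum_axis r sbe1) mulr0 addr0.
    by rewrite /height !e -!big_split; apply: eq_bigr => a _ /=; ring.
  have := jensen_sq (fun a => height k (x a)) t_gt0 t_sum.
  have : \sum_a t a * (3 / 4 * height k (x a) ^+ 2) <=
      \sum_a t a * frm (gramk 3 book_wt (book_lin k) 16) (x a - beta) (x a - beta).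
    by apply: ler_sum => a _; rewrite ler_pM2l // height_le.
  under eq_bigr do rewrite mulrCA; rewrite -mulr_sumr.
  have := sqr_ge0 (\sum_a t a * height k (x a)).
  set A := \sum_a t a * height k (x a) ^+ 2; set C := (\sum_a _) ^+ 2.
  (* The two constants 3/16 and 3/4 have quotient 1/4, which is at most 13/32. *)
  set G := \sum_a _; lra.
have [Si|Si] := boolP (S i); have [Sj|Sj] := boolP (S j).
- have fK := fold_folding R aij.
  apply: (delta_at_le _ _ fK sb sbeta); [by case=> [|[|]]|exact: ler0n|lra|].
  rewrite (fold_bound aij) ?(zeroD i j) //= ?eqxx ?orbT //.
  have [_ pK _] := fK.
  apply: mulr_ge0; first lra.
  by apply: sumr_ge0 => a _; rewrite mulr_ge0 // ltW.
- exact: (one_axis i j).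
- apply: (one_axis j i) => //.
    by move=> z; rewrite /= orbC; exact: sb.
  by move=> z; rewrite /= orbC; exact: sbeta.
have z0 (u : 'rV[R]_14) : in_supp (pred2 i j) u -> u 0 i = 0 -> u 0 j = 0 -> u = 0.
  move=> su ui uj; apply/rowP => z; rewrite mxE.
  by have [/orP[] /eqP->|/su] := boolP (pred2 i j z).
move: Si Sj; rewrite !negb_or !negbK => /andP[/eqP bi /eqP bei] /andP[/eqP bj /eqP bej].
have b0 := z0 _ sb bi bj; have beta0 := z0 _ sbeta bei bej.
have sup0 (P : pred 'I_14) (u : 'rV[R]_14) : u = 0 -> in_supp P u by move=> -> z _; rewrite mxE.
have fK := apex_folding R; have [sG pG _] := fK.
apply: (delta_at_le _ _ fK); [|by rewrite mulr_ge0 ?ler0n|exact: sup0|exact: sup0|lra|].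
  by move=> k _; exact: apex_wt_ge0.
rewrite -/(apexk R).
have x_ge0 a z : 0 <= x a 0 z by have [h _ _] := x_tang a; apply: h; rewrite b0 mxE.
have sE : s = \sum_a t a *: x a by apply: eq_bigr => a _; rewrite beta0 subr0.
(* At the apex each [x a] is itself an admissible variation of the barycenter, and averaging the
   first variations gives the sign. *)
have ss0 : frm K s s <= 0.
  rewrite {1}sE frm_suml; apply: sumr_le0 => a _; rewrite frmZl pmulr_rle0 //.
  have [k [l [akl sx]]] := chamber1 (x_clique a).
  by apply: (bary_le akl); [exact: sup0|exact: sup0|exact: sx|move=> z _ _; exact: x_ge0].
have bound : frm (apexk R) s s <=
    13 / 32 * (\sum_a t a * vnorm (x a)) ^+ 2 + 19 / 32 * frm K s s.
  rewrite [in X in _ + X]sE [X in frm (apexk R) X _]sE [X in frm (apexk R) _ X]sE.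
  rewrite !frm_suml expr2 mulr_suml !mulr_sumr -big_split; apply: ler_sum => a _ /=.
  rewrite !frm_sumr !mulr_sumr -big_split; apply: ler_sum => c _ /=.
  rewrite !frmZl !frmZr.
  have tt : 0 < t a * t c by rewrite mulr_gt0.
  have h := apex_pair (x_ge0 a) (x_ge0 c) (x_clique a) (x_clique c).
  by rewrite -(ler_pM2l tt) in h; lra.
have := jensen_sq (fun a => vnorm (x a)) t_gt0 t_sum.
have -> : \sum_a t a * vnorm (x a) ^+ 2 = \sum_a t a * frm (apexk R) (x a - beta) (x a - beta).
  apply: eq_bigr => a _; rewrite beta0 subr0 (folding_diag fK) // /vnorm sqr_sqrtr //.
  by rewrite -(folding_diag fK) //; exact: pG.
by lra.
Qed.

End DeltaBound.

(** The fraction 17/12 is an upper convergent of [sqrt 2]; substituting it leaves 23/56, which still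
    exceeds 13/32. *)
Lemma bound_sqrt2 (R : realType) : 13 / 32 <= (37 - 18 * Num.sqrt 2) / 28 :> R.
Proof.
have s2 : Num.sqrt 2 ^+ 2 = 2 :> R by rewrite sqr_sqrtr.
have s0 : 0 <= Num.sqrt 2 :> R by exact: sqrtr_ge0.
have : Num.sqrt 2 <= 17 / 12 :> R.
  have h : 0 <= 17 / 12 :> R by lra.
  by rewrite -(ler_pXn2r (n := 2)) ?nnegrE // s2; lra.
by lra.
Qed.

Theorem mainTheorem6 (R : realType) (side : R) (side_gt0 : (0 < side)%R)
    (p : building R) :
  (delta (tangent_cone_dist (building_dist side) p)
   <= ((37%:R - 18%:R * Num.sqrt 2%:R) / 28%:R)%:E)%E.
Proof.
have [b [F [hb F_tang F_ex F_dist]]] := tangent_cone_model p side_gt0.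
apply: ge_ereal_sup => _ [n [v [t [q [_ t_gt0 t_sum q_bary ->]]]]].
apply: le_trans (delta_at_bound side_gt0 hb F_tang F_ex F_dist t_gt0 t_sum q_bary) _.
by rewrite lee_fin bound_sqrt2.
Qed.
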